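(* There is an absolute constant $C>0$ such that the following holds. Let $n\ge2$, let $\{\xi_{jk}\}_{1\le j\le k\le n}$ be independent real random variables with $\mathbf{E}\xi_{jk}=0$ and $\mathrm{Var}(\xi_{jk})=1$, put $\xi_{kj}=\xi_{jk}$, and let $X_1\le\cdots\le X_n$ be the eigenvalues, in increasing order, of the random symmetric matrix $\left(\frac1{\sqrt n}\xi_{jk}\right)_{1\le j,k\le n}$. Let $F_n$ be the empirical distribution function of $X_1,\dots,X_n$, let $F=\mathbf{E}F_n$, and let $G$ be the distribution function of the semicircle law with mean zero and variance one. If the distributions of all the $\xi_{jk}$ satisfy the Poincaré-type inequality $\mathrm{PI}(\sigma^2)$ on the real line, then $$\mathbf{E}\int_{-\infty}^{+\infty}|F_n(x)-F(x)|\,dx\le\frac{C\sigma}{n^{2/3}}.$$ Moreover, if the distributions of all the $\xi_{jk}$ satisfy $\mathrm{LSI}(\sigma^2)$ on the real line, then $$\mathbf{E}\|F_n-G\|\le C\left(\frac\sigma n\right)^{2/3}\log^{1/3}n+\|F-G\|.$$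
   Context: $F_n(x)=\frac1n\,\mathrm{card}\{i\le n:X_i\le x\}$ and $F(x)=\mathbf{E}F_n(x)$, $x\in\mathbf{R}$. $\|H_1-H_2\|=\sup_{x\in\mathbf{R}}|H_1(x)-H_2(x)|$ is the Kolmogorov distance. $G$ has density $g(x)=\frac1{2\pi}\sqrt{4-x^2}$ on $(-2,2)$ and $0$ elsewhere. A probability measure $\nu$ on $\mathbf{R}$ satisfies $\mathrm{PI}(\sigma^2)$ ($\sigma\ge0$) if $\mathrm{Var}_\nu(g)\le\sigma^2\int|g'|^2\,d\nu$ for all bounded smooth $g$ on $\mathbf{R}$, where $\mathrm{Var}_\nu(g)=\int g^2\,d\nu-(\int g\,d\nu)^2$; it satisfies $\mathrm{LSI}(\sigma^2)$ if $\mathrm{Ent}_\nu(g^2)\le2\sigma^2\int|g'|^2\,d\nu$ for all bounded smooth $g$ on $\mathbf{R}$, where $\mathrm{Ent}_\nu(h)=\int h\log h\,d\nu-\int h\,d\nu\,\log\int h\,d\nu$ for $h\ge0$. The constant $\sigma^2$ is common to all $\xi_{jk}$. *)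

(* Defs.v *)
From mathcomp Require Export all_boot all_order all_algebra.
From mathcomp Require Export all_classical all_reals all_analysis.

Set Implicit Arguments.
Unset Strict Implicit.
Unset Printing Implicit Defensive.

Export Order.TTheory GRing.Theory Num.Theory.
Export numFieldNormedType.Exports.

Local Open Scope classical_set_scope.
Local Open Scope ring_scope.

(* Mutual independence of the finite subfamily (X i)_{i in D}. *)
Definition mutually_independent d (T : measurableType d) (R : realType)
    (P : probability T R) (I : finType) (D : {set I}) (X : I -> {RV P >-> R}) :=
  forall (J : {set I}) (B : I -> set R),
    J \subset D -> (forall i, i \in J -> measurable (B i)) ->
    P (\bigcap_(i in [set` J]) (X i @^-1` B i)) =
    (\prod_(i in J) P (X i @^-1` B i))%E.

(* X lists the eigenvalues of A in increasing order, with multiplicity. *)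
Definition ordered_eigenvalues (R : realType) n (A : 'M[R]_n)
    (X : 'I_n -> R) : Prop :=
  (forall i j : 'I_n, (i <= j)%N -> X i <= X j) /\
  char_poly A = \prod_(i < n) ('X - (X i)%:P).

Definition normalized_matrix (T : Type) (R : realType) n
    (xi : 'I_n -> 'I_n -> T -> R) (w : T) : 'M[R]_n :=
  \matrix_(j < n, k < n) ((Num.sqrt n%:R)^-1 * xi j k w).

Definition empirical_df (R : realType) n (X : 'I_n -> R) (x : R) : R :=
  n%:R^-1 * #|[set i : 'I_n | X i <= x]%SET|%:R.

Definition mean_empirical_df d (T : measurableType d) (R : realType)
    (P : probability T R) n (X : 'I_n -> T -> R) (x : R) : R :=
  fine ('E_P[fun w => empirical_df (X^~ w) x])%E.

Definition semicircle_pdf (R : realType) (x : R) : R :=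
  if (-2 < x) && (x < 2) then (2 * pi)^-1 * Num.sqrt (4 - x ^+ 2) else 0.

Definition semicircle_df (R : realType) (x : R) : R :=
  \int[lebesgue_measure]_(t in `]-oo, x]) semicircle_pdf t.

Definition kolmogorov_dist (R : realType) (H1 H2 : R -> R) : \bar R :=
  ereal_sup (range (fun x => `|H1 x - H2 x|%:E)).

Definition smooth (R : realType) (g : R -> R) : Prop :=
  forall (k : nat) (x : R), derivable (derive1n k g) x 1.

Definition Var (R : realType) (nu : probability R R)
    (g : R -> R) : R :=
  \int[nu]_x (g x ^+ 2) - (\int[nu]_x g x) ^+ 2.

(* ln 0 = 0, so 0 log 0 = 0 here. *)
Definition Ent (R : realType) (nu : probability R R)
    (h : R -> R) : R :=
  \int[nu]_x (h x * ln (h x)) - (\int[nu]_x h x) * ln (\int[nu]_x h x).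

(* g' need not be bounded, so the energy is an extended real. *)
Definition energy (R : realType) (nu : probability R R)
    (g : R -> R) : \bar R :=
  (\int[nu]_x (`|derive1 g x| ^+ 2)%:E)%E.

(* PI and LSI take sigma, not sigma ^+ 2, as their parameter. *)
Definition PI (R : realType) (sigma : R)
    (nu : probability R R) : Prop :=
  forall g : R -> R, smooth g -> bounded_fun g ->
    ((Var nu g)%:E <= (sigma ^+ 2)%:E * energy nu g)%E.

Definition LSI (R : realType) (sigma : R)
    (nu : probability R R) : Prop :=
  forall g : R -> R, smooth g -> bounded_fun g ->
    ((Ent nu (fun x => (g x) ^+ 2))%:E <=
       (2 * sigma ^+ 2)%:E * energy nu g)%E.

(* Main.v *)
Require Import Defs.
From mathcomp Require Import complex spectral.
From mathcomp Require Import measurable_realfun lebesgue_integral_under.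
From mathcomp Require Import ring lra zify.

(** Both bounds rest on one device: the counting function of the eigenvalues is
    replaced by a linear statistic of a smooth step of width h, the concentration
    inequality for independent entries is applied to that statistic, and h is
    chosen at the end.

    Write S(phi) for the mean of phi over the eigenvalues. As a function of the
    entries on and above the diagonal it has a gradient whose squared length is
    at most 2 n^-2 S(phi'^2) ([spectral_grad_sqr]); that phi(A) has derivative
    tr (phi'(A) .) up to a quadratic error comes from Klein's identity
    ([trace_fun_taylor]). For a step of width h the square phi'^2 is at most
    9/4 h^-2 on a window of length h and vanishes elsewhere, so the squared
    gradient is of order n^-2 h^-2 times the mass of that window. This
    self-improving factor is what turns the exponent 1/2 into 2/3.

    Under the Poincare inequality, tensorized to the product measure
    ([product_poincare]), the variance of the smoothed counting function at level
    x is thus of order sigma^2 n^-2 h^-2 times the mean mass m_h(x) of a window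
    at x, while smoothing costs m_h(x) itself. The arithmetic-geometric
    inequality, with the integrable weight 1/(1 + x^2), bounds the mean deviation
    at x by quantities linear in m_h(x) ([mean_deviation]). Integrated over x, a
    window contributes its length h, and the weight 1 + x^2 on the other side is
    absorbed by the second moment of the spectrum, which is 1
    ([mean_variation_L1]). Taking h = n^(-2/3) gives the first bound; here
    sigma >= 1 because the entries have variance 1 ([spectral_gap_ge1]).

    Under the logarithmic Sobolev inequality, Herbst's argument is run along a
    family that moves with the exponent: while t grows from 0 to h, the profile
    of the step is swept by the distance t. The energy term in the differential
    inequality for E exp(kappa t u_t) is the squared gradient, and by the above it
    is dominated by the rate at which u_t decreases; so the sweep pays for it
    ([exponential_moment], [spectral_mean_exp_decrease]). The outcome is that
    lambda times the excess of the counting function over its mean, shifted by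
    2h, has exponential moment at most 1, with lambda of order n^2 h^2 / sigma^2.
    A log-sum-exp bound over a grid of levels of mesh h in [-2, 2], the monotonicity of
    the distribution functions and the boundedness of the semicircle density
    ([kolmogorov_grid]) give the supremum, at the cost of a multiple of
    h + log n / lambda; the two terms balance for h^3 = (sigma / n)^2 log n
    ([optimal_scale]).

    The functional inequalities are assumed for bounded smooth functions only.
    They are extended by Gaussian convolution ([taylor1_smooth_approx]) to
    bounded functions with a uniformly quadratic first-order remainder, the class
    [taylor1], in which all the functions above live. *)

Set Implicit Arguments.
Unset Strict Implicit.
Unset Printing Implicit Defensive.

Local Open Scope classical_set_scope.
Local Open Scope ring_scope.

(** * Orthogonal diagonalization of real symmetric matrices *)

(** The complexified matrix has an eigenvector p + i q with eigenvalue a + i b.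
    Since A is symmetric, (p A) q^T = p (A q^T) gives b (|p|^2 + |q|^2) = 0, so
    b = 0 and whichever of p, q is nonzero is a real eigenvector. *)
Lemma symmetric_eigenvector (R : rcfType) n (A : 'M[R]_n.+1) :
  A^T = A -> exists a (v : 'rV[R]_n.+1), v *m v^T = 1%:M /\ v *m A = a *: v.
Proof.
move=> As.
have [[a b] /eigenvalueP [v vA v0]] := eigenvalue_closed (map_mx (real_complex R) A) isT.
pose p : 'rV[R]_n.+1 := map_mx (@complex.Re R) v.
pose q : 'rV[R]_n.+1 := map_mx (@complex.Im R) v.
have pA : p *m A = a *: p - b *: q.
  apply/rowP => j; move/rowP: vA => /(_ j) /(congr1 (@complex.Re R)).
  rewrite !mxE raddf_sum /=.
  under eq_bigr => k _ do rewrite !mxE.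
  rewrite [X in X = _ -> _](_ : _ = \sum_j0 p 0 j0 * A j0 j).
    by move=> ->; case: (v 0 j).
  apply: eq_bigr => k _; rewrite !mxE; case: (v 0 k) => x y /=.
  by rewrite mulr0 subr0.
have qA : q *m A = b *: p + a *: q.
  apply/rowP => j; move/rowP: vA => /(_ j) /(congr1 (@complex.Im R)).
  rewrite !mxE raddf_sum /=.
  under eq_bigr => k _ do rewrite !mxE.
  rewrite [X in X = _ -> _](_ : _ = \sum_j0 q 0 j0 * A j0 j).
    by move=> ->; case: (v 0 j) => x y /=; rewrite addrC.
  apply: eq_bigr => k _; rewrite !mxE; case: (v 0 k) => x y /=.
  by rewrite mulr0 add0r.
have dotE (u : 'rV[R]_n.+1) : (u *m u^T) 0 0 = \sum_i u 0 i ^+ 2.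
  by rewrite mxE; apply: eq_bigr => i _; rewrite mxE expr2.
have dot_gt0 (u : 'rV[R]_n.+1) : u != 0 -> 0 < (u *m u^T) 0 0.
  move=> /rV0Pn [i ui0]; rewrite dotE (bigD1 i) //= ltr_pwDl //.
    by rewrite exprn_even_gt0.
  by apply: sumr_ge0 => k _; apply: sqr_ge0.
have dot_ge0 (u : 'rV[R]_n.+1) : 0 <= (u *m u^T) 0 0.
  by rewrite dotE; apply: sumr_ge0 => k _; apply: sqr_ge0.
have b0 : b = 0.
  have e : p *m A *m q^T = (q *m A *m p^T)^T.
    by rewrite !trmx_mul trmxK As mulmxA.
  move: e; rewrite pA qA !mulmxDl mulNmx -!scalemxAl.
  have qp : q *m p^T = (p *m q^T)^T by rewrite trmx_mul trmxK.
  rewrite linearD /= !linearZ /= qp trmxK.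
  have key (X Y Z : 'M[R]_1) :
      a *: Z - b *: Y = b *: X^T + a *: Z -> b * (X 0 0 + Y 0 0) = 0.
    by move=> /matrixP /(_ 0 0); rewrite !mxE; lra.
  rewrite scalerN => /key e.
  have pq0 : (p != 0) || (q != 0).
    apply: contra_neqT v0; rewrite negb_or !negbK => /andP [/eqP p0 /eqP q0].
    apply/rowP => i; move/rowP: p0 => /(_ i); move/rowP: q0 => /(_ i).
    by rewrite !mxE; case: (v 0 i) => x y /= -> ->.
  have pos : 0 < (p *m p^T) 0 0 + (q *m q^T) 0 0.
    by case/orP: pq0 => /dot_gt0 ?; [rewrite ltr_pwDl | rewrite ltr_wpDl].
  by move: e => /eqP; rewrite mulf_eq0 (gt_eqF pos) orbF => /eqP.
have [u [u0 uA]] : exists u : 'rV[R]_n.+1, u != 0 /\ u *m A = a *: u.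
  have [p0|p0] := eqVneq p 0; last first.
    by exists p; rewrite p0 pA b0 scale0r subr0.
  exists q; rewrite qA b0 scale0r add0r; split=> //.
  apply: contra_neq v0 => q0.
  apply/rowP => i; move/rowP: p0 => /(_ i); move/rowP: q0 => /(_ i).
  by rewrite !mxE; case: (v 0 i) => x y /= -> ->.
have d0 := dot_gt0 _ u0.
exists a, ((Num.sqrt ((u *m u^T) 0 0))^-1 *: u); split; last first.
  by rewrite -scalemxAl uA !scalerA mulrC.
set d := (u *m u^T) 0 0 in d0 *.
have ud : u *m u^T = d%:M by exact: mx11_scalar.
rewrite linearZ /= -scalemxAl -scalemxAr scalerA ud scale_scalar_mx.
by rewrite -invfM -expr2 sqr_sqrtr ?ltW // mulVf // gt_eqF.
Qed.

(** The Householder reflection in the hyperplane orthogonal to delta_0 - v. *)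
Lemma householder (R : rcfType) n (v : 'rV[R]_n.+1) : v *m v^T = 1%:M ->
  exists H : 'M[R]_n.+1, [/\ H^T = H, H *m H = 1%:M & delta_mx 0 0 *m H = v].
Proof.
move=> vv; pose e : 'rV[R]_n.+1 := delta_mx 0 0; pose u := e - v.
have ee : e *m e^T = 1%:M .
  by rewrite /e trmx_delta mul_delta_mx; apply/matrixP => i j; rewrite !ord1 !mxE eqxx.
have [u0|u0] := eqVneq u 0.
  exists 1%:M; rewrite trmx1 mulmx1; split => //.
  by rewrite mulmx1; apply/eqP; rewrite -subr_eq0 -/e -/u u0.
pose c := v 0 0.
have ev : e *m v^T = c%:M by rewrite [LHS]mx11_scalar -rowE !mxE.
have ve : v *m e^T = c%:M by rewrite -[LHS]trmxK trmx_mul trmxK ev tr_scalar_mx.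
have uu : u *m u^T = (2 * (1 - c))%:M.
  rewrite /u linearB /= mulmxBl !mulmxBr ee ev ve vv -!raddfB /=.
  by congr (_%:M); ring.
have c1 : 1 - c != 0.
  apply: contra_neq u0 => c1; move: uu; rewrite c1 mulr0.
  move=> /matrixP/(_ 0 0); rewrite !mxE eqxx /= => s0.
  have s0' : \sum_j u 0 j ^+ 2 = 0.
    by rewrite -[RHS]s0; apply: eq_bigr => j _; rewrite [u^T _ _]mxE expr2.
  apply/rowP => j; rewrite [RHS]mxE.
  have /(_ s0') z0 := psumr_eq0P (fun (j : 'I_n.+1) (_ : true) => sqr_ge0 (u 0 j)).
  by apply/eqP; rewrite -[_ == _](sqrf_eq0 (u 0 j)) (z0 j).
have eu : e *m u^T = (1 - c)%:M by rewrite /u linearB /= mulmxBr ee ev -raddfB.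
have vE : v = e - u by rewrite /u opprB addrCA subrr addr0.
rewrite -/e; clearbody u e.
exists (1%:M - (1 - c)^-1 *: (u^T *m u)); split.
- by rewrite linearB /= trmx1 linearZ /= trmx_mul trmxK.
- rewrite mulmxBl mul1mx mulmxBr mulmx1 -scalemxAl -scalemxAr.
  rewrite -mulmxA (mulmxA u) uu mul_scalar_mx -scalemxAr !scalerA.
  rewrite (_ : _ * (_ * _) = 2 * (1 - c)^-1); last by field.
  by rewrite -scalerA -[X in _ - (X - _)]scale1r scaler_nat mulr2n; apply/matrixP => i j; rewrite !mxE; ring.
rewrite mulmxBr mulmx1 -scalemxAr mulmxA eu mul_scalar_mx scalerA mulVf //.
by rewrite scale1r.
Qed.

(** Induction by deflation: a reflection moves a unit eigenvector to the first
    basis vector, and by symmetry the matrix then splits into a scalar block and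
    a smaller symmetric block. *)
Theorem real_spectral (R : rcfType) n (A : 'M[R]_n) : A^T = A ->
  exists (U : 'M[R]_n) (a : 'rV[R]_n),
    U *m U^T = 1%:M /\ A = U^T *m diag_mx a *m U.
Proof.
elim: n A => [|n IHn] A As.
  by exists 1%:M, 0; split; apply/matrixP => -[].
have [a [v [vv vA]]] := symmetric_eigenvector As.
have [H [Hs HH eH]] := householder vv.
have [B BE] : exists B : 'M[R]_(1 + n), B = H *m A *m H by eexists.
have Bs : B^T = B by rewrite BE !trmx_mul Hs As mulmxA.
have eB : delta_mx 0 0 *m B = a *: (delta_mx 0 0 : 'rV_(1 + n)).
  rewrite BE !mulmxA eH vA -scalemxAl; congr (_ *: _).
  by rewrite -eH -mulmxA HH mulmx1.
have Bu : ulsubmx B = a%:M.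
  apply/matrixP => i j; rewrite !ord1 !mxE eqxx mulr1n.
  move/rowP: eB => /(_ 0); rewrite -rowE !mxE !eqxx mulr1 => <-.
  by congr (B _ _); apply: val_inj.
have Bur : ursubmx B = 0.
  apply/matrixP => i j; rewrite !ord1 !mxE.
  move/rowP: eB => /(_ (rshift 1 j)); rewrite -rowE !mxE /= mulr0 => <-.
  by congr (B _ _); apply: val_inj.
have Bdl : dlsubmx B = 0 by rewrite -[dlsubmx B]trmxK trmx_dlsub Bs Bur trmx0.
have Bb : B = block_mx a%:M 0 0 (drsubmx B) by rewrite -[LHS]submxK Bu Bur Bdl.
have [W [b [WW Wb]]] := IHn (drsubmx B) (etrans (trmx_drsub _) (congr1 _ Bs)).
pose V : 'M[R]_(1 + n) := block_mx 1%:M 0 0 W.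
have VV : V *m V^T = 1%:M.
  rewrite /V tr_block_mx !trmx0 trmx1 mulmx_block !mul0mx !mulmx0 mulmx1 WW.
  by rewrite !addr0 add0r scalar_mx_block.
have BV : B = V^T *m diag_mx (row_mx a%:M b) *m V.
  rewrite /V tr_block_mx diag_mx_row trmx1 !trmx0 !mulmx_block.
  rewrite !(mul0mx, mulmx0, mul1mx, mulmx1, addr0, add0r) -Wb Bb.
  congr block_mx; last by rewrite block_mxKdr.
  by apply/matrixP => i j; rewrite !ord1 !mxE eqxx.
exists (V *m H), (row_mx a%:M b); split.
  by rewrite trmx_mul Hs mulmxA -(mulmxA V) HH mulmx1.
rewrite trmx_mul Hs !mulmxA -(mulmxA H) -(mulmxA H) -BV BE.
by rewrite !mulmxA HH mul1mx -mulmxA HH mulmx1.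
Qed.

(** * Spectral functions of a symmetric matrix *)

Section SpectralCalculus.
Variables (R : rcfType) (n : nat).
Implicit Types (A B D : 'M[R]_n) (f g : R -> R).

(** The junk value for matrices that are not symmetric makes the spectrum a
    total function, which can be composed with random matrices freely. *)
Lemma spectral_pair_ex A : exists p : 'M[R]_n * 'rV[R]_n,
  A^T = A -> p.1 *m p.1^T = 1%:M /\ A = p.1^T *m diag_mx p.2 *m p.1.
Proof.
have [/eqP As|nAs] := boolP (A^T == A).
  by have [U [a Ua]] := real_spectral As; exists (U, a).
by exists (0, 0) => As; rewrite As eqxx in nAs.
Qed.

Definition spectral_basis A := (sval (cid (spectral_pair_ex A))).1.
Definition spectrum A : 'I_n -> R := (sval (cid (spectral_pair_ex A))).2 0.

Definition matrix_fun f A : 'M[R]_n :=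
  (spectral_basis A)^T *m diag_mx (\row_i f (spectrum A i)) *m spectral_basis A.

Definition trace_fun f A : R := \sum_i f (spectrum A i).

Lemma spectral_basisP A : A^T = A ->
  spectral_basis A *m (spectral_basis A)^T = 1%:M.
Proof. by rewrite /spectral_basis; case: cid => p /= pP /pP[]. Qed.

Lemma matrix_fun_id A : A^T = A -> matrix_fun id A = A.
Proof.
move=> As; rewrite /matrix_fun.
rewrite [X in diag_mx X](_ : _ = (sval (cid (spectral_pair_ex A))).2).
  by rewrite /spectral_basis; case: cid => p /= /(_ As) [_ <-].
by apply/rowP => i; rewrite mxE.
Qed.

Lemma matrix_fun_sym f A : (matrix_fun f A)^T = matrix_fun f A.
Proof. by rewrite /matrix_fun !trmx_mul trmxK tr_diag_mx mulmxA. Qed.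

Lemma char_poly_spectrum A : A^T = A ->
  char_poly A = \prod_i ('X - (spectrum A i)%:P).
Proof.
move=> As; set U := spectral_basis A.
have UU : U *m U^T = 1%:M by exact: spectral_basisP.
have UU' : U^T *m U = 1%:M by apply: mulmx1C.
pose d := diag_mx (\row_i spectrum A i).
have AE : A = U^T *m d *m U by rewrite -[LHS]matrix_fun_id.
pose Up := map_mx polyC U.
have UUp : Up^T *m Up = 1%:M.
  by rewrite /Up map_trmx -map_mxM UU' map_mx1.
have -> : char_poly A = char_poly d.
  rewrite /char_poly /char_poly_mx.
  have -> : 'X%:M - map_mx polyC A = Up^T *m ('X%:M - map_mx polyC d) *m Up.
    rewrite mulmxBr mulmxBl scalar_mxC -(mulmxA _ Up^T) UUp mulmx1.
    by rewrite /Up map_trmx -!map_mxM -AE.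
  by rewrite !det_mulmx mulrAC -det_mulmx UUp det1 mul1r.
rewrite char_poly_trig; last by apply: diag_mx_is_trig.
by apply: eq_bigr => i _; rewrite !mxE eqxx mulr1n.
Qed.

(** A trace of a function sees only the multiset of roots of the
    characteristic polynomial, whatever diagonalization is chosen. *)
Lemma trace_fun_roots f A (X : 'I_n -> R) : A^T = A ->
  char_poly A = \prod_i ('X - (X i)%:P) -> \sum_i f (X i) = trace_fun f A.
Proof.
move=> As; rewrite char_poly_spectrum //.
have prodE (Y : 'I_n -> R) : \prod_i ('X - (Y i)%:P) =
    \prod_(x <- [seq Y i | i <- enum 'I_n]) ('X - x%:P) by rewrite big_map big_enum.
have sumE (Y : 'I_n -> R) : \sum_i f (Y i) =
    \sum_(x <- [seq Y i | i <- enum 'I_n]) f x by rewrite big_map big_enum.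
rewrite !prodE => /prod_XsubC_eq h.
by rewrite /trace_fun !sumE; apply/esym/perm_big.
Qed.

(** The squared overlaps of two orthonormal eigenbases. They are doubly
    stochastic, so traces over A and B can be compared entry by entry. *)
Definition overlap A B i j :=
  ((spectral_basis A *m (spectral_basis B)^T) i j) ^+ 2.

Lemma trace_matrix_fun2 f g A B :
  \tr (matrix_fun f A *m matrix_fun g B) =
  \sum_i \sum_j f (spectrum A i) * g (spectrum B j) * overlap A B i j.
Proof.
rewrite /matrix_fun -!mulmxA mxtrace_mulC -!mulmxA.
set U := spectral_basis A; set V := spectral_basis B.
have -> : U *m (V^T *m (diag_mx (\row_i g (spectrum B i)) *m (V *m U^T))) =
   (U *m V^T) *m diag_mx (\row_i g (spectrum B i)) *m (U *m V^T)^T.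
  by rewrite trmx_mul trmxK !mulmxA.
rewrite /mxtrace; apply: eq_bigr => i _; rewrite mul_diag_mx !mxE big_distrr /=.
apply: eq_bigr => j _; rewrite mul_mx_diag ![((U *m V^T)^T) _ _]mxE.
rewrite [(\matrix_(_, _) _) i j]mxE [(\row__ _) _ _]mxE /overlap -/U -/V.
by ring.
Qed.

Lemma matrix_fun1 A : A^T = A -> matrix_fun (fun=> 1) A = 1%:M.
Proof.
move=> As; rewrite /matrix_fun [X in diag_mx X](_ : _ = const_mx 1).
  by rewrite diag_const_mx mulmx1; apply/mulmx1C/spectral_basisP.
by apply/rowP => i; rewrite !mxE.
Qed.

Lemma trace_matrix_fun f A : A^T = A -> \tr (matrix_fun f A) = trace_fun f A.
Proof.
move=> As; rewrite /matrix_fun mxtrace_mulC mulmxA spectral_basisP // mul1mx.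
by rewrite mxtrace_diag; apply: eq_bigr => i _; rewrite mxE.
Qed.

Lemma trace_matrix_fun_sqr f A : A^T = A ->
  \tr (matrix_fun f A *m matrix_fun f A) = trace_fun (fun x => f x ^+ 2) A.
Proof.
move=> As; rewrite -trace_matrix_fun //; congr (\tr _).
rewrite /matrix_fun !mulmxA -(mulmxA _ (spectral_basis A)) spectral_basisP //.
rewrite mulmx1 -(mulmxA _ (diag_mx _) (diag_mx _)) mulmx_diag; congr (_ *m diag_mx _ *m _).
by apply/rowP => i; rewrite !mxE expr2.
Qed.

(** Klein's identity: in the overlap coordinates the Taylor remainder of the
    trace is an average of scalar Taylor remainders, so a quadratic bound for
    the scalar function passes to matrices. *)
Lemma trace_fun_taylor f f1 (K : R) A B : A^T = A -> B^T = B ->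
  (forall s t, `|f s - f t - (s - t) * f1 t| <= K * (s - t) ^+ 2) ->
  `|trace_fun f B - trace_fun f A - \tr (matrix_fun f1 A *m (B - A))|
    <= K * \tr ((B - A) *m (B - A)).
Proof.
move=> As Bs fK; pose w := overlap A B.
pose a := spectrum A; pose b := spectrum B.
have T2 g h : \tr (matrix_fun g A *m matrix_fun h B) =
    \sum_i \sum_j g (a i) * h (b j) * w i j by exact: trace_matrix_fun2.
have TB g : trace_fun g B = \sum_i \sum_j g (b j) * w i j.
  rewrite -trace_matrix_fun // -[matrix_fun _ B]mul1mx -(matrix_fun1 As) T2.
  by apply: eq_bigr => i _; apply: eq_bigr => j _; rewrite mul1r.
have TA g : trace_fun g A = \sum_i \sum_j g (a i) * w i j.
  rewrite -trace_matrix_fun // -[matrix_fun _ A]mulmx1 -(matrix_fun1 Bs) T2.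
  by apply: eq_bigr => i _; apply: eq_bigr => j _; rewrite mulr1.
have TfA g : \tr (matrix_fun g A *m A) = trace_fun (fun x => g x * x) A.
  rewrite -trace_matrix_fun //; congr (\tr _); rewrite -{2}(matrix_fun_id As).
  rewrite /matrix_fun !mulmxA -(mulmxA _ (spectral_basis A)) spectral_basisP //.
  rewrite mulmx1 -(mulmxA _ (diag_mx _) (diag_mx _)) mulmx_diag.
  by congr (_ *m diag_mx _ *m _); apply/rowP => i; rewrite !mxE.
have TfB g : \tr (matrix_fun g A *m B) = \sum_i \sum_j g (a i) * b j * w i j.
  by rewrite -{1}(matrix_fun_id Bs) T2.
have -> : trace_fun f B - trace_fun f A - \tr (matrix_fun f1 A *m (B - A)) =
    \sum_i \sum_j w i j * (f (b j) - f (a i) - (b j - a i) * f1 (a i)).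
  rewrite mulmxBr raddfB /= TfA TfB TB !TA -!sumrB.
  apply: eq_bigr => i _; rewrite -!sumrB.
  by apply: eq_bigr => j _; ring.
have -> : \tr ((B - A) *m (B - A)) = \sum_i \sum_j w i j * (b j - a i) ^+ 2.
  rewrite mulmxBr !mulmxBl !raddfB /=.
  have -> : \tr (B *m A) = \tr (A *m B) by rewrite mxtrace_mulC.
  have -> : \tr (B *m B) = trace_fun (fun x => x ^+ 2) B.
    by rewrite -trace_matrix_fun_sqr // matrix_fun_id.
  have -> : \tr (A *m A) = trace_fun (fun x => x ^+ 2) A.
    by rewrite -trace_matrix_fun_sqr // matrix_fun_id.
  have -> : \tr (A *m B) = \sum_i \sum_j a i * b j * w i j.
    by rewrite -{1}(matrix_fun_id As) TfB.
  rewrite TA TB -!sumrN -!big_split /=; apply: eq_bigr => i _; rewrite -!sumrN -!big_split /=.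
  by apply: eq_bigr => j _; ring.
rewrite mulr_sumr; apply: (le_trans (ler_norm_sum _ _ _)).
apply: ler_sum => i _; rewrite mulr_sumr.
apply: (le_trans (ler_norm_sum _ _ _)); apply: ler_sum => j _.
rewrite normrM ger0_norm ?sqr_ge0 // mulrCA.
by apply: ler_wpM2l; [exact: sqr_ge0 | exact: fK].
Qed.

End SpectralCalculus.

Section SymmetricCoordinates.
Variables (R : realType) (n : nat).

Definition upper_pairs : {set 'I_n * 'I_n} :=
  [set p : 'I_n * 'I_n | (p.1 <= p.2)%N]%SET.

Definition upper_pair (i : 'I_#|upper_pairs|) : 'I_n * 'I_n := enum_val i.

(** The factor 1 / sqrt n is that of the random matrix, whose entries thereby
    become the coordinates of [sym_matrix]. *)
Definition sym_basis (p : 'I_n * 'I_n) : 'M[R]_n :=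
  (Num.sqrt n%:R)^-1 *:
    \matrix_(j, k) (((j, k) == p) || ((k, j) == p))%:R.

Definition sym_matrix (x : #|upper_pairs|.-tuple R) : 'M[R]_n :=
  \sum_i tnth x i *: sym_basis (upper_pair i).

Lemma sym_basis_sym p : (sym_basis p)^T = sym_basis p.
Proof.
by rewrite /sym_basis linearZ /=; congr (_ *: _); apply/matrixP => j k; rewrite !mxE orbC.
Qed.

Lemma sym_matrix_sym x : (sym_matrix x)^T = sym_matrix x.
Proof.
rewrite /sym_matrix raddf_sum /=; apply: eq_bigr => i _.
by rewrite linearZ /= sym_basis_sym.
Qed.

Lemma trace_mul_sym_basis (D : 'M[R]_n) p : D^T = D ->
  \tr (D *m sym_basis p) =
  (Num.sqrt n%:R)^-1 * ((1 + (p.1 != p.2)%:R) * D p.1 p.2).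
Proof.
case: p => j k Ds /=; rewrite /sym_basis -scalemxAr mxtraceZ; congr (_ * _).
have Djk : D k j = D j k by rewrite -[in LHS]Ds mxE.
rewrite /mxtrace (eq_bigr (fun a => \sum_b D a b * ((b == j) && (a == k) || (a == j) && (b == k))%:R)); last first.
  move=> a _; rewrite mxE; apply: eq_bigr => b _; rewrite mxE !xpair_eqE.
  by congr (_ * (_ || _)%:R).
have sel c d : \sum_a \sum_b D a b * ((b == d) && (a == c))%:R = D c d.
  rewrite (bigD1 c) //= [X in _ + X]big1 ?addr0; last first.
    by move=> a /negPf ac; apply: big1 => b _; rewrite ac andbF mulr0.
  rewrite (bigD1 d) //= !eqxx mulr1 [X in _ + X]big1 ?addr0 //.
  by move=> b /negPf bd; rewrite bd mulr0.
have [<-|jk] := eqVneq j k.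
  rewrite addr0 mul1r -[RHS]sel; apply: eq_bigr => a _; apply: eq_bigr => b _.
  by rewrite [(a == j) && _]andbC orbb.
rewrite mulrDl !mul1r -{1}Djk -(sel k j) -(sel j k) -big_split /=.
apply: eq_bigr => a _; rewrite -big_split /=; apply: eq_bigr => b _.
rewrite -mulrDr; congr (_ * _).
have [->|_] := eqVneq a j; last by rewrite andbF /= orbF addr0.
by rewrite (negPf jk) andbF /= add0r andbT.
Qed.

(** The entry above the diagonal counts twice in the matrix, and its square
    is shared by two entries of the Frobenius norm: hence the factor 2. *)
Lemma sum_trace_sym_basis (D : 'M[R]_n) : D^T = D ->
  \sum_i \tr (D *m sym_basis (upper_pair i)) ^+ 2 <= 2 / n%:R * \tr (D *m D).
Proof.
move=> Ds.
have -> : \tr (D *m D) = \sum_p D p.1 p.2 ^+ 2.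
  rewrite /mxtrace -(pair_bigA _ (fun j k => D j k ^+ 2)) /=.
  apply: eq_bigr => j _; rewrite mxE; apply: eq_bigr => k _.
  by rewrite -{2}Ds mxE expr2.
rewrite /upper_pair -(big_enum_val (fun p => \tr (D *m sym_basis p) ^+ 2)) /=.
pose w (p : 'I_n * 'I_n) := (Num.sqrt n%:R)^-1 ^+ 2 * (1 + 3 * (p.1 != p.2)%:R) * D p.1 p.2 ^+ 2.
have n0 : (n%:R : R)^-1 = (Num.sqrt n%:R)^-1 ^+ 2 by rewrite exprVn sqr_sqrtr // ler0n.
have -> : \sum_(p in upper_pairs) \tr (D *m sym_basis p) ^+ 2 = \sum_(p in upper_pairs) w p.
  apply: eq_bigr => p _; rewrite trace_mul_sym_basis // /w.
  by case: eqP => _ /=; ring.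
rewrite n0; set c := _ ^+ 2.
have c0 : 0 <= c by apply: sqr_ge0.
pose sw (p : 'I_n * 'I_n) := (p.2, p.1).
have swK : involutive sw by case.
pose lowp : pred ('I_n * 'I_n) := fun p => (p.2 < p.1)%N.
have e : \sum_(p | lowp p) D p.1 p.2 ^+ 2 = \sum_(p : 'I_n * 'I_n | (p.1 < p.2)%N) D p.1 p.2 ^+ 2.
  rewrite (reindex_inj (inv_inj swK)) /=; apply: eq_bigr => -[j k] _ /=.
  by rewrite -[in LHS]Ds mxE.
rewrite [X in _ <= _ * X](bigID (mem upper_pairs)) /=.
rewrite [X in _ * (_ + X)](_ : _ = \sum_(p : 'I_n * 'I_n | (p \in upper_pairs) && (p.1 < p.2)%N) D p.1 p.2 ^+ 2); last first.
  rewrite (eq_bigl lowp); last by move=> p; rewrite !inE -ltnNge.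
  rewrite e; apply: eq_bigl => p; rewrite inE.
  by case: ltnP => //= h; rewrite ?(ltnW h) ?andbF.
rewrite big_mkcondr /= -big_split /= mulr_sumr; apply: ler_sum => p; rewrite inE => pp.
have := mulr_ge0 c0 (sqr_ge0 (D p.1 p.2)).
rewrite /w -/c; have [eq12|ne12] := eqVneq p.1 p.2.
  by rewrite eq12 ltnn /=; lra.
have -> : (p.1 < p.2)%N by rewrite ltn_neqAle ne12.
by rewrite /=; lra.
Qed.

Lemma normalized_matrixE (T : Type) (xi : 'I_n -> 'I_n -> T -> R) w :
  (forall j k : 'I_n, (j <= k)%N -> xi k j w = xi j k w) ->
  normalized_matrix xi w =
  sym_matrix [tuple (xi (upper_pair i).1 (upper_pair i).2 w) | i < #|upper_pairs|].
Proof.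
move=> xs; apply/matrixP => j k; rewrite mxE /sym_matrix summxE.
under eq_bigr => i _ do rewrite tnth_mktuple !mxE.
rewrite /upper_pair -(big_enum_val (fun p => xi p.1 p.2 w *
  ((Num.sqrt n%:R)^-1 * (((j, k) == p) || ((k, j) == p))%:R))) /=.
wlog jk : j k / (j <= k)%N.
  move=> h; have [jk|kj] := leqP j k; first exact: h.
  rewrite xs ?(ltnW kj) // h ?(ltnW kj) //.
  by apply: eq_bigr => p _; rewrite orbC.
rewrite (bigD1 (j, k)) ?inE //= eqxx mulr1 [X in _ + X]big1 ?addr0 1?mulrC //.
move=> p /andP[]; rewrite inE => pp pjk.
rewrite eq_sym (negPf pjk) /=.
case: eqP => [e|]; last by rewrite !mulr0.
move: pp pjk; rewrite -e /= => kj; rewrite xpair_eqE.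
have -> : j = k by apply/val_inj/eqP; rewrite eqn_leq jk kj.
by rewrite eqxx.
Qed.

End SymmetricCoordinates.

(** * Bounded measurable functions on a probability space *)

Section BoundedMeasurable.
Context d (T : measurableType d) (R : realType).
Implicit Types (f g : T -> R).

Definition bounded_measurable f :=
  measurable_fun setT f /\ exists B, forall x, `|f x| <= B.

Lemma bm_cst (c : R) : bounded_measurable (fun=> c).
Proof. by split; [exact: measurable_cst | exists `|c|]. Qed.

Lemma bmD f g : bounded_measurable f -> bounded_measurable g ->
  bounded_measurable (fun x => f x + g x).
Proof.
move=> [mf [A fA]] [mg [B gB]]; split; first exact: measurable_funD.
by exists (A + B) => x; apply: (le_trans (ler_normD _ _)); apply: lerD.
Qed.

Lemma bmN f : bounded_measurable f -> bounded_measurable (fun x => - f x).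
Proof.
move=> [mf [A fA]]; split; first exact: measurableT_comp.
by exists A => x; rewrite normrN.
Qed.

Lemma bmB f g : bounded_measurable f -> bounded_measurable g ->
  bounded_measurable (fun x => f x - g x).
Proof. by move=> bf bg; apply: bmD => //; apply: bmN. Qed.

Lemma bmM f g : bounded_measurable f -> bounded_measurable g ->
  bounded_measurable (fun x => f x * g x).
Proof.
move=> [mf [A fA]] [mg [B gB]]; split; first exact: measurable_funM.
by exists (A * B) => x; rewrite normrM ler_pM.
Qed.

Lemma bmZ c f : bounded_measurable f -> bounded_measurable (fun x => c * f x).
Proof. by apply: bmM; exact: bm_cst. Qed.

Lemma bmX n f : bounded_measurable f -> bounded_measurable (fun x => f x ^+ n).
Proof.
move=> bf; elim: n => [|n IHn]; first exact: (bm_cst 1).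
under eq_fun do rewrite exprS.
exact: bmM.
Qed.

Lemma bm_sum (I : Type) (s : seq I) (F : I -> T -> R) :
  (forall i, bounded_measurable (F i)) ->
  bounded_measurable (fun x => \sum_(i <- s) F i x).
Proof.
move=> bF; elim: s => [|i s IHs].
  by under eq_fun do rewrite big_nil; exact: bm_cst.
by under eq_fun do rewrite big_cons; exact: bmD.
Qed.

Lemma bm_norm f : bounded_measurable f -> bounded_measurable (fun x => `|f x|).
Proof.
move=> [mf [A fA]]; split; first exact: measurableT_comp.
by exists A => x; rewrite normr_id.
Qed.

Lemma bm_expR f : bounded_measurable f -> bounded_measurable (fun x => expR (f x)).
Proof.
move=> [mf [C fC]]; split; first exact: measurableT_comp.
by exists (expR C) => x; rewrite ger0_norm ?expR_ge0 // ler_expR (le_trans (ler_norm _)).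
Qed.

Lemma bm_comp_itv (h : R -> R) f a b : bounded_measurable f ->
  (forall x, a <= f x <= b) -> measurable_fun setT h ->
  (exists B, forall u, a <= u <= b -> `|h u| <= B) ->
  bounded_measurable (fun x => h (f x)).
Proof.
move=> [mf _] fab mh [B hB]; split; first exact: measurableT_comp.
by exists B => x; apply: hB.
Qed.

(** The expansion exhibits f1 as the limit of difference quotients. *)
Lemma measurable_first_order (f f1 : T -> R) (g : nat -> T -> R) (K : R) :
  measurable_fun setT f -> (forall n, measurable_fun setT (g n)) ->
  (forall n x, `|g n x - f x - n.+1%:R^-1 * f1 x| <= K * n.+1%:R^-1 ^+ 2) ->
  measurable_fun setT f1.
Proof.
move=> mf mg fK; pose u n x := n.+1%:R * (g n x - f x).
apply: (measurable_fun_cvg (f := f1) (h := u)) => [n|x _].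
  by apply: measurable_funM => //; exact: measurable_funB.
have ub n : `|f1 x - u n x| <= K * n.+1%:R^-1.
  have n0 : (0 : R) < n.+1%:R by [].
  have -> : f1 x - u n x = - n.+1%:R * (g n x - f x - n.+1%:R^-1 * f1 x).
    by rewrite /u; field; rewrite gt_eqF.
  rewrite normrM normrN (gtr0_norm n0).
  apply: le_trans (ler_wpM2l (ltW n0) (fK n x)) _.
  by rewrite [leLHS](_ : _ = K * n.+1%:R^-1) //; field; rewrite gt_eqF.
apply/cvgrPdist_le => e e0; near=> n.
apply: (le_trans (ub n)).
near: n; have hc : K * n.+1%:R^-1 @[n --> \oo] --> (0 : R).
  by rewrite -[X in _ --> X](mulr0 K); apply: cvgM; [exact: cvg_cst | exact: cvg_harmonic].
move/cvgrPdist_le : hc => /(_ _ e0); apply: filterS => n.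
by rewrite sub0r normrN; apply: le_trans; rewrite ler_norm.
Unshelve. all: end_near. Qed.

End BoundedMeasurable.

Lemma bm_comp d d' (S : measurableType d') (T : measurableType d) (R : realType)
    (h : S -> T) (f : T -> R) :
  measurable_fun setT h -> bounded_measurable f ->
  bounded_measurable (f \o h).
Proof.
move=> mh [mf [B fB]]; split; first exact: measurableT_comp.
by exists B => x; apply: fB.
Qed.

#[global] Hint Extern 0 (bounded_measurable (fun=> _)) => solve [exact: bm_cst] : core.

Section DominatedConvergence.
Context d (T : measurableType d) (R : realType).
Variable nu : {measure set T -> \bar R}.

Lemma dominated_Rintegral (u : nat -> T -> R) (f G : T -> R) :
  (forall n, measurable_fun setT (u n)) -> (forall n x, `|u n x| <= G x) ->
  (forall x, u n x @[n --> \oo] --> f x) ->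
  nu.-integrable setT (EFin \o G) ->
  \int[nu]_x (u n x) @[n --> \oo] --> \int[nu]_x f x.
Proof.
move=> mu uB uf iG.
have mf : measurable_fun setT f by apply: (measurable_fun_cvg mu) => x _; exact: uf.
have [] := @dominated_convergence _ _ _ nu setT measurableT (fun n x => (u n x)%:E)
  (fun x => (f x)%:E) (fun x => (G x)%:E).
- by move=> n; apply/measurable_EFinP.
- exact/measurable_EFinP.
- by apply: aeW => x _; apply: cvg_EFin; [exact: nearW | exact: uf].
- exact: iG.
- by apply: aeW => x n _; rewrite lee_fin.
move=> fi _ h.
have ifin : (\int[nu]_x (f x)%:E)%E \is a fin_num by apply: integrable_fin_num.
by rewrite -[X in _ --> X]/(fine _); apply: fine_cvg; rewrite fineK.
Qed.

End DominatedConvergence.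

Section ProbabilityIntegral.
Context d (T : measurableType d) (R : realType) (P : probability T R).
Implicit Types (f g : T -> R).

Lemma bm_integrable f : bounded_measurable f -> P.-integrable setT (EFin \o f).
Proof.
move=> [mf [B fB]]; apply: (@le_integrable _ _ _ P setT measurableT _ (EFin \o cst B)).
- exact/measurable_EFinP.
- by move=> x _ /=; rewrite lee_fin (le_trans (fB x)) // ler_norm.
- exact: finite_measure_integrable_cst.
Qed.

Lemma prob_int_cst (c : R) : \int[P]_x c = c.
Proof.
rewrite Rintegral_cst // -[RHS]mulr1; congr (_ * _).
by have -> : (P : {measure set T -> \bar R}) setT = 1%E by exact: (probability_setT P).
Qed.

Lemma bm_intD f g : bounded_measurable f -> bounded_measurable g ->
  \int[P]_x (f x + g x) = \int[P]_x f x + \int[P]_x g x.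
Proof. by move=> bf bg; rewrite RintegralD //; exact: bm_integrable. Qed.

Lemma bm_intB f g : bounded_measurable f -> bounded_measurable g ->
  \int[P]_x (f x - g x) = \int[P]_x f x - \int[P]_x g x.
Proof. by move=> bf bg; rewrite RintegralB //; exact: bm_integrable. Qed.

Lemma bm_intZ c f : bounded_measurable f ->
  \int[P]_x (c * f x) = c * \int[P]_x f x.
Proof. by move=> bf; rewrite RintegralZl //; exact: bm_integrable. Qed.

Lemma bm_intN f : bounded_measurable f -> \int[P]_x (- f x) = - \int[P]_x f x.
Proof.
move=> bf; rewrite -mulN1r -bm_intZ //; apply: eq_Rintegral => x _.
by rewrite mulN1r.
Qed.

Lemma bm_int_sum (I : Type) (s : seq I) (F : I -> T -> R) :
  (forall i, bounded_measurable (F i)) ->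
  \int[P]_x (\sum_(i <- s) F i x) = \sum_(i <- s) \int[P]_x F i x.
Proof.
move=> bF; elim: s => [|i s IHs].
  rewrite big_nil -[RHS](prob_int_cst 0); apply: eq_Rintegral => x _.
  by rewrite big_nil.
rewrite big_cons -IHs -bm_intD //; last exact: bm_sum.
by apply: eq_Rintegral => x _; rewrite big_cons.
Qed.

Lemma bm_int_le f g : bounded_measurable f -> bounded_measurable g ->
  (forall x, f x <= g x) -> \int[P]_x f x <= \int[P]_x g x.
Proof. by move=> bf bg fg; apply: le_Rintegral => //; exact: bm_integrable. Qed.

Lemma bm_int_ge0 f : (forall x, 0 <= f x) -> 0 <= \int[P]_x f x.
Proof. by move=> f0; apply: Rintegral_ge0 => x _. Qed.

Lemma bm_int_bounds f a b : bounded_measurable f ->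
  (forall x, a <= f x <= b) -> a <= \int[P]_x f x <= b.
Proof.
move=> bf fab;
have la := bm_int_le (bm_cst T a) bf (fun x => proj1 (andP (fab x))).
have lb := bm_int_le bf (bm_cst T b) (fun x => proj2 (andP (fab x))).
by rewrite !prob_int_cst in la lb; rewrite la lb.
Qed.

Lemma bm_int_norm f B : bounded_measurable f -> (forall x, `|f x| <= B) ->
  `|\int[P]_x f x| <= B.
Proof.
by move=> bf fB; rewrite ler_norml; apply: bm_int_bounds => // x; rewrite -ler_norml.
Qed.

Lemma bm_EFin f : bounded_measurable f ->
  (\int[P]_x f x)%:E = (\int[P]_x (f x)%:E)%E.
Proof.
by move=> bf; rewrite fineK // integrable_fin_num //; exact: bm_integrable.
Qed.

Lemma bounded_convergence (u : nat -> T -> R) f B :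
  (forall n, measurable_fun setT (u n)) -> (forall n x, `|u n x| <= B) ->
  (forall x, u n x @[n --> \oo] --> f x) ->
  \int[P]_x (u n x) @[n --> \oo] --> \int[P]_x f x.
Proof.
move=> mu uB uf; apply: (dominated_Rintegral (nu := P) (G := fun=> B)) => //.
exact: bm_integrable (bm_cst T B).
Qed.

End ProbabilityIntegral.

(** * Gaussian regularization *)

Section GaussianKernel.
Variable R : realType.
Notation mu := (@lebesgue_measure R).
Implicit Types (p : {poly R}) (q s x y z : R).

Lemma monomial_gauss_bound n q : 0 < q ->
  exists2 C, 0 <= C & forall z, `|z| ^+ n <= C * expR (q * z ^+ 2).
Proof.
move=> q0; exists (1 + n.+1`!%:R / q ^+ n.+1).
  by rewrite addr_ge0 // divr_ge0 // exprn_ge0 // ltW.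
move=> z; have e1 : 1 <= expR (q * z ^+ 2).
  by rewrite -expR0 ler_expR mulr_ge0 ?sqr_ge0 // ltW.
have h := expR_ge1Dxn n (mulr_ge0 (ltW q0) (sqr_ge0 z)).
have zn : (z ^+ 2) ^+ n.+1 <= n.+1`!%:R / q ^+ n.+1 * expR (q * z ^+ 2).
  rewrite -ler_pdivrMl; last by rewrite divr_gt0 ?exprn_gt0 // ltr0n fact_gt0.
  rewrite invf_div mulrAC -exprMn; apply: le_trans h.
  by rewrite lerDr.
rewrite mulrDl mul1r.
have [z1|z1] := leP `|z| 1.
  apply: (@le_trans _ _ 1); first by rewrite exprn_ile1.
  rewrite -[leLHS]addr0 lerD // mulr_ge0 ?expR_ge0 //.
  by rewrite divr_ge0 // exprn_ge0 // ltW.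
apply: (@le_trans _ _ ((z ^+ 2) ^+ n.+1)).
  rewrite -real_normK ?num_real // -exprM ler_weXn2l //; first exact: ltW.
  by rewrite mul2n -addnn; lia.
by rewrite -[leLHS]add0r lerD // ltW // expR_gt0.
Qed.

Lemma poly_gauss_bound p q : 0 < q ->
  exists2 C, 0 <= C & forall z, `|p.[z]| <= C * expR (q * z ^+ 2).
Proof.
move=> q0.
have /all_sig2 [c c0 cP] : forall n, { C | 0 <= C & forall z, `|z| ^+ n <= C * expR (q * z ^+ 2)}.
  by move=> n; have /cid2 := monomial_gauss_bound n q0.
exists (\sum_(i < size p) `|p`_i| * c i).
  by apply: sumr_ge0 => i _; rewrite mulr_ge0.
move=> z; rewrite horner_coef mulr_suml.
apply: (le_trans (ler_norm_sum _ _ _)); apply: ler_sum => i _.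
by rewrite normrM normrX -mulrA ler_wpM2l.
Qed.

(** Polynomial multiples of a Gaussian: the smallest family of kernels that
    contains the Gaussian and is stable under differentiation. *)
Definition kernel s p x y : R := p.[x - y] * normal_fun x s y.

Lemma normal_fun_symE s x y :
  normal_fun x s y = expR (- ((s ^+ 2 *+ 2)^-1 * (x - y) ^+ 2)).
Proof. by rewrite /normal_fun; congr expR; rewrite -sqrrN opprB mulNr mulrC. Qed.

(** A domination that is uniform for x near x0, as needed to differentiate
    under the integral sign. *)
Lemma kernel_bound s p : 0 < s -> exists2 C, 0 <= C &
  forall x0 x y, `|x - x0| <= 1 -> `|kernel s p x y| <= C * normal_fun x0 (2 * s) y.
Proof.
move=> s0; pose q := (s ^+ 2 *+ 2)^-1.
have q0 : 0 < q by rewrite invr_gt0 mulrn_wgt0 // exprn_gt0.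
have [C C0 CP] := poly_gauss_bound p (divr_gt0 q0 (ltr0n _ 2)).
exists (C * expR (q / 2)); first by rewrite mulr_ge0 ?expR_ge0.
move=> x0 x y xx0; rewrite /kernel normrM (ger0_norm (normal_fun_ge0 _ _ _)).
apply: (@le_trans _ _ (C * expR (q / 2 * (x - y) ^+ 2) * normal_fun x s y)).
  by rewrite ler_wpM2r // normal_fun_ge0.
rewrite -!mulrA ler_wpM2l // !normal_fun_symE -!expRD ler_expR -/q.
have -> : ((2 * s) ^+ 2 *+ 2)^-1 = q / 4.
  by rewrite /q; field; rewrite gt_eqF.
have h : (x0 - y) ^+ 2 <= 2 * (x - y) ^+ 2 + 2.
  have : (x - x0) ^+ 2 <= 1 by rewrite -real_normK ?num_real // expr_le1.
  by have := sqr_ge0 ((x - y) + (x - x0)); nra.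
by have := ler_wpM2l (ltW q0) h; lra.
Qed.

Lemma integrable_normal_fun m s : 0 < s ->
  mu.-integrable setT (fun y => (normal_fun m s y)%:E).
Proof.
move=> s0; have sn0 : s != 0 by rewrite gt_eqF.
have := integrableZl measurableT (normal_peak s)^-1 (integrable_normal_pdf m s).
apply: eq_integrable => // y _; rewrite normal_pdfE // -EFinM mulKf //.
by rewrite gt_eqF // normal_peak_gt0.
Qed.

Lemma measurable_kernel s p x : measurable_fun setT (kernel s p x).
Proof.
apply: measurable_funM; last exact: measurable_normal_fun.
apply: (measurableT_comp (f := horner p)).
  by apply: continuous_measurable_fun; exact: continuous_horner.
exact: measurable_funB.
Qed.

Definition kernel_deriv s p := p^`() - (s ^+ 2)^-1 *: ('X * p).

Lemma is_derive_kernel s p x y : s != 0 ->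
  is_derive x 1 (kernel s p ^~ y) (kernel s (kernel_deriv s p) x y).
Proof.
move=> s0.
pose q := (s ^+ 2 *+ 2)^-1.
have h0 : is_derive x 1 (fun u => u - y) 1 by apply: is_derive_eq; rewrite subr0.
have h1 : is_derive x 1 (fun u => p.[u - y]) (p^`().[x - y]).
  by rewrite -[X in is_derive _ _ _ X]mulr1; apply: is_derive1_comp.
have h2 : is_derive x 1 (fun u => - (q * (u - y) ^+ 2)) (- (q * (2 * (x - y)))).
  by apply: is_derive_eq; rewrite /GRing.scale /= mulr1 mulr_natl mulr2n.
have h3 := @is_derive1_comp _ expR (fun u => - (q * (u - y) ^+ 2)) x _ _
  (is_derive_expR _) h2.
rewrite (_ : kernel s p ^~ y = (fun u => p.[u - y]) \* (expR \o (fun u => - (q * (u - y) ^+ 2)))); last first.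
  by apply/funext => u; rewrite /kernel normal_fun_symE.
have h := is_deriveM h1 h3.
rewrite (_ : kernel _ _ _ _ = p.[x - y] *: (expR (- (q * (x - y) ^+ 2)) * - (q * (2 * (x - y)))) +
  (expR \o (fun u => - (q * (u - y) ^+ 2))) x *: p^`().[x - y]) //.
rewrite /kernel normal_fun_symE -/q /kernel_deriv hornerD hornerN hornerZ hornerM hornerX.
have -> : (s ^+ 2)^-1 = q * 2 by rewrite /q -mulr_natr; field.
rewrite /GRing.scale /=; set e := expR _.
move: (p.[x - y]) (p^`().[x - y]) e => u v e; ring.
Qed.

Variables (g : R -> R) (B : R).
Hypothesis mg : measurable_fun setT g.
Hypothesis gB : forall y, `|g y| <= B.

Definition conv s p x : R := \int[mu]_y (g y * kernel s p x y).

Lemma integrable_conv s p x : 0 < s ->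
  mu.-integrable setT (fun y => (g y * kernel s p x y)%:E).
Proof.
move=> s0; have [C C0 CP] := kernel_bound p s0.
have s20 : 0 < 2 * s by rewrite mulr_gt0.
have := integrableZl measurableT (B * C) (integrable_normal_fun x s20).
apply: le_integrable => //.
  by apply/measurable_EFinP; apply: measurable_funM => //; exact: measurable_kernel.
have B0 : 0 <= B by apply: le_trans (gB 0).
move=> y _; rewrite -EFinM lee_fin.
rewrite (ger0_norm (mulr_ge0 (mulr_ge0 B0 C0) (normal_fun_ge0 x (2 * s) y))).
by rewrite normrM -mulrA ler_pM // CP // subrr normr0.
Qed.

Lemma derive_conv s p x : 0 < s ->
  derivable (conv s p) x 1 /\ derive1 (conv s p) x = conv s (kernel_deriv s p) x.
Proof.
move=> s0; have sn0 : s != 0 by rewrite gt_eqF.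
have [C C0 CP] := kernel_bound (kernel_deriv s p) s0.
have s20 : 0 < 2 * s by rewrite mulr_gt0.
have B0 : 0 <= B by apply: le_trans (gB 0).
pose f u y := g y * kernel s p u y.
have df (u y : R) : is_derive u 1 (f ^~ y) (g y * kernel s (kernel_deriv s p) u y).
  have h := is_derive_kernel p u y sn0.
  exact: (is_deriveZ (g y) h).
have xI : x \in `]x - 1, x + 1[ by rewrite in_itv /= gtrBl ltrDl ltr01.
have If (u : R) : u \in `]x - 1, x + 1[ -> mu.-integrable setT (EFin \o f u).
  by move=> _; exact: integrable_conv.
have Df (u y : R) : u \in `]x - 1, x + 1[ -> setT y -> derivable (f ^~ y) u 1.
  by move=> _ _; have [] := df u y.
pose G y := B * C * normal_fun x (2 * s) y.
have G0 y : 0 <= G y by rewrite !mulr_ge0 // normal_fun_ge0.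
have iG : mu.-integrable setT (EFin \o G).
  have := integrableZl measurableT (B * C) (integrable_normal_fun x s20).
  exact.
have dfE (u y : R) : partial1of2 f u y = g y * kernel s (kernel_deriv s p) u y.
  by rewrite /partial1of2 derive1E; have [_ ->] := df u y.
have bG (u y : R) : u \in `]x - 1, x + 1[ -> setT y -> `|partial1of2 f u y| <= G y.
  move=> uI _; rewrite dfE normrM /G -mulrA ler_pM // CP //.
  by move: uI; rewrite in_itv /= ler_norml; lra.
split; first exact: (derivable_under_integral measurableT xI If Df G0 iG bG).
rewrite (differentiation_under_integral measurableT xI If Df G0 iG bG).
by apply: eq_Rintegral => y _; exact: dfE.
Qed.

Lemma smooth_conv s p c : 0 < s -> smooth (fun x => c * conv s p x).
Proof.
move=> s0.
have dS u (x : R) : derivable (fun x => c * conv s u x) x 1 /\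
    derive1 (fun x => c * conv s u x) x = c * conv s (kernel_deriv s u) x.
  have [du dE] := derive_conv u x s0.
  have h : is_derive x 1 (conv s u) (conv s (kernel_deriv s u) x).
    by apply: DeriveDef; [exact: du | rewrite -derive1E; exact: dE].
  have [dh hE] := is_deriveZ c h.
  by split; [exact: dh | rewrite derive1E; exact: hE].
move=> k x.
have -> : derive1n k (fun x => c * conv s p x) =
    fun x => c * conv s (iter k (kernel_deriv s) p) x.
  elim: k => [//|k IHk]; rewrite derive1nS IHk; apply/funext => y.
  exact: (dS _ y).2.
exact: (dS _ x).1.
Qed.

End GaussianKernel.

(** * Functions with a uniform first-order expansion *)

(** Bounded functions with a first-order Taylor expansion whose remainder is
    uniformly quadratic: a substitute for bounded C^{1,1} functions that asks
    for no topology on the derivative. *)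
Definition taylor1 (R : realType) (g g1 : R -> R) : Prop :=
  exists B L K : R, [/\ forall t, `|g t| <= B, forall t, `|g1 t| <= L
    & forall s t, `|g s - g t - (s - t) * g1 t| <= K * (s - t) ^+ 2].

Section TaylorFacts.
Variable R : realType.
Implicit Types g : R -> R.

(** For increments larger than 1 the bound on the values takes over from the
    Taylor expansion. *)
Lemma taylor1_lipschitz_bound g g1 (B L K : R) : (forall t, `|g t| <= B) ->
  (forall t, `|g1 t| <= L) ->
  (forall s t, `|g s - g t - (s - t) * g1 t| <= K * (s - t) ^+ 2) ->
  forall s t, `|g s - g t| <= (2 * B + L + K) * `|s - t|.
Proof.
move=> gB g1L gK s t.
have B0 : 0 <= B := le_trans (normr_ge0 _) (gB 0).
have L0 : 0 <= L := le_trans (normr_ge0 _) (g1L 0).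
have K0 : 0 <= K by have := le_trans (normr_ge0 _) (gK 1 0); rewrite subr0 expr1n mulr1.
have [st|st] := leP `|s - t| 1; last first.
  apply: (@le_trans _ _ (B + B)); first by apply: (le_trans (ler_normB _ _)); exact: lerD.
  by nra.
have h1 : `|(s - t) * g1 t| <= L * `|s - t| by rewrite normrM mulrC ler_wpM2r.
have h2 : K * (s - t) ^+ 2 <= K * `|s - t|.
  by rewrite ler_wpM2l // -real_normK ?num_real // expr2 ler_piMr.
have -> : g s - g t = (g s - g t - (s - t) * g1 t) + (s - t) * g1 t by ring.
apply: (le_trans (ler_normD _ _)); have := gK s t.
have := mulr_ge0 B0 (normr_ge0 (s - t)); nra.
Qed.

Lemma taylor1_lipschitz g g1 : taylor1 g g1 ->
  exists M, forall s t, `|g s - g t| <= M * `|s - t|.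
Proof.
move=> [B [L [K [gB g1L gK]]]]; exists (2 * B + L + K).
exact: taylor1_lipschitz_bound.
Qed.

Lemma lipschitz_continuous g M :
  (forall s t, `|g s - g t| <= M * `|s - t|) -> continuous g.
Proof.
move=> gM x; apply/cvgrPdist_le => e e0.
have M0 : 0 <= M by have := le_trans (normr_ge0 _) (gM 1 0); rewrite subr0 normr1 mulr1.
have e1 : 0 < (M + 1)^-1 * e by rewrite mulr_gt0 // invr_gt0 ltr_wpDl.
near=> y; apply: (le_trans (gM _ _)).
apply: (@le_trans _ _ ((M + 1) * `|x - y|)); first by rewrite ler_wpM2r // lerDl.
rewrite -ler_pdivlMl; last by rewrite ltr_wpDl.
near: y; apply: cvgr_dist_le => //.
Unshelve. all: end_near. Qed.

Lemma taylor1_deriv_lipschitz g g1 : taylor1 g g1 ->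
  exists M, forall s t, `|g1 s - g1 t| <= M * `|s - t|.
Proof.
move=> [B [L [K [_ _ gK]]]]; exists (2 * K) => s t.
have [->|st] := eqVneq s t; first by rewrite !subrr normr0 mulr0.
have d0 : 0 < `|s - t| by rewrite normr_gt0 subr_eq0.
rewrite -(ler_pM2r d0) -normrM.
have -> : (g1 s - g1 t) * (s - t) =
   (g s - g t - (s - t) * g1 t) + (g t - g s - (t - s) * g1 s) by ring.
apply: (le_trans (ler_normD _ _)); apply: (le_trans (lerD (gK s t) (gK t s))).
rewrite -!mulrA -expr2 real_normK ?num_real //.
by rewrite (_ : (t - s) ^+ 2 = (s - t) ^+ 2); [lra | ring].
Qed.

Lemma taylor1_continuous g g1 : taylor1 g g1 -> continuous g.
Proof. by move=> /taylor1_lipschitz [M]; exact: lipschitz_continuous. Qed.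

Lemma taylor1_bm g g1 : taylor1 g g1 -> bounded_measurable g.
Proof.
move=> gt; split; first by apply: continuous_measurable_fun; exact: taylor1_continuous gt.
by have [B [L [K [gB _ _]]]] := gt; exists B.
Qed.

Lemma taylor1_deriv_bm g g1 : taylor1 g g1 -> bounded_measurable g1.
Proof.
move=> gt; split.
  have [M gM] := taylor1_deriv_lipschitz gt.
  by apply: continuous_measurable_fun; exact: lipschitz_continuous gM.
by have [B [L [K [_ gL _]]]] := gt; exists L.
Qed.

Lemma taylor_is_derive (h h1 : R -> R) (K x : R) :
  (forall s, `|s - x| <= 1 -> `|h s - h x - (s - x) * h1 x| <= K * (s - x) ^+ 2) ->
  is_derive x 1 h (h1 x).
Proof.
move=> hK.
have K0 : 0 <= K.
  have e1 : x + 1 - x = 1 by ring.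
  have := hK (x + 1); rewrite e1 normr1 expr1n mulr1 => /(_ (lexx 1)).
  exact: le_trans.
suff cv : (u^-1 *: (h (u *: 1 + x) - h x)) @[u --> 0^'] --> h1 x.
  apply: DeriveDef; first by apply/cvg_ex; exists (h1 x).
  exact/cvg_lim.
apply/cvgrPdist_le => e e0.
have e1 : 0 < (K + 1)^-1 * e by rewrite mulr_gt0 // invr_gt0 ltr_wpDl.
near=> u; have u0 : u != 0 by near: u; exact: nbhs_dnbhs_neq.
rewrite scaler1 /GRing.scale /=.
have -> : h1 x - u^-1 * (h (u + x) - h x) =
   - u^-1 * (h (u + x) - h x - (u + x - x) * h1 x).
  by field.
rewrite normrM normrN normfV ler_pdivrMl ?normr_gt0 //.
apply: (le_trans (hK _ _)).
  by rewrite addrK; near: u; exact: dnbhs0_le.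
rewrite addrK -real_normK ?num_real // expr2 mulrA mulrC ler_wpM2l //.
apply: (@le_trans _ _ ((K + 1) * `|u|)); first by rewrite ler_wpM2r // lerDl.
rewrite -ler_pdivlMl; last by rewrite ltr_wpDl.
by near: u; exact: dnbhs0_le.
Unshelve. all: end_near. Qed.

End TaylorFacts.

Section GaussianAverage.
Variable R : realType.
Notation mu := (@lebesgue_measure R).
Implicit Types (f g : R -> R).

Definition gauss_avg f : R := \int[mu]_z (f z * normal_pdf 0 1 z).

Lemma gauss_avg_integrable f : bounded_measurable f ->
  mu.-integrable setT (fun z => (f z * normal_pdf 0 1 z)%:E).
Proof.
move=> [mf [B fB]].
have := integrableZl measurableT `|B| (integrable_normal_pdf 0 (1 : R)).
apply: le_integrable => //.
  by apply/measurable_EFinP; apply: measurable_funM => //; exact: measurable_normal_pdf.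
move=> z _; rewrite -EFinM lee_fin !normrM normr_id ler_wpM2r //.
exact: (le_trans (fB z) (ler_norm B)).
Qed.

Lemma gauss_avg_cst (c : R) : gauss_avg (fun=> c) = c.
Proof.
rewrite /gauss_avg RintegralZl //; last exact: integrable_normal_pdf.
by rewrite /Rintegral integral_normal_pdf /= mulr1.
Qed.

Lemma gauss_avgD f g : bounded_measurable f -> bounded_measurable g ->
  gauss_avg (fun z => f z + g z) = gauss_avg f + gauss_avg g.
Proof.
move=> bf bg; rewrite /gauss_avg -RintegralD //; try exact: gauss_avg_integrable.
by apply: eq_Rintegral => z _; rewrite mulrDl.
Qed.

Lemma gauss_avgZ c f : bounded_measurable f ->
  gauss_avg (fun z => c * f z) = c * gauss_avg f.
Proof.
move=> bf; rewrite /gauss_avg -RintegralZl //; last exact: gauss_avg_integrable.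
by apply: eq_Rintegral => z _; rewrite mulrA.
Qed.

Lemma gauss_avgB f g : bounded_measurable f -> bounded_measurable g ->
  gauss_avg (fun z => f z - g z) = gauss_avg f - gauss_avg g.
Proof.
move=> bf bg; rewrite gauss_avgD //; last exact: bmN.
rewrite -mulN1r -gauss_avgZ //; congr (_ + gauss_avg _).
by apply/funext => z; rewrite mulN1r.
Qed.

Lemma gauss_avg_norm f B : bounded_measurable f -> (forall z, `|f z| <= B) ->
  `|gauss_avg f| <= B.
Proof.
move=> bf fB; rewrite -[leRHS]gauss_avg_cst.
apply: (le_trans (le_normr_Rintegral _ _)) => //; first exact: gauss_avg_integrable.
apply: le_Rintegral => //.
- have := gauss_avg_integrable (bm_norm bf); apply: eq_integrable => // z _ /=.
  by rewrite normrM (ger0_norm (normal_pdf_ge0 0 1 z)).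
- exact: (gauss_avg_integrable (bm_cst _ B)).
- by move=> z _; rewrite normrM (ger0_norm (normal_pdf_ge0 0 1 z)) ler_wpM2r // normal_pdf_ge0.
Qed.

Lemma gauss_avg_cvg (u : nat -> R -> R) f B :
  (forall n, measurable_fun setT (u n)) -> (forall n x, `|u n x| <= B) ->
  (forall x, u n x @[n --> \oo] --> f x) ->
  gauss_avg (u n) @[n --> \oo] --> gauss_avg f.
Proof.
move=> mu' uB uf.
have mp : measurable_fun setT (@normal_pdf R 0 1) by exact: measurable_normal_pdf.
apply: (dominated_Rintegral (nu := mu) (G := fun x => B * normal_pdf 0 1 x)) => [n|n x|x|].
- by apply: measurable_funM; [exact: mu' | exact: mp].
- by rewrite normrM (ger0_norm (normal_pdf_ge0 0 1 x)) ler_wpM2r // normal_pdf_ge0.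
- by apply: cvgM; [exact: uf | exact: cvg_cst].
- exact: (gauss_avg_integrable (bm_cst _ B)).
Qed.

(** On the right-hand side the Gaussian is fixed and s only moves the point of
    evaluation, so limits in s follow by dominated convergence. *)
Lemma conv_gauss_avg g (B s x : R) : continuous g -> (forall y, `|g y| <= B) ->
  0 < s -> normal_peak s * conv g s 1 x = gauss_avg (fun z => g (x + s * z)).
Proof.
move=> cg gB s0; have sn0 : s != 0 by rewrite gt_eqF.
have mg : measurable_fun setT g by exact: continuous_measurable_fun.
have bg : bounded_measurable g by split => //; exists B.
have bgs : bounded_measurable (fun z => g (x + s * z)).
  apply: (bm_comp (h := fun z => x + s * z)) => //.
  by apply: measurable_funD => //; exact: measurable_funM.
have -> : normal_peak s * conv g s 1 x = \int[mu]_y (g y * normal_pdf x s y).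
  rewrite /conv -RintegralZl //; last exact: (integrable_conv mg gB).
  apply: eq_Rintegral => y _; rewrite /kernel hornerC mul1r normal_pdfE //; ring.
have ig : mu.-integrable setT (fun y => (g y * normal_pdf x s y)%:E).
  have := integrableZl measurableT (normal_peak s) (integrable_conv mg gB 1 x s0).
  apply: eq_integrable => // y _.
  by rewrite -EFinM /kernel hornerC mul1r normal_pdfE //; congr (_%:E); ring.
(* the substitution rule is for nonnegative integrands: shift g by its bound *)
have e : \int[mu]_y ((g y + B) * normal_pdf x s y) =
    gauss_avg (fun z => g (x + s * z) + B).
  congr fine.
  pose F (z : R) := x + s * z.
  have dF (z : R) : is_derive z 1 F s.
    rewrite /F; apply: is_derive_eq; rewrite add0r /GRing.scale /=; ring.
  have F1 : derive1 F = cst s.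
    by apply/funext => z; rewrite derive1E; have [_ ->] := dF z.
  have cF : continuous F.
    by move=> z; apply/differentiable_continuous/derivable1_diffP; have [] := dF z.
  rewrite (increasing_ge0_integration_by_substitutionT (F := F)) //.
  - apply: eq_integral => z _; rewrite F1 /= !fctE.
    rewrite !normal_pdfE ?oner_eq0 // /F -mulrA; congr ((_ * _)%:E).
    rewrite /normal_peak /normal_fun expr1n mul1r -mulrA [X in _ = X]mulrC.
    rewrite subr0 addrAC subrr add0r.
    have -> : - (s * z) ^+ 2 / (s ^+ 2 *+ 2) = - z ^+ 2 / 2.
      by rewrite -mulr_natr; field.
    rewrite mulrCA; congr (_ * _).
    rewrite -mulrnAr sqrtrM ?sqr_ge0 // sqrtr_sqr gtr0_norm //.
    by rewrite invfM mulrAC mulVf // mul1r.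
  - by move=> y z yz; rewrite /F ltrD2l ltr_pM2l.
  - by rewrite F1 => z; exact: cvg_cst.
  - by rewrite F1; exact: is_cvg_cst.
  - by rewrite F1; exact: is_cvg_cst.
  - apply: (@cvg_comp _ _ _ ( *%R s) (+%R x) _ -oo%R); last exact: cvg_addrl_Ny.
    by apply: gt0_cvgMrNy => //; exact: cvg_id.
  - apply: (@cvg_comp _ _ _ ( *%R s) (+%R x) _ +oo%R); last exact: cvg_addrl.
    by apply: gt0_cvgMry => //; exact: cvg_id.
  - move=> y; apply: cvgM; last exact: continuous_normal_pdf.
    by apply: cvgD; [exact: cg | exact: cvg_cst].
  - move=> y; rewrite mulr_ge0 ?normal_pdf_ge0 //.
    by have := gB y; rewrite ler_norml; lra.
move: e; rewrite gauss_avgD // gauss_avg_cst.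
have -> : \int[mu]_y ((g y + B) * normal_pdf x s y) =
    \int[mu]_y (g y * normal_pdf x s y) + B.
  transitivity (\int[mu]_y (g y * normal_pdf x s y + B * normal_pdf x s y)).
    by apply: eq_Rintegral => y _; rewrite mulrDl.
  rewrite RintegralD //; last first.
    by have := integrableZl measurableT B (integrable_normal_pdf x s).
  congr (_ + _); rewrite RintegralZl //; last exact: integrable_normal_pdf.
  by rewrite /Rintegral integral_normal_pdf /= mulr1.
by move=> /addIr.
Qed.

End GaussianAverage.

(** * Extending the functional inequalities beyond smooth functions *)

Section Approximation.
Variable R : realType.
Implicit Types g : R -> R.

Lemma gauss_avg_ge (f : R -> R) c : bounded_measurable f -> (forall z, c <= f z) ->
  c <= gauss_avg f.
Proof.
move=> bf cf; rewrite -[leLHS]gauss_avg_cst; apply: le_Rintegral => //.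
- exact: (gauss_avg_integrable (bm_cst _ c)).
- exact: gauss_avg_integrable.
- by move=> z _; rewrite ler_wpM2r // normal_pdf_ge0.
Qed.

(** Gaussian smoothing at scale 1/(n+1) keeps every uniform bound and
    converges pointwise together with the derivative. *)
Lemma taylor1_smooth_approx g g1 : taylor1 g g1 ->
  exists (h h1 : nat -> R -> R) (B L : R),
  [/\ forall n, smooth (h n) /\ taylor1 (h n) (h1 n),
      forall n x, derive1 (h n) x = h1 n x,
      forall x, (h n x @[n --> \oo] --> g x) /\ (h1 n x @[n --> \oo] --> g1 x),
      forall n x, `|h n x| <= B /\ `|h1 n x| <= L
    & forall c, (forall x, c <= g x) -> forall n x, c <= h n x].
Proof.
move=> gt; have [B [L [K [gB g1L gK]]]] := gt.
have [mg _] := taylor1_bm gt; have [mg1 _] := taylor1_deriv_bm gt.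
pose s n : R := n.+1%:R^-1.
have s0 n : 0 < s n by rewrite invr_gt0.
pose avg f n (x : R) := gauss_avg (fun z => f (x + s n * z)).
have bms (f : R -> R) C n x : measurable_fun setT f -> (forall t, `|f t| <= C) ->
    bounded_measurable (fun z : R => f (x + s n * z)).
  move=> mf fC; apply: (bm_comp (h := fun z => x + s n * z)).
    by apply: measurable_funD => //; exact: measurable_funM.
  by split=> //; exists C.
have K0 : 0 <= K by have := le_trans (normr_ge0 _) (gK 1 0); rewrite subr0 expr1n mulr1.
have hK n x' x : `|avg g n x' - avg g n x - (x' - x) * avg g1 n x| <= K * (x' - x) ^+ 2.
  have b1 := bms _ _ n x' mg gB; have b2 := bms _ _ n x mg gB.
  have b3 := bms _ _ n x mg1 g1L.
  rewrite /avg -gauss_avgZ // -gauss_avgB // -gauss_avgB //; last 2 first.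
  - exact: bmB.
  - exact: bmZ.
  apply: gauss_avg_norm; first by apply: bmB; [exact: bmB | exact: bmZ].
  move=> z; have := gK (x' + s n * z) (x + s n * z).
  by rewrite opprD addrACA subrr addr0.
have ht n : taylor1 (avg g n) (avg g1 n).
  exists B, L, K; split => [x|x|x' x]; last exact: hK.
    by apply: gauss_avg_norm => [|z]; [exact: bms gB | exact: gB].
  by apply: gauss_avg_norm => [|z]; [exact: bms g1L | exact: g1L].
have cvg_s (x z : R) : x + s n * z @[n --> \oo] --> x.
  rewrite -[X in _ --> X]addr0 -[X in _ --> _ + X](mul0r z).
  apply: cvgD; first exact: cvg_cst.
  by apply: cvgM; [exact: cvg_harmonic | exact: cvg_cst].
have cvg_avg (f : R -> R) C : continuous f -> (forall t, `|f t| <= C) ->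
    forall x, avg f n x @[n --> \oo] --> f x.
  move=> cf fC x; rewrite -[X in _ --> X]gauss_avg_cst.
  have mf : measurable_fun setT f by exact: continuous_measurable_fun.
  apply: (gauss_avg_cvg (B := C)) => [n|n z|z]; first by have [] := bms _ _ n x mf fC.
    exact: fC.
  by apply: (cvg_comp _ f) (cf x); exact: cvg_s.
have [M1 g1M] := taylor1_deriv_lipschitz gt.
exists (avg g), (avg g1), B, L; split.
- move=> n; split; last exact: ht.
  have -> : avg g n = fun x => normal_peak (s n) * conv g (s n) 1 x.
    apply/funext => x.
    by rewrite (conv_gauss_avg x (taylor1_continuous gt) gB (s0 n)).
  exact: smooth_conv.
- move=> n x; rewrite derive1E; have [_] := taylor_is_derive (fun y _ => hK n y x).
  exact.
- move=> x; split; first exact: cvg_avg (taylor1_continuous gt) gB x.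
  exact: cvg_avg (lipschitz_continuous g1M) g1L x.
- move=> n x.
  split; first by apply: gauss_avg_norm => [|z]; [exact: bms gB | exact: gB].
  by apply: gauss_avg_norm => [|z]; [exact: bms g1L | exact: g1L].
- move=> c cg n x; apply: gauss_avg_ge => [|z]; last exact: cg.
  exact: bms gB.
Qed.

Variables (nu : probability R R) (sigma : R).

Lemma energy_taylor1 g g1 : taylor1 g g1 -> (forall x, derive1 g x = g1 x) ->
  energy nu g = (\int[nu]_x (g1 x ^+ 2))%:E.
Proof.
move=> gt gE; rewrite bm_EFin; last by apply: bmX; exact: taylor1_deriv_bm gt.
by apply: eq_integral => x _; rewrite gE real_normK ?num_real.
Qed.

Lemma bounded_fun_of g B : (forall x, `|g x| <= B) -> bounded_fun g.
Proof.
move=> gB; exists B; split; first exact: num_real.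
by move=> M BM x _; apply: le_trans (gB x) (ltW BM).
Qed.

Lemma PI_taylor1 g g1 : PI sigma nu -> taylor1 g g1 ->
  Var nu g <= sigma ^+ 2 * \int[nu]_x (g1 x ^+ 2).
Proof.
move=> pi gt; have [h [h1 [B [L [hs hd hc hB _]]]]] := taylor1_smooth_approx gt.
have hle n : Var nu (h n) <= sigma ^+ 2 * \int[nu]_x (h1 n x ^+ 2).
  rewrite -lee_fin EFinM -(energy_taylor1 (hs n).2 (hd n)).
  by apply: pi; [exact: (hs n).1 | exact: (bounded_fun_of (fun x => (hB n x).1))].
have mh n : measurable_fun setT (h n) by have [] := taylor1_bm (hs n).2.
have mh1 n : measurable_fun setT (h1 n) by have [] := taylor1_deriv_bm (hs n).2.
have sqc (u : nat -> R -> R) (v : R -> R) C : (forall n, measurable_fun setT (u n)) ->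
    (forall n x, `|u n x| <= C) -> (forall x, u n x @[n --> \oo] --> v x) ->
    \int[nu]_x (u n x ^+ 2) @[n --> \oo] --> \int[nu]_x (v x ^+ 2).
  move=> mu uC uv; apply: (bounded_convergence (B := C ^+ 2)).
  - by move=> n; exact: measurable_funX.
  - by move=> n x; rewrite normrX ler_pXn2r ?nnegrE // (le_trans _ (uC n x)).
  - by move=> x; rewrite expr2; apply: cvgM; exact: uv.
have l1 : Var nu (h n) @[n --> \oo] --> Var nu g.
  apply: cvgB; first exact: (sqc h g B mh (fun n x => (hB n x).1) (fun x => (hc x).1)).
  rewrite expr2; apply: cvgM;
    by apply: (bounded_convergence (B := B) mh) => [n x|x]; [exact: (hB n x).1 | exact: (hc x).1].
have l2 := sqc h1 g1 L mh1 (fun n x => (hB n x).2) (fun x => (hc x).2).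
by apply: (ler_cvg_to l1 _ (nearW _ hle)); apply: cvgM l2; exact: cvg_cst.
Qed.

Lemma measurable_xlnx : measurable_fun setT (fun u : R => u * ln u).
Proof. by apply: measurable_funM => //; exact: measurable_ln. Qed.

Lemma ln_itv_bound (a b u : R) : 0 < a -> a <= u <= b -> `|ln u| <= b + a^-1.
Proof.
move=> a0 /andP[au ub]; have u0 : 0 < u := lt_le_trans a0 au.
have h1 := ln_sublinear u0.
have h2 : ln u^-1 < u^-1 by apply: ln_sublinear; rewrite invr_gt0.
have h3 : u^-1 <= a^-1 by rewrite lef_pV2 ?posrE.
have ai : 0 < a^-1 by rewrite invr_gt0.
by move: h2; rewrite lnV ?posrE // ler_norml; lra.
Qed.

Lemma xlnx_itv_bound (a b u : R) : 0 < a -> a <= u <= b ->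
  `|u * ln u| <= b * (b + a^-1).
Proof.
move=> a0 aub; rewrite normrM ler_pM ?ln_itv_bound //.
by case/andP: aub => au ub; rewrite ger0_norm // (le_trans _ au) // ltW.
Qed.

(** The lower bound on g keeps the logarithm bounded along the smooth
    approximations. *)
Lemma LSI_taylor1 g g1 c : LSI sigma nu -> taylor1 g g1 -> 0 < c ->
  (forall x, c <= g x) ->
  Ent nu (fun x => g x ^+ 2) <= 2 * sigma ^+ 2 * \int[nu]_x (g1 x ^+ 2).
Proof.
move=> lsi gt c0 cg; have [h [h1 [B [L [hs hd hc hB hl]]]]] := taylor1_smooth_approx gt.
have hle n : Ent nu (fun x => h n x ^+ 2) <= 2 * sigma ^+ 2 * \int[nu]_x (h1 n x ^+ 2).
  rewrite -lee_fin EFinM -(energy_taylor1 (hs n).2 (hd n)).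
  by apply: lsi; [exact: (hs n).1 | exact: (bounded_fun_of (fun x => (hB n x).1))].
have mh n : measurable_fun setT (h n) by have [] := taylor1_bm (hs n).2.
have mh1 n : measurable_fun setT (h1 n) by have [] := taylor1_deriv_bm (hs n).2.
have mh2 n : measurable_fun setT (fun x => h n x ^+ 2) by exact: measurable_funX.
have h2B n x : c ^+ 2 <= h n x ^+ 2 <= B ^+ 2.
  have c1 := hl c cg n x; have [hb _] := hB n x.
  have hn0 : 0 <= h n x by apply: le_trans c1; exact: ltW.
  have hnB : h n x <= B := le_trans (ler_norm _) hb.
  have c0' := ltW c0; have B0 : 0 <= B := le_trans hn0 hnB.
  by rewrite !ler_pXn2r ?nnegrE // c1 hnB.
have h2n n x : `|h n x ^+ 2| <= B ^+ 2.
  by rewrite ger0_norm ?sqr_ge0 //; case/andP: (h2B n x).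
have h2c x : h n x ^+ 2 @[n --> \oo] --> g x ^+ 2.
  by rewrite expr2; apply: cvgM; exact: (hc x).1.
have g0 x : 0 < g x ^+ 2 by rewrite exprn_gt0 // (lt_le_trans c0).
have c20 : 0 < c ^+ 2 by rewrite exprn_gt0.
have i2c : \int[nu]_x (h n x ^+ 2) @[n --> \oo] --> \int[nu]_x (g x ^+ 2).
  exact: (bounded_convergence (B := B ^+ 2) mh2).
have bg2 : bounded_measurable (fun x => g x ^+ 2) by apply: bmX; exact: taylor1_bm gt.
have ig0 : 0 < \int[nu]_x (g x ^+ 2).
  apply: (lt_le_trans c20); rewrite -[leLHS](prob_int_cst nu); apply: bm_int_le => // x.
  by rewrite ler_pXn2r ?nnegrE ?(ltW c0) // (le_trans _ (cg x)) // ltW.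
have l1 : Ent nu (fun x => h n x ^+ 2) @[n --> \oo] --> Ent nu (fun x => g x ^+ 2).
  apply: cvgB.
    apply: (bounded_convergence (B := B ^+ 2 * (B ^+ 2 + (c ^+ 2)^-1))).
    + move=> n; apply: (measurableT_comp measurable_xlnx); exact: mh2.
    + by move=> n x; apply: xlnx_itv_bound.
    + move=> x; apply: cvgM; first exact: h2c.
      by apply: continuous_cvg; [exact: continuous_ln | exact: h2c].
  apply: cvgM; first exact: i2c.
  by apply: continuous_cvg; [exact: continuous_ln | exact: i2c].
apply: (ler_cvg_to l1 _ (nearW _ hle)); apply: cvgM; first exact: cvg_cst.
apply: (bounded_convergence (B := L ^+ 2)).
- by move=> n; exact: measurable_funX.
- move=> n x; rewrite normrX ler_pXn2r ?nnegrE ?(hB n x).2 //.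
  exact: le_trans (hB n x).2.
- by move=> x; rewrite expr2; apply: cvgM; exact: (hc x).2.
Qed.

End Approximation.

(** * The spectral gap *)

Section SpectralGap.
Variables (R : realType) (nu : probability R R).
Implicit Types g : R -> R.

(** With [taylor1] in place of smoothness, [PI] and [LSI] give instances of one
    notion that differ in the constant only. *)
Definition spectral_gap (tau : R) : Prop := forall g g1 : R -> R,
  taylor1 g g1 -> Var nu g <= tau * \int[nu]_x (g1 x ^+ 2).

Lemma spectral_gap_PI sigma : PI sigma nu -> spectral_gap (sigma ^+ 2).
Proof. by move=> pi g g1 gt; exact: PI_taylor1. Qed.

Lemma taylor1_shift g g1 c : taylor1 g g1 -> taylor1 (fun x => g x + c) g1.
Proof.
move=> [B [L [K [gB g1L gK]]]]; exists (B + `|c|), L, K; split => // [t|s t].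
  by apply: (le_trans (ler_normD _ _)); exact: lerD.
by rewrite [X in X - _](_ : _ = g s - g t); [exact: gK | ring].
Qed.

Lemma Var_shift g c : bounded_measurable g -> Var nu (fun x => g x + c) = Var nu g.
Proof.
move=> bg; rewrite /Var bm_intD // prob_int_cst.
transitivity (\int[nu]_x (g x ^+ 2 + (2 * c * g x + c ^+ 2)) - (\int[nu]_x g x + c) ^+ 2).
  by congr (_ - _); apply: eq_Rintegral => x _; ring.
rewrite bm_intD; [|exact: bmX|by apply: bmD => //; exact: bmZ].
by rewrite bm_intD //; [rewrite bm_intZ // prob_int_cst; ring | exact: bmZ].
Qed.

(** With m the mean and a^2 the second moment of g, the inequality
    ln (g / a) >= 1 - a / g bounds the entropy below by 2 a^2 - 2 a m, which
    exceeds the variance a^2 - m^2 by (a - m)^2. *)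
Lemma Var_le_Ent g b : bounded_measurable g -> (forall x, 1 <= g x <= b) ->
  Var nu g <= Ent nu (fun x => g x ^+ 2).
Proof.
move=> bg gb; pose m2 := \int[nu]_x (g x ^+ 2); pose m := \int[nu]_x g x.
have g0 x : 0 < g x by have /andP[g1 _] := gb x; exact: lt_le_trans g1.
have bg2 : bounded_measurable (fun x => g x ^+ 2) by exact: bmX.
have m21 : 1 <= m2.
  rewrite -[leLHS](prob_int_cst nu); apply: bm_int_le => // x.
  by have /andP[g1 _] := gb x; rewrite expr_ge1 // ltW.
have m20 : 0 < m2 by apply: lt_le_trans m21.
pose a := Num.sqrt m2; have a0 : 0 < a by rewrite sqrtr_gt0.
have a2 : a ^+ 2 = m2 by rewrite sqr_sqrtr // ltW.
have g2b x : 1 <= g x ^+ 2 <= b ^+ 2.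
  have /andP[g1 gbx] := gb x; rewrite expr_ge1 ?(ltW (g0 x)) // g1 /=.
  by rewrite ler_pXn2r ?nnegrE // ?(le_trans _ gbx) // ltW.
have bl : bounded_measurable (fun x => g x ^+ 2 * ln (g x ^+ 2)).
  apply: (bm_comp_itv (a := 1) (b := b ^+ 2) bg2 g2b (@measurable_xlnx R)).
  by exists (b ^+ 2 * (b ^+ 2 + 1^-1)) => u; exact: xlnx_itv_bound.
have pt x : 2 * g x ^+ 2 - 2 * a * g x <= g x ^+ 2 * ln (g x ^+ 2) - ln m2 * g x ^+ 2.
  have gx := g0 x; rewrite [ln m2 * _]mulrC -mulrBr -ln_div ?posrE ?exprn_gt0 //.
  rewrite -a2 -expr_div_n lnXn; last by rewrite divr_gt0.
  have h := ln_sublinear (divr_gt0 a0 gx).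
  have h1 : ln (a / g x) <= a / g x - 1.
    have := @le_ln1Dx R (a / g x - 1); rewrite addrCA subrr addr0; apply.
    by rewrite ltrBrDl subrr divr_gt0.
  have -> : ln (g x / a) = - ln (a / g x) by rewrite -lnV ?posrE ?divr_gt0 // invf_div.
  have -> : 2 * g x ^+ 2 - 2 * a * g x = g x ^+ 2 * (- (a / g x - 1) *+ 2).
    by rewrite -mulr_natr; field; rewrite gt_eqF.
  by rewrite ler_pM2l ?exprn_gt0 // lerMn2r lerN2 h1 orbT.
have hE : 2 * m2 - 2 * a * m <= Ent nu (fun x => g x ^+ 2).
  have b1 : bounded_measurable (fun x => 2 * g x ^+ 2) by exact: bmZ.
  have b2 : bounded_measurable (fun x => 2 * a * g x) by exact: bmZ.
  have b3 : bounded_measurable (fun x => ln m2 * g x ^+ 2) by exact: bmZ.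
  have := @bm_int_le _ _ R nu _ _ (bmB b1 b2) (bmB bl b3) pt.
  by rewrite !bm_intB // !bm_intZ // [ln m2 * _]mulrC.
apply: le_trans hE; rewrite /Var -/m2 -/m -a2.
by have := sqr_ge0 (a - m); rewrite sqrrB; lra.
Qed.

(** A shift above 1 changes neither the variance nor the derivative of g. The
    factor 2 lost against the sharp constant is harmless. *)
Lemma spectral_gap_LSI sigma : LSI sigma nu -> spectral_gap (2 * sigma ^+ 2).
Proof.
move=> lsi g g1 gt; have [B [L [K [gB _ _]]]] := gt.
rewrite -(Var_shift (B + 1) (taylor1_bm gt)).
have ht := taylor1_shift (B + 1) gt.
have hb x : 1 <= g x + (B + 1) <= 2 * B + 1.
  by have := gB x; rewrite ler_norml; lra.
apply: le_trans (Var_le_Ent (taylor1_bm ht) hb) _.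
by apply: (LSI_taylor1 lsi ht ltr01) => x; case/andP: (hb x).
Qed.

(** A bounded substitute for the identity: it has slope at most one and tends
    to the identity as d tends to 0. *)
Let trunc (d x : R) : R := x / (1 + (d * x) ^+ 2).
Let trunc1 (d x : R) : R := (1 - (d * x) ^+ 2) / (1 + (d * x) ^+ 2) ^+ 2.

Let den_gt0 (a : R) : 0 < 1 + a ^+ 2.
Proof. by rewrite ltr_pwDl // sqr_ge0. Qed.

Let trunc1_le1 d x : `|trunc1 d x| <= 1.
Proof.
have q0 := den_gt0 (d * x); rewrite /trunc1 normrM normfV.
rewrite [`|_ ^+ 2|]ger0_norm ?sqr_ge0 // ler_pdivrMr ?exprn_gt0 // mul1r.
by have := sqr_ge0 (d * x); rewrite ler_norml expr2; nra.
Qed.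

Let trunc_le_id d x : `|trunc d x| <= `|x|.
Proof.
have q0 := den_gt0 (d * x); rewrite /trunc normrM normfV [`|1 + _|]gtr0_norm //.
by rewrite ler_pdivrMr // ler_peMr // lerDl sqr_ge0.
Qed.

Let taylor1_trunc d : 0 < d -> taylor1 (trunc d) (trunc1 d).
Proof.
move=> d0; exists d^-1, 1, (4 * d); split => [t|t|s t]; last 1 first.
- have q1 := den_gt0 (d * s); have q2 := den_gt0 (d * t).
  have -> : trunc d s - trunc d t - (s - t) * trunc1 d t =
     (s - t) ^+ 2 * (d * (((d * s) * (d * t) ^+ 2 - 2 * (d * t) - d * s) /
        ((1 + (d * t) ^+ 2) ^+ 2 * (1 + (d * s) ^+ 2)))).
    by rewrite /trunc /trunc1; field; rewrite !gt_eqF.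
  rewrite normrM (ger0_norm (sqr_ge0 _)) mulrC ler_wpM2r ?sqr_ge0 //.
  rewrite normrM (gtr0_norm d0) mulrC ler_pM2r //.
  have Q0 : 0 < (1 + (d * t) ^+ 2) ^+ 2 * (1 + (d * s) ^+ 2).
    by rewrite mulr_gt0 // exprn_gt0.
  rewrite normrM normfV (gtr0_norm Q0) ler_pdivrMr //.
  move: (d * s) (d * t) => a b.
  have a2 : `|a| <= 1 + a ^+ 2 by rewrite ler_norml; have := sqr_ge0 (a - 1); have := sqr_ge0 (a + 1); rewrite !expr2; nra.
  have b2 : `|b| <= 1 + b ^+ 2 by rewrite ler_norml; have := sqr_ge0 (b - 1); have := sqr_ge0 (b + 1); rewrite !expr2; nra.
  have A1 : 1 <= 1 + a ^+ 2 by rewrite lerDl sqr_ge0.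
  have B1 : 1 <= 1 + b ^+ 2 by rewrite lerDl sqr_ge0.
  have hb2 : `|b ^+ 2| <= 1 + b ^+ 2 by rewrite ger0_norm ?sqr_ge0 // lerDr.
  apply: (@le_trans _ _ (`|a| * `|b ^+ 2| + 2 * `|b| + `|a|)).
    rewrite -normrM -[X in _ <= _ + X * _ + _](@ger0_norm R 2) // -normrM.
    by apply: (le_trans (ler_normB _ _)); rewrite lerD2r; exact: ler_normB.
  move: a2 b2 A1 B1 hb2 (normr_ge0 a) (normr_ge0 b) (normr_ge0 (b ^+ 2)).
  move: (1 + a ^+ 2) (1 + b ^+ 2) `|a| `|b| `|b ^+ 2| => A B x y z.
  move=> xA yB A1 B1 zB x0 y0 z0.
  have AB : 1 <= A * B by nra.
  have h1 : x * z <= A * B by apply: ler_pM.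
  have h2 : y <= A * B by nra.
  have h3 : x <= A * B by nra.
  have h4 : A * B <= B ^+ 2 * A by rewrite expr2; nra.
  by nra.
- have q0 := den_gt0 (d * t); rewrite /trunc normrM normfV [`|1 + _|]gtr0_norm //.
  rewrite ler_pdivrMr // ler_pdivlMl // -{1}(gtr0_norm d0) -normrM.
  by rewrite ler_norml; have := sqr_ge0 (d * t - 1); have := sqr_ge0 (d * t + 1); rewrite !expr2; nra.
- exact: trunc1_le1.
Qed.

(** Tested on the truncated identity, a spectral gap controls the variance. *)
Lemma spectral_gap_ge1 tau : 0 <= tau -> spectral_gap tau ->
  (\int[nu]_x x%:E = 0)%E -> (\int[nu]_x (x ^+ 2)%:E = 1)%E -> 1 <= tau.
Proof.
move=> tau0 gap m1 m2.
pose d n : R := n.+1%:R^-1.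
have d0 n : 0 < d n by rewrite invr_gt0.
have vle n : Var nu (trunc (d n)) <= tau.
  apply: (le_trans (gap _ _ (taylor1_trunc (d0 n)))).
  rewrite -[leRHS]mulr1 ler_wpM2l // -[leRHS](prob_int_cst nu); apply: bm_int_le => //.
    by apply: bmX; exact: taylor1_deriv_bm (taylor1_trunc (d0 n)).
  by move=> x; rewrite -real_normK ?num_real // expr_le1.
have mt n : measurable_fun setT (trunc (d n)) by have [] := taylor1_bm (taylor1_trunc (d0 n)).
have i2 : nu.-integrable setT (EFin \o (fun x : R => x ^+ 2)).
  apply/integrableP; split; first by apply/measurable_EFinP; exact: exprn_measurable.
  rewrite (eq_integral (fun x : R => (x ^+ 2)%:E)) ?m2 ?ltry // => x _ /=.
  by rewrite ger0_norm // sqr_ge0.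
have i1 : nu.-integrable setT (EFin \o (fun x : R => 1 + x ^+ 2)).
  have := integrableD measurableT (bm_integrable nu (bm_cst _ 1)) i2.
  by apply: eq_integrable.
have tc (x : R) : trunc (d n) x @[n --> \oo] --> x.
  have e0 : x / (1 + (0 * x) ^+ 2) = x by rewrite mul0r expr0n addr0 divr1.
  rewrite -[X in _ --> X]e0; apply: cvgM; first exact: cvg_cst.
  apply: cvgV; first by rewrite gt_eqF.
  have dx : d n * x @[n --> \oo] --> 0 * x by apply: cvgM; [exact: cvg_harmonic | exact: cvg_cst].
  by apply: cvgD; [exact: cvg_cst | rewrite expr2; apply: cvgM].
have l1 : \int[nu]_x (trunc (d n) x) @[n --> \oo] --> \int[nu]_x x.
  apply: (dominated_Rintegral (nu := nu) mt _ tc i1) => n x; apply: (le_trans (trunc_le_id _ _)).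
  by rewrite ler_norml; have := sqr_ge0 (x - 1); have := sqr_ge0 (x + 1); rewrite !expr2; nra.
have l2 : \int[nu]_x (trunc (d n) x ^+ 2) @[n --> \oo] --> \int[nu]_x (x ^+ 2).
  apply: (dominated_Rintegral (nu := nu) _ _ _ i2) => [n|n x|x].
  - exact: measurable_funX.
  - rewrite normrX -[leRHS]real_normK ?num_real //.
    by rewrite ler_pXn2r ?nnegrE // trunc_le_id.
  - by rewrite expr2; apply: cvgM; exact: tc.
have l : Var nu (trunc (d n)) @[n --> \oo] --> \int[nu]_x (x ^+ 2) - (\int[nu]_x x) ^+ 2.
  by apply: cvgB l2 _; rewrite expr2; apply: cvgM.
have := cvgr_to_le l (nearW _ vle).
by rewrite /Rintegral m1 m2 /= expr0n subr0; apply.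
Qed.

End SpectralGap.

(** * Resampling a coordinate of an independent family *)

Section Update.
Variables (R : realType) (N : nat).
Implicit Types (x : N.-tuple R).

Definition upd x (i : 'I_N) (t : R) : N.-tuple R :=
  [tuple if j == i then t else tnth x j | j < N].

Lemma tnth_upd x i t j : tnth (upd x i t) j = if j == i then t else tnth x j.
Proof. by rewrite tnth_mktuple. Qed.

Lemma upd_upd x i s t : upd (upd x i s) i t = upd x i t.
Proof. by apply: eq_from_tnth => j; rewrite !tnth_upd; case: eqP. Qed.

Lemma upd_comm x i j s t : i != j ->
  upd (upd x i s) j t = upd (upd x j t) i s.
Proof.
move=> ij; apply: eq_from_tnth => k; rewrite !tnth_upd.
by case: (eqVneq k j) => [->|//]; rewrite eq_sym (negPf ij).
Qed.

Lemma upd_same x i : upd x i (tnth x i) = x.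
Proof. by apply: eq_from_tnth => j; rewrite tnth_upd; case: eqP => [->|]. Qed.

Lemma measurable_upd i :
  measurable_fun setT (fun p : N.-tuple R * R => upd p.1 i p.2).
Proof.
apply/measurable_fun_tnthP => j /=.
rewrite (_ : _ \o _ = fun p : N.-tuple R * R => if j == i then p.2 else tnth p.1 j); last first.
  by apply/funext => p /=; rewrite tnth_upd.
case: (j == i); first exact: measurable_snd.
apply: (measurableT_comp (f := fun x : N.-tuple R => tnth x j)).
  exact: measurable_tnth.
exact: measurable_fst.
Qed.

Lemma measurable_updr x i : measurable_fun setT (upd x i).
Proof. exact: (measurable_fun_pair2 x (@measurable_upd i)). Qed.

Lemma bm_upd (f : N.-tuple R -> R) x i : bounded_measurable f ->
  bounded_measurable (fun t => f (upd x i t)).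
Proof. by move=> bf; apply: bm_comp bf; exact: measurable_updr. Qed.

(** Coordinate boxes: a generating pi-system on which independence can be
    tested. *)
Definition box (B : 'I_N -> set R) : set (N.-tuple R) :=
  [set x | forall i, B i (tnth x i)].

Definition boxes : set (set (N.-tuple R)) :=
  [set A | exists2 B, (forall i, measurable (B i)) & A = box B].

Lemma boxes_setI : setI_closed boxes.
Proof.
move=> _ _ [B mB ->] [C mC ->]; exists (fun i => B i `&` C i).
  by move=> i; exact: measurableI.
apply/seteqP; split=> x /=; first by move=> [Bx Cx] i; split.
by move=> BC; split=> i; case: (BC i).
Qed.

Lemma measurable_box B : (forall i, measurable (B i)) -> measurable (box B).
Proof.
move=> mB.
rewrite (_ : box B = \bigcap_(i in [set` 'I_N]) ((fun x => tnth x i) @^-1` B i)); last first.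
  by apply/seteqP; split=> x /= h i; [move=> _; exact: h | exact: (h i isT)].
apply: fin_bigcap_measurable => // i _.
by rewrite -[X in measurable X]setTI; exact: measurable_tnth.
Qed.

Lemma measurable_boxes : @measurable _ (N.-tuple R) = <<s boxes >>.
Proof.
apply/seteqP; split; last first.
  apply: smallest_sub; first exact: sigma_algebra_measurable.
  by move=> _ [B mB ->]; exact: measurable_box.
apply: smallest_sub; first exact: smallest_sigma_algebra.
apply: (subset_trans _ (@sub_sigma_algebra _ setT boxes)).
rewrite -bigcup_seq /= => A [i _ [B mB <-]].
exists (fun j => if j == i then B else setT).
  by move=> j; case: ifP.
apply/seteqP; split=> x /=.
  by move=> [_ Bx] j; case: eqP => [->|//].
by move=> /(_ i); rewrite eqxx.
Qed.

End Update.

Section Independence.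
Context d (T : measurableType d) (R : realType) (P : probability T R) (N : nat).
Variable xi : 'I_N -> {RV P >-> R}.
Hypothesis indep : mutually_independent [set: 'I_N]%SET xi.

Definition joint (w : T) : N.-tuple R := [tuple xi i w | i < N].

Lemma measurable_joint : measurable_fun setT joint.
Proof.
apply/measurable_fun_tnthP => i.
by rewrite (_ : _ \o _ = xi i) //; apply/funext => w /=; rewrite tnth_mktuple.
Qed.

Definition coord_law i : probability R R := distribution P (xi i).

(** The vector of all the variables with the i-th one replaced by an
    independent variable that lives on the second factor of the sample space. *)
Definition resample i (p : T * R) : N.-tuple R := upd (joint p.1) i p.2.

Lemma measurable_resample i : measurable_fun setT (resample i).
Proof.
rewrite (_ : resample i = (fun p => upd p.1 i p.2) \o (fun p => (joint p.1, p.2))) //.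
apply: measurableT_comp; first exact: measurable_upd.
apply: measurable_fun_pair; last exact: measurable_snd.
by apply: measurableT_comp; [exact: measurable_joint | exact: measurable_fst].
Qed.

Let joint_mf : {mfun T >-> N.-tuple R} := mfun_Sub (mem_set measurable_joint).
Let resample_mf i : {mfun (T * R)%type >-> N.-tuple R} :=
  mfun_Sub (mem_set (@measurable_resample i)).

(** Drawing one coordinate anew from its own law does not change the joint
    law: this is the form in which independence is used. *)
Lemma resample_law i (A : set (N.-tuple R)) : measurable A ->
  P (joint @^-1` A) = (P \x coord_law i)%E (resample i @^-1` A).
Proof.
move=> mA.
apply: (@measure_unique _ R (N.-tuple R) (@boxes R N) (fun=> setT) _ _ _ _
  (pushforward P joint_mf) (pushforward (P \x coord_law i)%E (resample_mf i))) => //.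
- exact: measurable_boxes.
- exact: boxes_setI.
- move=> n; exists (fun=> setT) => //.
  by apply/seteqP; split.
- by rewrite bigcup_const.
- move=> _ [B mB ->].
  change (P (joint @^-1` box B) = (P \x coord_law i)%E (resample i @^-1` box B)).
  have bigE (J : {set 'I_N}) : P (\bigcap_(j in [set` J]) (xi j @^-1` B j)) =
      (\prod_(j in J) P (xi j @^-1` B j))%E.
    by apply: indep => [|j _]; [exact: finset.subsetT | exact: mB].
  have -> : joint @^-1` box B = \bigcap_(j in [set` [set: 'I_N]%SET]) (xi j @^-1` B j).
    apply/seteqP; split=> w /=.
      by move=> h j _; have := h j; rewrite tnth_mktuple.
    by move=> h j; rewrite tnth_mktuple; apply: (h j); rewrite /= inE.
  have -> : resample i @^-1` box B =
     (\bigcap_(j in [set` [set: 'I_N]%SET :\ i]) (xi j @^-1` B j)) `*` B i.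
    apply/seteqP; split=> -[w t] /=.
      move=> h; split=> /=.
        move=> j /=; rewrite !inE andbT => /negPf ji.
        by have := h j; rewrite tnth_upd ji tnth_mktuple.
      by have := h i; rewrite tnth_upd eqxx.
    move=> [h Bt] j; rewrite tnth_upd; case: eqP => [->//|/eqP ji].
    by rewrite tnth_mktuple; apply: (h j); rewrite /= !inE ji.
  rewrite product_measure1E //; last first.
    apply: fin_bigcap_measurable; first exact: finite_finset.
    by move=> j _; rewrite -[X in measurable X]setTI; exact: measurable_funPT.
  rewrite !bigE (big_setD1 i) ?inE //= muleC.
  by congr (_ * _)%E; apply: esym; exact: (bigE (finset.setT :\ i)%SET).
- move=> n; change (P (joint @^-1` setT) < +oo)%E.
  by rewrite preimage_setT probability_setT ltry.
Qed.

Lemma joint_resample i (f : N.-tuple R -> R) : bounded_measurable f ->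
  \int[P]_w f (joint w) =
  \int[P]_w \int[coord_law i]_t f (upd (joint w) i t).
Proof.
move=> bf; have [mf _] := bf.
have bj : bounded_measurable (f \o joint) by apply: bm_comp bf; exact: measurable_joint.
have br : bounded_measurable (f \o resample i).
  by apply: bm_comp bf; exact: measurable_resample.
have ir : (P \x coord_law i)%E.-integrable setT (EFin \o (f \o resample i)).
  exact: bm_integrable.
transitivity (fine (\int[(P \x coord_law i)%E]_p (f (resample i p))%:E)).
  congr fine.
  transitivity (\int[pushforward P joint_mf]_x (f x)%:E)%E.
    rewrite integral_pushforward //=.
    - exact: measurable_joint.
    - exact/measurable_EFinP.
    - by rewrite preimage_setT; exact: bm_integrable.
  rewrite (eq_measure_integral (pushforward (P \x coord_law i)%E (resample_mf i))); last first.
    by move=> A mA _; exact: resample_law.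
  rewrite integral_pushforward //=.
  - exact: measurable_resample.
  - exact/measurable_EFinP.
rewrite -(integral12_prod_meas1 ir) /=; congr fine.
apply: eq_integral => w _; rewrite /fubini_F -bm_EFin //.
exact: (bm_upd (joint w) i bf).
Qed.

Definition avg i (f : N.-tuple R -> R) (x : N.-tuple R) : R :=
  \int[coord_law i]_t f (upd x i t).

Lemma bm_avg i f : bounded_measurable f -> bounded_measurable (avg i f).
Proof.
move=> bf; have [mf [B fB]] := bf; split; last first.
  exists B => x; apply: bm_int_norm => // .
  exact: bm_upd.
(* measurability of a partial integral is available for nonnegative functions:
   shift f by its bound *)
pose g (p : N.-tuple R * R) : \bar R := (f (upd p.1 i p.2) + B)%:E.
have mu : measurable_fun setT g.
  apply/measurable_EFinP; apply: measurable_funD => //.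
  by apply: (measurableT_comp mf); exact: measurable_upd.
have u0 p : (0 <= g p)%E.
  by rewrite /g lee_fin; have := fB (upd p.1 i p.2); rewrite ler_norml; lra.
have h : measurable_fun setT (fubini_F (coord_law i) g).
  exact: measurable_fun_fubini_tonelli_F.
have bu x : bounded_measurable (fun t => f (upd x i t)).
  exact: bm_upd.
have -> : avg i f = fun x => fine (\int[coord_law i]_t (f (upd x i t) + B)%:E) - B.
  apply/funext => x; rewrite -[fine _]/(\int[coord_law i]_t (f (upd x i t) + B)).
  by rewrite bm_intD // prob_int_cst addrK.
apply: measurable_funB => //.
by apply: (measurableT_comp _ h); exact: fine_measurable.
Qed.

End Independence.

(** * Tensorization of variance and entropy *)

(** The variance for Phi u = u^2, the entropy for Phi u = u ln u. *)
Definition phi_ent (R : realType) (Phi : R -> R) (nu : probability R R) (h : R -> R) : R :=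
  \int[nu]_t Phi (h t) - Phi (\int[nu]_t h t).

Section Tensorization.
Context d (T : measurableType d) (R : realType) (P : probability T R) (N : nat).
Variable xi : 'I_N -> {RV P >-> R}.
Hypothesis indep : mutually_independent [set: 'I_N]%SET xi.
Implicit Types (f g H : N.-tuple R -> R) (s : seq 'I_N).

Let nu i := coord_law xi i.

Definition insensitive i H := forall x t, H (upd x i t) = H x.

Definition avgs s f := foldr (avg xi) f s.

Lemma bm_avgs s f : bounded_measurable f -> bounded_measurable (avgs s f).
Proof. by move=> bf; elim: s => //= i s IHs; exact: bm_avg. Qed.

Lemma avg_insensitive i f : insensitive i (avg xi i f).
Proof. by move=> x t; apply: eq_Rintegral => u _; rewrite upd_upd. Qed.

Lemma insensitive_avg i j f : insensitive i f -> insensitive i (avg xi j f).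
Proof.
have [->|ij] := eqVneq i j; first by move=> _; exact: avg_insensitive.
by move=> fi x t; apply: eq_Rintegral => u _; rewrite upd_comm // fi.
Qed.

Lemma insensitive_avgs s f i : i \in s -> insensitive i (avgs s f).
Proof.
elim: s => //= j s IHs; rewrite inE; case: eqP => [->|_ /= /IHs].
  by move=> _; exact: avg_insensitive.
exact: insensitive_avg.
Qed.

(** [avgs s f] plays the part of the conditional expectation of f given the
    coordinates outside s; this is its characteristic property. *)
Lemma int_avgs s f H : bounded_measurable f -> bounded_measurable H ->
  (forall i, i \in s -> insensitive i H) ->
  \int[P]_w (H (joint xi w) * f (joint xi w)) =
  \int[P]_w (H (joint xi w) * avgs s f (joint xi w)).
Proof.
move=> bf bH; elim: s => //= i s IHs Hs.
rewrite IHs; last by move=> j js; apply: Hs; rewrite inE js orbT.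
have bg := bm_avgs s bf.
rewrite (joint_resample indep i (bmM bH bg)); apply: eq_Rintegral => w _.
rewrite /avg -bm_intZ; last exact: bm_upd.
by apply: eq_Rintegral => t _; rewrite Hs // inE eqxx.
Qed.

Lemma insensitive_cst H : (forall i, insensitive i H) -> forall x y, H x = H y.
Proof.
move=> Hi x y.
have -> : y = foldr (fun i z => upd z i (tnth y i)) x (enum 'I_N).
  apply: eq_from_tnth => j; have : j \in enum 'I_N by rewrite mem_enum.
  elim: (enum 'I_N) => //= i s IHs; rewrite inE tnth_upd.
  by case: eqP => [->|_ /=].
by elim: (enum 'I_N) => //= i s IHs; rewrite Hi.
Qed.

Lemma avgs_all f x : bounded_measurable f ->
  avgs (enum 'I_N) f x = \int[P]_w f (joint xi w).
Proof.
move=> bf; have := int_avgs (s := enum 'I_N) bf (bm_cst _ 1).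
have cst := insensitive_cst (fun i => @insensitive_avgs (enum 'I_N) f i (mem_enum _ i)).
have -> : \int[P]_w (1 * f (joint xi w)) = \int[P]_w f (joint xi w).
  by apply: eq_Rintegral => w _; rewrite mul1r.
move=> -> // {bf}.
rewrite -[LHS](prob_int_cst P); apply: eq_Rintegral => w _.
by rewrite mul1r; exact: cst.
Qed.

Variables (Phi Phi1 : R -> R) (a b : R).
Hypothesis mPhi : measurable_fun setT Phi.
Hypothesis mPhi1 : measurable_fun setT Phi1.
Hypothesis bPhi : exists B, forall u, a <= u <= b -> `|Phi u| <= B.
Hypothesis bPhi1 : exists B, forall u, a <= u <= b -> `|Phi1 u| <= B.
(* Phi-entropy is convex: it lies above its tangent functionals. *)
Hypothesis duality : forall (mu : probability R R) (f g : R -> R),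
  bounded_measurable f -> bounded_measurable g ->
  (forall t, a <= f t <= b) -> (forall t, a <= g t <= b) ->
  phi_ent Phi mu g +
    \int[mu]_t ((Phi1 (g t) - Phi1 (\int[mu]_t g t)) * (f t - g t)) <=
  phi_ent Phi mu f.

Lemma avg_bounds i f : bounded_measurable f -> (forall x, a <= f x <= b) ->
  forall x, a <= avg xi i f x <= b.
Proof. by move=> bf fab x; apply: bm_int_bounds => //; exact: bm_upd. Qed.

Lemma avgs_bounds s f : bounded_measurable f -> (forall x, a <= f x <= b) ->
  forall x, a <= avgs s f x <= b.
Proof.
move=> bf fab; elim: s => //= i s IHs; apply: avg_bounds => //.
exact: bm_avgs.
Qed.

Lemma bm_joint f : bounded_measurable f -> bounded_measurable (f \o joint xi).
Proof. by move=> bf; apply: bm_comp bf; exact: measurable_joint. Qed.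

Lemma bm_phi_ent i f : bounded_measurable f -> (forall x, a <= f x <= b) ->
  bounded_measurable (fun x => phi_ent Phi (nu i) (fun t => f (upd x i t))).
Proof.
move=> bf fab; apply: bmB.
  exact: (bm_avg xi i (bm_comp_itv bf fab mPhi bPhi)).
exact: (bm_comp_itv (bm_avg xi i bf) (avg_bounds i bf fab) mPhi bPhi).
Qed.

(** One coordinate is averaged at a time. The entropy lost at each step is
    that of an already averaged function, which the tangent inequality bounds
    by the entropy of the original one: the linear term integrates to zero
    because its weight does not see the coordinates averaged before. *)
Lemma tensorization_partial s f : bounded_measurable f ->
  (forall x, a <= f x <= b) -> uniq s ->
  \int[P]_w Phi (f (joint xi w)) - \int[P]_w Phi (avgs s f (joint xi w)) <=
  \sum_(i <- s) \int[P]_w phi_ent Phi (nu i) (fun t => f (upd (joint xi w) i t)).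
Proof.
move=> bf fab; elim: s => [|i s IHs] /=; first by rewrite big_nil subrr.
move=> /andP[iNs us]; rewrite big_cons.
set g := avgs s f; have bg : bounded_measurable g by exact: bm_avgs.
have gab : forall x, a <= g x <= b by exact: avgs_bounds.
have bag : bounded_measurable (avg xi i g) by exact: bm_avg.
have agab : forall x, a <= avg xi i g x <= b by exact: avg_bounds.
pose H x := Phi1 (g x) - Phi1 (avg xi i g x).
have bH : bounded_measurable H.
  by apply: bmB; [exact: (bm_comp_itv bg gab mPhi1 bPhi1) | exact: (bm_comp_itv bag agab mPhi1 bPhi1)].
have Hs j : j \in s -> insensitive j H.
  move=> js x t; have gj : insensitive j g by exact: insensitive_avgs.
  by rewrite /H gj (insensitive_avg i gj).
have H0 : \int[P]_w (H (joint xi w) * (f (joint xi w) - g (joint xi w))) = 0.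
  have bHf := bm_joint (bmM bH bf); have bHg := bm_joint (bmM bH bg).
  transitivity (\int[P]_w (H (joint xi w) * f (joint xi w) - H (joint xi w) * g (joint xi w))).
    by apply: eq_Rintegral => w _; rewrite mulrBr.
  by rewrite (bm_intB P bHf bHg) (int_avgs bf bH Hs) subrr.
have step : \int[P]_w Phi (g (joint xi w)) - \int[P]_w Phi (avg xi i g (joint xi w)) <=
    \int[P]_w phi_ent Phi (nu i) (fun t => f (upd (joint xi w) i t)).
  have bPg : bounded_measurable (fun x => Phi (g x)) by exact: (bm_comp_itv bg gab mPhi bPhi).
  have bPag : bounded_measurable (fun x => Phi (avg xi i g x)).
    exact: (bm_comp_itv bag agab mPhi bPhi).
  rewrite (joint_resample indep i bPg) -bm_intB; last 2 first.
  - exact: (bm_joint (bm_avg xi i bPg)).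
  - exact: (bm_joint bPag).
  rewrite -[X in X <= _]addr0 -[X in _ + X]H0.
  have bHfg : bounded_measurable (fun x => H x * (f x - g x)).
    by apply: bmM => //; exact: bmB.
  rewrite (joint_resample indep i bHfg) -bm_intD; last 2 first.
  - exact: (bm_joint (bmB (bm_avg xi i bPg) bPag)).
  - exact: (bm_joint (bm_avg xi i bHfg)).
  apply: bm_int_le.
  - exact: (bm_joint (bmD (bmB (bm_avg xi i bPg) bPag) (bm_avg xi i bHfg))).
  - exact: (bm_joint (bm_phi_ent i bf fab)).
  move=> w; apply: le_trans (duality (nu i) (bm_upd _ _ bf) (bm_upd _ _ bg) _ _) => //.
  apply: lerD; first exact: lexx.
  rewrite le_eqVlt; apply/orP; left; apply/eqP; apply: eq_Rintegral => t _.
  by rewrite /H (avg_insensitive i g (joint xi w) t).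
apply: le_trans (lerD step (IHs us)).
by rewrite -/g; lra.
Qed.

Theorem tensorization f : bounded_measurable f -> (forall x, a <= f x <= b) ->
  \int[P]_w Phi (f (joint xi w)) - Phi (\int[P]_w f (joint xi w)) <=
  \sum_i \int[P]_w phi_ent Phi (nu i) (fun t => f (upd (joint xi w) i t)).
Proof.
move=> bf fab; have := tensorization_partial bf fab (enum_uniq 'I_N).
rewrite big_enum /=; apply: le_trans; rewrite lerD2l lerN2.
rewrite -[leRHS](prob_int_cst P); apply: bm_int_le.
- exact: (bm_joint (bm_comp_itv (bm_avgs _ bf) (avgs_bounds _ bf fab) mPhi bPhi)).
- exact: bm_cst.
by move=> w; rewrite avgs_all.
Qed.

End Tensorization.

(** * Product Poincare and logarithmic Sobolev inequalities *)

Section TangentInequalities.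
Variables (R : realType) (nu : probability R R).
Implicit Types f g : R -> R.

(** The two sides differ by the variance of f - g. *)
Lemma sqr_tangent f g : bounded_measurable f -> bounded_measurable g ->
  phi_ent (fun u => u ^+ 2) nu g +
    \int[nu]_t ((2 * g t - 2 * \int[nu]_t g t) * (f t - g t)) <=
  phi_ent (fun u => u ^+ 2) nu f.
Proof.
move=> bf bg; set mg := \int[nu]_t g t; pose mf := \int[nu]_t f t.
have bh : bounded_measurable (fun t => f t - g t) by exact: bmB.
have := bm_int_ge0 nu (fun t => sqr_ge0 (f t - g t - (mf - mg))).
have b1 : bounded_measurable (fun t => f t ^+ 2) by exact: bmX.
have b2 : bounded_measurable (fun t => g t ^+ 2) by exact: bmX.
have b3 : bounded_measurable (fun t => g t * f t) by exact: bmM.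
have -> : \int[nu]_t ((f t - g t - (mf - mg)) ^+ 2) =
   \int[nu]_t (f t ^+ 2) + \int[nu]_t (g t ^+ 2) - 2 * \int[nu]_t (g t * f t) - (mf - mg) ^+ 2.
  transitivity (\int[nu]_t ((f t ^+ 2 + g t ^+ 2 - 2 * (g t * f t)) -
     (2 * (mf - mg) * (f t - g t) - (mf - mg) ^+ 2))).
    by apply: eq_Rintegral => t _; ring.
  rewrite bm_intB; [|by apply: bmB; [exact: bmD | exact: bmZ]|by apply: bmB => //; exact: bmZ].
  rewrite bm_intB; [|exact: bmD|exact: bmZ].
  rewrite bm_intD // bm_intZ // bm_intB //; last exact: bmZ.
  by rewrite bm_intZ // bm_intB // prob_int_cst -/mf -/mg; ring.
have -> : \int[nu]_t ((2 * g t - 2 * mg) * (f t - g t)) =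
   2 * \int[nu]_t (g t * f t) - 2 * \int[nu]_t (g t ^+ 2) - 2 * mg * (mf - mg).
  transitivity (\int[nu]_t ((2 * (g t * f t) - 2 * g t ^+ 2) - 2 * mg * (f t - g t))).
    by apply: eq_Rintegral => t _; ring.
  rewrite bm_intB; [|by apply: bmB; exact: bmZ|exact: bmZ].
  rewrite bm_intB; [|exact: bmZ|exact: bmZ].
  by rewrite !bm_intZ // bm_intB.
by rewrite /phi_ent -/mf -/mg; lra.
Qed.

(** The two sides differ by the relative entropy of f with respect to c g, the
    multiple of g with the same mean as f; it is nonnegative because
    ln x <= x - 1. *)
Lemma xlnx_tangent f g (a b : R) : 0 < a ->
  bounded_measurable f -> bounded_measurable g ->
  (forall t, a <= f t <= b) -> (forall t, a <= g t <= b) ->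
  phi_ent (fun u => u * ln u) nu g +
    \int[nu]_t ((ln (g t) - ln (\int[nu]_t g t)) * (f t - g t)) <=
  phi_ent (fun u => u * ln u) nu f.
Proof.
move=> a0 bf bg fab gab; set mg := \int[nu]_t g t; pose mf := \int[nu]_t f t.
have f0 t : 0 < f t by case/andP: (fab t) => h _; exact: lt_le_trans h.
have g0 t : 0 < g t by case/andP: (gab t) => h _; exact: lt_le_trans h.
have mg0 : 0 < mg by have /andP[h _] := bm_int_bounds nu bg gab; exact: lt_le_trans h.
have mf0 : 0 < mf by have /andP[h _] := bm_int_bounds nu bf fab; exact: lt_le_trans h.
have lnb (h : R -> R) : bounded_measurable h -> (forall t, a <= h t <= b) ->
    bounded_measurable (fun t => ln (h t)).
  move=> bh hab; apply: (bm_comp_itv (a := a) (b := b) bh hab (@measurable_ln R)).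
  by exists (b + a^-1) => u; exact: ln_itv_bound.
have blf := lnb f bf fab; have blg := lnb g bg gab.
have b1 : bounded_measurable (fun t => f t * ln (f t)) by exact: bmM.
have b2 : bounded_measurable (fun t => g t * ln (g t)) by exact: bmM.
have b3 : bounded_measurable (fun t => f t * ln (g t)) by exact: bmM.
have -> : \int[nu]_t ((ln (g t) - ln mg) * (f t - g t)) =
   \int[nu]_t (f t * ln (g t)) - \int[nu]_t (g t * ln (g t)) - ln mg * (mf - mg).
  transitivity (\int[nu]_t ((f t * ln (g t) - g t * ln (g t)) - ln mg * (f t - g t))).
    by apply: eq_Rintegral => t _; ring.
  rewrite bm_intB; [|exact: bmB|by apply: bmZ; exact: bmB].
  by rewrite bm_intB // bm_intZ ?bm_intB //; exact: bmB.
have [c [c0 cmg lnc]] : exists c, [/\ 0 < c, c * mg = mf & ln c = ln mf - ln mg].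
  exists (mf / mg); split; first by rewrite divr_gt0.
    by rewrite divfK // gt_eqF.
  by rewrite ln_div.
have pt t : f t * ln c + (f t - c * g t) <= f t * ln (f t) - f t * ln (g t).
  have ft := f0 t; have gt := g0 t.
  have h1 : ln (c * g t / f t) <= c * g t / f t - 1.
    have := @le_ln1Dx R (c * g t / f t - 1); rewrite addrCA subrr addr0; apply.
    by rewrite ltrBrDl subrr divr_gt0 // mulr_gt0.
  have cgt : 0 < c * g t by rewrite mulr_gt0.
  rewrite (ln_div (x := c * g t)) // lnM // in h1.
  have := ler_wpM2l (ltW ft) h1.
  have -> : f t * (c * g t / f t - 1) = c * g t - f t by field; rewrite gt_eqF.
  by lra.
have := @bm_int_le _ _ R nu _ _ _ _ pt.
move=> /(_ (bmD (bmM bf (bm_cst _ (ln c))) (bmB bf (bmZ c bg))) (bmB b1 b3)).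
rewrite bm_intD; [|by apply: bmM|by apply: bmB => //; exact: bmZ].
rewrite bm_intB //; last exact: bmZ.
rewrite bm_intZ // bm_intB //.
have -> : \int[nu]_t (f t * ln c) = mf * ln c.
  rewrite mulrC -bm_intZ //; apply: eq_Rintegral => t _; exact: mulrC.
by rewrite -/mf -/mg cmg lnc /phi_ent -/mf -/mg; lra.
Qed.

End TangentInequalities.

Section CoordinateTaylor.
Variables (R : realType) (N : nat).
Implicit Types (f : N.-tuple R -> R) (df : 'I_N -> N.-tuple R -> R).

(** The bounds are uniform over coordinates and base points; this makes f
    Lipschitz, hence measurable. *)
Definition coord_taylor f df : Prop :=
  exists B L K : R, [/\ forall x, `|f x| <= B, forall i x, `|df i x| <= L
    & forall i x s, `|f (upd x i s) - f x - (s - tnth x i) * df i x| <=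
        K * (s - tnth x i) ^+ 2].

Lemma coord_taylor_slice f df i x : coord_taylor f df ->
  taylor1 (fun t => f (upd x i t)) (fun t => df i (upd x i t)).
Proof.
move=> [B [L [K [fB dL fK]]]]; exists B, L, K; split => [t|t|s t] //.
by have := fK i (upd x i t) s; rewrite upd_upd tnth_upd eqxx.
Qed.

Lemma coord_taylor_lipschitz f df : coord_taylor f df ->
  exists M, 0 <= M /\ forall x y, `|f x - f y| <= M * \sum_i `|tnth x i - tnth y i|.
Proof.
move=> [B [L [K [fB dL fK]]]]; pose M := 2 * B + L + K.
have slice i x s : `|f (upd x i s) - f x| <= M * `|s - tnth x i|.
  rewrite -{2}(upd_same x i).
  apply: (taylor1_lipschitz_bound (g := fun t => f (upd x i t))
    (g1 := fun t => df i (upd x i t))) => // u t.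
  by have := fK i (upd x i t) u; rewrite upd_upd tnth_upd eqxx.
case: (posnP N) => [N0|N0].
  exists 0; split=> // x y; suff -> : x = y by rewrite subrr normr0 mul0r.
  by apply: eq_from_tnth => -[m mN]; exfalso; move: mN; rewrite {1}N0 ltn0.
have M0 : 0 <= M.
  pose i0 := Ordinal N0; pose x0 : N.-tuple R := [tuple 0 | _ < N].
  have := le_trans (normr_ge0 _) (slice i0 x0 1).
  by rewrite tnth_mktuple subr0 normr1 mulr1.
exists M; split=> // x y.
(* the coordinates are moved from x to y one after another *)
pose path s := foldr (fun i z => upd z i (tnth y i)) x s.
have pathE s j : tnth (path s) j = if j \in s then tnth y j else tnth x j.
  elim: s => //= i s IHs; rewrite tnth_upd inE.
  by case: eqP => [->|_ /=].
have pathB s : uniq s -> `|f (path s) - f x| <= M * \sum_(i <- s) `|tnth y i - tnth x i|.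
  elim: s => [_|i s IHs /= /andP[iNs us]]; first by rewrite big_nil /= subrr normr0 mulr0.
  rewrite big_cons mulrDr.
  have -> : f (upd (path s) i (tnth y i)) - f x =
    (f (upd (path s) i (tnth y i)) - f (path s)) + (f (path s) - f x) by ring.
  apply: (le_trans (ler_normD _ _)); apply: lerD; last exact: IHs.
  by have := slice i (path s) (tnth y i); rewrite pathE (negPf iNs).
have -> : y = path (enum 'I_N).
  by apply: eq_from_tnth => j; rewrite pathE mem_enum.
rewrite distrC; apply: le_trans (pathB _ (enum_uniq _)) _.
rewrite big_enum /=; apply: ler_wpM2l => //; apply: ler_sum => i _.
by rewrite distrC pathE mem_enum.
Qed.

(** McShane's formula: f is the infimum of r |-> f r + M |x - r| over the rational
    points r, so its strict sublevel sets are countable unions. *)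
Lemma lipschitz_measurable f (M : R) : 0 <= M ->
  (forall x y, `|f x - f y| <= M * \sum_i `|tnth x i - tnth y i|) ->
  measurable_fun setT f.
Proof.
move=> M0 fM; apply: (measurability _ (RGenInftyO.measurableE R)).
move=> _ [_ [c ->] <-]; rewrite setTI.
pose q (r : N.-tuple rat) : N.-tuple R := [tuple ratr (tnth r i) | i < N].
pose h r x := f (q r) + M * \sum_i `|tnth x i - tnth (q r) i|.
pose A (n : nat) := if (unpickle n : option (N.-tuple rat)) is Some r
  then [set x | h r x < c] else set0.
have mh r : measurable_fun setT (h r).
  apply: measurable_funD => //; apply: measurable_funM => //.
  apply: measurable_sum => i; apply: measurableT_comp => //.
  by apply: measurable_funB => //; exact: measurable_tnth.
rewrite (_ : _ @^-1` _ = \bigcup_n A n); last first.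
  apply/seteqP; split=> x /=; rewrite in_itv /=.
    move=> fxc; pose e := (c - f x) / (2 * M * N%:R + 1).
    have den : 0 < 2 * M * N%:R + 1 by rewrite ltr_wpDl // !mulr_ge0.
    have e0 : 0 < e by rewrite divr_gt0 // subr_gt0.
    have /all_sig [r rP] : forall i, {r : rat | `|tnth x i - ratr r| < e}.
      move=> i; apply/cid.
      have [r] := @rat_in_itvoo R (tnth x i - e) (tnth x i + e) ltac:(lra).
      by rewrite in_itv /= => rI; exists r; rewrite ltr_norml; lra.
    exists (pickle [tuple r i | i < N]) => //; rewrite /A pickleK /h /=.
    set rt := [tuple r i | i < N].
    have sum_le : \sum_i `|tnth x i - tnth (q rt) i| <= N%:R * e.
      rewrite -[X in X%:R]card_ord -sum1_card natr_sum mulr_suml.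
      apply: ler_sum => i _; rewrite mul1r !tnth_mktuple ltW //.
    have := fM (q rt) x; rewrite (eq_bigr (fun i => `|tnth x i - tnth (q rt) i|)); last first.
      by move=> i _; rewrite distrC.
    rewrite ler_norml => /andP[_ h1].
    have h2 := ler_wpM2l M0 sum_le.
    have e1 : (2 * M * N%:R + 1) * e = c - f x by rewrite /e mulrC divfK // gt_eqF.
    by lra.
  move=> [n _]; rewrite /A; case: (unpickle n) => [r /=|//].
  rewrite /h => hc; have := fM x (q r); rewrite ler_norml => /andP[_ h1].
  by lra.
apply: bigcup_measurable => n _; rewrite /A; case: (unpickle n) => [r|//].
have := mh r measurableT `]-oo, c[%classic (measurable_itv _).
by rewrite setTI; congr measurable; apply/seteqP; split=> x /=; rewrite in_itv.
Qed.

Lemma coord_taylor_bm f df : coord_taylor f df -> bounded_measurable f.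
Proof.
move=> ft; have [M [M0 fM]] := coord_taylor_lipschitz ft.
split; first exact: lipschitz_measurable fM.
by have [B [L [K [fB _ _]]]] := ft; exists B.
Qed.

Lemma coord_taylor_deriv_bm f df i : coord_taylor f df -> bounded_measurable (df i).
Proof.
move=> ft; have [mf _] := coord_taylor_bm ft.
have [B [L [K [_ dL fK]]]] := ft; split; last by exists L.
apply: (measurable_first_order (g := fun n x => f (upd x i (tnth x i + n.+1%:R^-1))) (K := K) mf) => [n|n x].
  have mp : measurable_fun setT (fun x : N.-tuple R => (x, tnth x i + n.+1%:R^-1)).
    apply: measurable_fun_pair => //.
    by apply: measurable_funD => //; exact: measurable_tnth.
  exact: (measurableT_comp mf (measurableT_comp (measurable_upd i) mp)).
by have := fK i x (tnth x i + n.+1%:R^-1); rewrite [tnth x i + _ - _](_ : _ = n.+1%:R^-1) //; ring.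
Qed.

End CoordinateTaylor.

Section ProductInequalities.
Context d (T : measurableType d) (R : realType) (P : probability T R) (N : nat).
Variable xi : 'I_N -> {RV P >-> R}.
Hypothesis indep : mutually_independent [set: 'I_N]%SET xi.
Variables (f : N.-tuple R -> R) (df : 'I_N -> N.-tuple R -> R).
Hypothesis ft : coord_taylor f df.

Let energy_resample i :
  \int[P]_w (df i (joint xi w) ^+ 2) =
  \int[P]_w \int[coord_law xi i]_t (df i (upd (joint xi w) i t) ^+ 2).
Proof.
by rewrite (joint_resample indep i (bmX 2 (coord_taylor_deriv_bm i ft))).
Qed.

Theorem product_poincare tau : (forall i, spectral_gap (coord_law xi i) tau) ->
  \int[P]_w (f (joint xi w) ^+ 2) - (\int[P]_w f (joint xi w)) ^+ 2 <=
  tau * \sum_i \int[P]_w (df i (joint xi w) ^+ 2).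
Proof.
move=> gap; have [B [_ [_ [fB _ _]]]] := ft; have bf := coord_taylor_bm ft.
have fab x : - B <= f x <= B by rewrite -ler_norml.
have sqm : measurable_fun setT (fun u : R => u ^+ 2) by exact: exprn_measurable.
have m2 : measurable_fun setT (fun u : R => 2 * u) by exact: measurable_funM.
have bsq : exists C, forall u, - B <= u <= B -> `|u ^+ 2| <= C.
  exists (B ^+ 2) => u; rewrite -ler_norml => uB.
  by rewrite normrX ler_pXn2r ?nnegrE // (le_trans _ uB).
have b2 : exists C, forall u, - B <= u <= B -> `|2 * u| <= C.
  by exists (2 * B) => u; rewrite -ler_norml normrM ger0_norm // ler_pM2l.
have := tensorization indep sqm m2 bsq b2
  (fun mu g h bg bh _ _ => sqr_tangent mu bg bh) bf fab.
move/le_trans; apply; rewrite mulr_sumr; apply: ler_sum => i _.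
rewrite energy_resample -bm_intZ; last first.
  exact: (bm_joint xi (bm_avg xi i (bmX 2 (coord_taylor_deriv_bm i ft)))).
apply: bm_int_le.
- exact: (bm_joint xi (bm_phi_ent xi sqm bsq i bf fab)).
- exact: bmZ (bm_joint xi (bm_avg xi i (bmX 2 (coord_taylor_deriv_bm i ft)))).
by move=> w; exact: (gap i _ _ (coord_taylor_slice i (joint xi w) ft)).
Qed.

Theorem product_logsobolev sigma c : (forall i, LSI sigma (coord_law xi i)) ->
  0 < c -> (forall x, c <= f x) ->
  \int[P]_w (f (joint xi w) ^+ 2 * ln (f (joint xi w) ^+ 2)) -
    (\int[P]_w (f (joint xi w) ^+ 2)) * ln (\int[P]_w (f (joint xi w) ^+ 2)) <=
  2 * sigma ^+ 2 * \sum_i \int[P]_w (df i (joint xi w) ^+ 2).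
Proof.
move=> lsi c0 cf; have [B [_ [_ [fB _ _]]]] := ft; have bf := coord_taylor_bm ft.
have f2ab x : c ^+ 2 <= f x ^+ 2 <= B ^+ 2.
  have fx0 : 0 <= f x := le_trans (ltW c0) (cf x).
  have fxB : f x <= B := le_trans (ler_norm _) (fB x).
  have B0 := le_trans fx0 fxB; have c0' := ltW c0.
  by rewrite !ler_pXn2r ?nnegrE // cf.
have c20 : 0 < c ^+ 2 by rewrite exprn_gt0.
have bf2 : bounded_measurable (fun x => f x ^+ 2) by exact: bmX.
have bx : exists C, forall u : R, c ^+ 2 <= u <= B ^+ 2 -> `|u * ln u| <= C.
  by exists (B ^+ 2 * (B ^+ 2 + (c ^+ 2)^-1)) => u; exact: xlnx_itv_bound.
have bl : exists C, forall u : R, c ^+ 2 <= u <= B ^+ 2 -> `|ln u| <= C.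
  by exists (B ^+ 2 + (c ^+ 2)^-1) => u; exact: ln_itv_bound.
have := tensorization indep (@measurable_xlnx R) (@measurable_ln R) bx bl
  (fun mu g h bg bh => @xlnx_tangent R mu g h _ _ c20 bg bh) bf2 f2ab.
move/le_trans; apply; rewrite mulr_sumr; apply: ler_sum => i _.
rewrite energy_resample -bm_intZ; last first.
  exact: (bm_joint xi (bm_avg xi i (bmX 2 (coord_taylor_deriv_bm i ft)))).
apply: bm_int_le.
- exact: (bm_joint xi (bm_phi_ent xi (@measurable_xlnx R) bx i bf2 f2ab)).
- exact: bmZ (bm_joint xi (bm_avg xi i (bmX 2 (coord_taylor_deriv_bm i ft)))).
move=> w; apply: (LSI_taylor1 (lsi i) (coord_taylor_slice i (joint xi w) ft) c0).
by move=> t; exact: cf.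
Qed.

End ProductInequalities.

(** * Spectral means as functions of the entries *)

Section TraceStatistic.
Variables (R : realType) (n : nat).
Local Notation N := (#|@upper_pairs n|).
Implicit Types (phi : R -> R) (x : N.-tuple R).

(** Linear eigenvalue statistics, normalized as integrals against the
    empirical spectral measure, as functions of the matrix entries. *)
Definition spectral_mean phi x : R :=
  n%:R^-1 * trace_fun phi (sym_matrix x).

Definition spectral_grad (phi1 : R -> R) (i : 'I_N) x : R :=
  n%:R^-1 * \tr (matrix_fun phi1 (sym_matrix x) *m sym_basis R (upper_pair i)).

Lemma sym_matrix_upd x i s :
  sym_matrix (upd x i s) - sym_matrix x = (s - tnth x i) *: sym_basis R (upper_pair i).
Proof.
rewrite /sym_matrix -sumrB (bigD1 i) //= tnth_upd eqxx -scalerBl.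
rewrite big1 ?addr0 // => j ji.
by rewrite tnth_upd (negPf ji) subrr.
Qed.

Lemma spectral_mean_norm phi B x : (forall t, `|phi t| <= B) ->
  `|spectral_mean phi x| <= B.
Proof.
move=> phiB; have B0 := le_trans (normr_ge0 _) (phiB 0).
rewrite /spectral_mean normrM ger0_norm ?invr_ge0 //.
(* for n = 0 the normalizing factor is 0^-1 = 0 *)
have [n0|n0] := posnP n; first by rewrite [X in X^-1](_ : _ = 0) ?invr0 ?mul0r // n0.
rewrite ler_pdivrMl ?ltr0n //; apply: (le_trans (ler_norm_sum _ _ _)).
apply: (@le_trans _ _ (\sum_(i < n) B)); first exact: ler_sum.
by rewrite sumr_const card_ord mulr_natl.
Qed.

(** The basis matrices are orthogonal with squared norms of order 1 / n, so
    Bessel's inequality bounds the sum by the trace of phi1 (A)^2, which is a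
    spectral mean again. *)
Lemma spectral_grad_sqr phi1 x :
  \sum_i spectral_grad phi1 i x ^+ 2 <=
  2 / n%:R ^+ 2 * spectral_mean (fun t => phi1 t ^+ 2) x.
Proof.
rewrite /spectral_grad /spectral_mean.
rewrite (eq_bigr (fun i : 'I_N => n%:R^-1 ^+ 2 * \tr (matrix_fun phi1 (sym_matrix x)
   *m sym_basis R (upper_pair i)) ^+ 2)); last by move=> i _; rewrite exprMn.
rewrite -mulr_sumr exprVn.
have h := sum_trace_sym_basis (matrix_fun_sym phi1 (sym_matrix x)).
rewrite trace_matrix_fun_sqr ?sym_matrix_sym // in h.
have i0 : 0 <= (n%:R ^+ 2 : R)^-1 by rewrite invr_ge0 sqr_ge0.
have := ler_wpM2l i0 h.
by rewrite [2 / _ * (_ * _)](_ : _ = (n%:R ^+ 2)^-1 * (2 / n%:R * trace_fun (fun t => phi1 t ^+ 2) (sym_matrix x))) //; ring.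
Qed.

Lemma spectral_coord_taylor phi phi1 : taylor1 phi phi1 ->
  coord_taylor (spectral_mean phi) (spectral_grad phi1).
Proof.
move=> [B [L [K [phiB phi1L phiK]]]].
have K0 : 0 <= K by have := le_trans (normr_ge0 _) (phiK 1 0); rewrite subr0 expr1n mulr1.
have L0 : 0 <= L := le_trans (normr_ge0 _) (phi1L 0).
pose E i := sym_basis R (@upper_pair n i).
have EE i : 0 <= \tr (E i *m E i).
  have Es : (E i)^T = E i by exact: sym_basis_sym.
  rewrite -{1}Es /mxtrace; apply: sumr_ge0 => j _.
  by rewrite mxE; apply: sumr_ge0 => k _; rewrite mxE -expr2 sqr_ge0.
pose Q := \sum_i \tr (E i *m E i).
exists B, (2 * L), (n%:R^-1 * (K * Q)); split => [x|i x|i x s].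
- exact: spectral_mean_norm.
- have h : spectral_grad phi1 i x ^+ 2 <= (2 * L) ^+ 2.
    apply: (@le_trans _ _ (\sum_j spectral_grad phi1 j x ^+ 2)).
      rewrite (bigD1 i) //= lerDl; apply: sumr_ge0 => j _; exact: sqr_ge0.
    apply: le_trans (spectral_grad_sqr _ _) _.
    have hm : spectral_mean (fun t => phi1 t ^+ 2) x <= L ^+ 2.
      apply: le_trans (ler_norm _) _; apply: spectral_mean_norm => t.
      by rewrite normrX ler_pXn2r ?nnegrE // (le_trans _ (phi1L t)).
    have c1 : 2 / (n%:R : R) ^+ 2 <= 4.
      have [n0|n0] := posnP n; first by rewrite (_ : n%:R = 0 :> R) ?expr0n ?invr0 ?mulr0 // n0.
      rewrite ler_pdivrMr ?exprn_gt0 ?ltr0n //.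
      have : (1 : R) <= n%:R by rewrite ler1n.
      by rewrite expr2; nra.
    have c0 : 0 <= 2 / (n%:R : R) ^+ 2 by rewrite divr_ge0 // sqr_ge0.
    apply: le_trans (ler_wpM2l c0 hm) _.
    by rewrite exprMn; have := ler_wpM2r (sqr_ge0 L) c1; lra.
  by rewrite -ler_sqr ?nnegrE ?mulr_ge0 // real_normK ?num_real.
- have h := trace_fun_taylor (sym_matrix_sym x) (sym_matrix_sym (upd x i s)) phiK.
  have trZ (c : R) (M F : 'M[R]_n) : \tr (M *m (c *: F)) = c * \tr (M *m F).
    by rewrite -scalemxAr mxtraceZ.
  have trZZ (c : R) (F : 'M[R]_n) : \tr ((c *: F) *m (c *: F)) = c ^+ 2 * \tr (F *m F).
    by rewrite trZ -scalemxAl mxtraceZ mulrA expr2.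
  rewrite sym_matrix_upd trZ trZZ in h.
  rewrite /spectral_mean /spectral_grad.
  rewrite [X in `|X|](_ : _ = n%:R^-1 * (trace_fun phi (sym_matrix (upd x i s)) -
    trace_fun phi (sym_matrix x) - (s - tnth x i) *
    \tr (matrix_fun phi1 (sym_matrix x) *m E i))); last by rewrite /E; ring.
  rewrite normrM ger0_norm ?invr_ge0 // -!mulrA ler_wpM2l ?invr_ge0 //.
  apply: le_trans h _; apply: ler_wpM2l => //.
  rewrite mulrC ler_wpM2r ?sqr_ge0 //.
  by rewrite /Q (bigD1 i) //= lerDl; apply: sumr_ge0.
Qed.

End TraceStatistic.

Section ExpClosure.
Variable R : realType.

Lemma expR_taylor2 (u : R) : 0 <= expR u - 1 - u <= u ^+ 2 * expR `|u|.
Proof.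
apply/andP; split; first by have := expR_ge1Dx u; lra.
have e1 : expR u - 1 <= u * expR u.
  have h := expR_ge1Dx (- u); have e0 := expR_gt0 u.
  have : expR u * expR (- u) = 1 by rewrite -expRD subrr expR0.
  have := ler_wpM2l (ltW e0) h; lra.
have [u0|u0] := leP 0 u.
  rewrite ger0_norm // expr2; have := ler_wpM2l u0 e1; lra.
rewrite ltr0_norm // expr2.
have h1 : 1 <= expR (- u) by rewrite -expR0 ler_expR oppr_ge0 ltW.
have h2 := expR_ge1Dx u.
have h3 : u * u <= u * u * expR (- u) by rewrite ler_peMr // -expr2 sqr_ge0.
by nra.
Qed.

(** The constants depend only on the bounds of the argument and of its
    expansion, so the estimate is uniform in the base point. *)
Lemma expR_taylor (B M K a b z : R) : `|a| <= B -> `|b| <= B ->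
  `|b - a| <= M * `|z| -> forall d : R, `|b - a - z * d| <= K * z ^+ 2 ->
  `|expR b - expR a - z * (expR a * d)| <=
    expR B * (M ^+ 2 * expR (2 * B) + K) * z ^+ 2.
Proof.
move=> aB bB baM d bad; have ea := expR_gt0 a.
have eaB : expR a <= expR B by rewrite ler_expR (le_trans (ler_norm _) aB).
have -> : expR b - expR a - z * (expR a * d) =
    expR a * ((expR (b - a) - 1 - (b - a)) + (b - a - z * d)).
  by rewrite expRB; field; rewrite gt_eqF.
rewrite normrM (gtr0_norm ea) -mulrA ler_pM // ?(ltW ea) //.
apply: (le_trans (ler_normD _ _)); rewrite mulrDl; apply: lerD => //.
have /andP[p0 p1] := expR_taylor2 (b - a); rewrite ger0_norm //.
apply: (le_trans p1).
have ubd : `|b - a| <= 2 * B by apply: (le_trans (ler_normB _ _)); lra.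
have -> : M ^+ 2 * expR (2 * B) * z ^+ 2 = (M ^+ 2 * z ^+ 2) * expR (2 * B) by ring.
apply: ler_pM; rewrite ?sqr_ge0 ?expR_ge0 ?ler_expR //.
have h := ler_pM (normr_ge0 _) (normr_ge0 _) baM baM.
have e1 : `|b - a| * `|b - a| = (b - a) ^+ 2 by rewrite -expr2 real_normK ?num_real.
have e2 : M * `|z| * (M * `|z|) = M ^+ 2 * z ^+ 2.
  by rewrite -expr2 exprMn real_normK ?num_real.
by rewrite -e1 -e2.
Qed.

Lemma coord_taylor_expR N (f : N.-tuple R -> R) df : coord_taylor f df ->
  coord_taylor (fun x => expR (f x)) (fun i x => expR (f x) * df i x).
Proof.
move=> ft; have [B [L [K [fB dL fK]]]] := ft.
exists (expR B), (expR B * L), (expR B * ((2 * B + L + K) ^+ 2 * expR (2 * B) + K)).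
have eB x : expR (f x) <= expR B by rewrite ler_expR (le_trans (ler_norm _) (fB x)).
split => [x|i x|i x s].
- by rewrite ger0_norm ?expR_ge0.
- by rewrite normrM ger0_norm ?expR_ge0 // ler_pM // expR_ge0.
- apply: expR_taylor => //.
  rewrite -{2}(upd_same x i).
  apply: (taylor1_lipschitz_bound (g := fun t => f (upd x i t))
    (g1 := fun t => df i (upd x i t))) => // u t.
  by have := fK i (upd x i t) u; rewrite upd_upd tnth_upd eqxx.
Qed.

Lemma coord_taylorZ N c (f : N.-tuple R -> R) df : coord_taylor f df ->
  coord_taylor (fun x => c * f x) (fun i x => c * df i x).
Proof.
move=> [B [L [K [fB dL fK]]]]; exists (`|c| * B), (`|c| * L), (`|c| * K).
split => [x|i x|i x s]; try by rewrite normrM ler_wpM2l.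
rewrite [X in `|X|](_ : _ = c * (f (upd x i s) - f x - (s - tnth x i) * df i x)); last by ring.
by rewrite normrM -mulrA ler_wpM2l.
Qed.

End ExpClosure.

(** * Exponential moments from the logarithmic Sobolev inequality *)

(** Herbst's argument: the differential inequality says that log (m t) / t is
    nonincreasing, and its limit at 0 is the derivative of m there. *)
Lemma herbst (R : realType) (m m1 : R -> R) (H : R) : 0 < H ->
  (forall t : R, is_derive t 1 m (m1 t)) -> (forall t, 0 < m t) -> m 0 = 1 ->
  (forall t, 0 < t -> t * m1 t <= m t * ln (m t)) ->
  m H <= expR (H * m1 0).
Proof.
move=> H0 dm m0 m01 hm.
pose l t := ln (m t).
have dl (t : R) : is_derive t 1 l (m1 t / m t).
  rewrite mulrC; apply: (@is_derive1_comp _ (@ln R) m); exact: is_derive1_ln.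
pose q t := l t / t.
have dq (t : R) : 0 < t -> is_derive t 1 q ((m1 t / m t) / t - l t / t ^+ 2).
  move=> t0; have tn0 : t != 0 by rewrite gt_eqF.
  have dV := is_deriveV tn0 (is_derive_id t 1).
  have h := is_deriveM (dl t) dV.
  rewrite (_ : q = l \* (fun y => (y : R)^-1)) //.
  apply: is_derive_eq; rewrite /GRing.scale /=; field; rewrite tn0 gt_eqF //.
have dq0 (t : R) : 0 < t -> (m1 t / m t) / t - l t / t ^+ 2 <= 0.
  move=> t0; have mt := m0 t; have h := hm _ t0.
  have -> : (m1 t / m t) / t - l t / t ^+ 2 = (t * m1 t - m t * l t) / (m t * t ^+ 2).
    by rewrite /l; field; rewrite !gt_eqF.
  rewrite pmulr_lle0; last by rewrite invr_gt0 mulr_gt0 // exprn_gt0.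
  by rewrite subr_le0.
have qH t : 0 < t -> t <= H -> q H <= q t.
  move=> t0 tH.
  have pos x : x \in `[t, H] -> 0 < x by rewrite in_itv /= => /andP[tx _]; exact: lt_le_trans tx.
  have posoo x : x \in `]t, H[ -> 0 < x by rewrite in_itv /= => /andP[tx _]; exact: lt_trans tx.
  apply: (@ler0_derive1_nincr _ q t H) => // [x xI|x xI|].
  - by have [] := dq x (posoo x xI).
  - rewrite derive1E; have [_ ->] := dq x (posoo x xI); exact: dq0 (posoo x xI).
  - apply: derivable_within_continuous => x xI.
    by have [] := dq x (pos x xI).
pose u (n : nat) : R := H / n.+1%:R.
have u0 n : 0 < u n by rewrite divr_gt0.
have uH n : u n <= H by rewrite ler_pdivrMr // -[leLHS]mulr1 ler_pM2l // ler1n.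
have uc : u n @[n --> \oo] --> (0 : R).
  by rewrite -[X in _ --> X](mulr0 H); apply: cvgM; [exact: cvg_cst | exact: cvg_harmonic].
have ql : q (u n) @[n --> \oo] --> m1 0.
  have [/cvg_ex [e he] dE] := dl 0.
  have e1 : e = m1 0.
    have dE1 : 'D_1 l 0 = m1 0 by rewrite dE m01 divr1.
    by rewrite -dE1; apply/esym/cvg_lim.
  move: he; rewrite e1 => /cvgr_dnbhsP /(_ u) hu.
  have qE : (fun n => q (u n)) = (fun h : R => h^-1 *: (l (h *: 1 + 0) - l 0)) \o u.
    by apply/funext => n /=; rewrite scaler1 addr0 /q /l m01 ln1 subr0 /GRing.scale /= mulrC.
  rewrite [X in X @ _ --> _]qE.
  by apply: hu; split => [n|//]; rewrite gt_eqF.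
have qle : q H <= m1 0.
  apply: (cvgr_to_ge ql); apply: nearW => n; exact: qH.
rewrite -[leLHS]lnK ?posrE // ler_expR mulrC -ler_pdivrMr //.
Qed.

Section ExponentialMoment.
Context d (T : measurableType d) (R : realType) (P : probability T R) (N : nat).
Variable xi : 'I_N -> {RV P >-> R}.
Hypothesis indep : mutually_independent [set: 'I_N]%SET xi.
Variables (u ut : R -> N.-tuple R -> R) (du : R -> 'I_N -> N.-tuple R -> R).
Variables (B L K A sigma kappa : R).
Hypothesis uB : forall t x, `|u t x| <= B.
Hypothesis utL : forall t x, `|ut t x| <= L.
Hypothesis uK : forall s t x, `|u s x - u t x - (s - t) * ut t x| <= K * (s - t) ^+ 2.
Hypothesis ux : forall t, coord_taylor (u t) (du t).
Hypothesis grad : forall t x, \sum_i du t i x ^+ 2 <= - A * ut t x.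
Hypothesis ut0 : forall t x, ut t x <= 0.
Hypothesis lsi : forall i, LSI sigma (coord_law xi i).
Hypothesis kappa0 : 0 < kappa.
Hypothesis kappaA : sigma ^+ 2 * kappa * A <= 2.

Let um t : bounded_measurable (u t).
Proof. exact: coord_taylor_bm (ux t). Qed.

Let utm t : bounded_measurable (ut t).
Proof.
split; last by exists L.
apply: (measurable_first_order (g := fun n => u (t + n.+1%:R^-1)) (K := K)) => [|n|n x].
- exact: (um t).1.
- exact: (um (t + n.+1%:R^-1)).1.
- by have := uK (t + n.+1%:R^-1) t x; rewrite [t + _ - _](_ : _ = n.+1%:R^-1) //; ring.
Qed.

Let f t x := kappa * t * u t x.
Let ft t x := kappa * (u t x + t * ut t x).

Let fm t : bounded_measurable (f t). Proof. exact: bmZ. Qed.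

Let ftm t : bounded_measurable (ft t).
Proof. by apply: bmZ; apply: bmD => //; exact: bmZ. Qed.

Let efm t : bounded_measurable (fun x => expR (f t x)).
Proof. exact: bm_expR (fm t). Qed.

Let jm (g : N.-tuple R -> R) : bounded_measurable g ->
  bounded_measurable (fun w => g (joint xi w)).
Proof. exact: bm_joint. Qed.

Let m t := \int[P]_w expR (f t (joint xi w)).
Let m1 t := \int[P]_w (expR (f t (joint xi w)) * ft t (joint xi w)).

Let dm (t : R) : is_derive t 1 m (m1 t).
Proof.
have B0 : 0 <= B by exact: le_trans (uB 0 [tuple 0 | _ < N]).
have L0 : 0 <= L by exact: le_trans (utL 0 [tuple 0 | _ < N]).
have K0 : 0 <= K.
  have := le_trans (normr_ge0 _) (uK 1 0 [tuple 0 | _ < N]).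
  by rewrite subr0 expr1n mulr1.
pose M := 2 * B + L + K.
have uM s x : `|u s x - u t x| <= M * `|s - t|.
  exact: (taylor1_lipschitz_bound (g := u ^~ x) (g1 := ut ^~ x)).
have M0 : 0 <= M by rewrite /M !addr_ge0 // mulr_ge0.
pose C := kappa * (`|t| + 1) * B; pose M' := kappa * (B + (`|t|) * M).
pose K' := kappa * (M + `|t| * K).
apply: (taylor_is_derive (K := expR C * (M' ^+ 2 * expR (2 * C) + K'))) => s st.
have pt x : `|expR (f s x) - expR (f t x) - (s - t) * (expR (f t x) * ft t x)| <=
    expR C * (M' ^+ 2 * expR (2 * C) + K') * (s - t) ^+ 2.
  have ns : `|s| <= `|t| + 1.
    by rewrite -[s](subrK t) addrC; apply: (le_trans (ler_normD _ _)); rewrite lerD2l.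
  have fC r : `|r| <= `|t| + 1 -> `|f r x| <= C.
    move=> rt; rewrite /f /C !normrM (gtr0_norm kappa0).
    by rewrite ler_pM ?mulr_ge0 ?(ltW kappa0) // ler_pM2l.
  apply: expR_taylor => //.
  - by apply: fC; rewrite lerDl.
  - exact: fC.
  - have -> : f s x - f t x = kappa * ((s - t) * u s x + t * (u s x - u t x)).
      by rewrite /f; ring.
    rewrite /M' normrM (gtr0_norm kappa0) -mulrA ler_pM2l // [leRHS]mulrDl.
    apply: (le_trans (ler_normD _ _)); apply: lerD.
      by rewrite normrM mulrC ler_wpM2r.
    by rewrite normrM -mulrA ler_wpM2l.
  - have -> : f s x - f t x - (s - t) * ft t x =
       kappa * ((s - t) * (u s x - u t x) + t * (u s x - u t x - (s - t) * ut t x)).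
      by rewrite /f /ft; ring.
    rewrite /K' normrM (gtr0_norm kappa0) -mulrA ler_pM2l // [leRHS]mulrDl.
    apply: (le_trans (ler_normD _ _)); apply: lerD.
      rewrite normrM; apply: le_trans (ler_wpM2l (normr_ge0 _) (uM s x)) _.
      by rewrite mulrCA -expr2 real_normK ?num_real.
    by rewrite normrM -mulrA ler_wpM2l.
have b1 := jm (efm s); have b2 := jm (efm t).
have b3 : bounded_measurable (fun w => expR (f t (joint xi w)) * ft t (joint xi w)).
  exact: jm (bmM (efm t) (ftm t)).
rewrite /m /m1 -bm_intZ // -bm_intB // -bm_intB //; last 2 first.
- exact: (bmB b1 b2).
- exact: (bmZ _ b3).
by apply: bm_int_norm (bmB (bmB b1 b2) (bmZ (s - t) b3)) _.
Qed.

Let m_gt0 t : 0 < m t.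
Proof.
have [_ [C fC]] := fm t; apply: (@lt_le_trans _ _ (expR (- C))); first exact: expR_gt0.
rewrite -[leLHS](prob_int_cst P); apply: bm_int_le => //; first exact: jm (efm t).
by move=> w; rewrite ler_expR; have := fC (joint xi w); rewrite ler_norml => /andP[].
Qed.

(** The logarithmic Sobolev inequality applied to exp (f / 2): the energy is
    paid for by the decrease of u in t. *)
Let entropy_ineq t : 0 < t -> t * m1 t <= m t * ln (m t).
Proof.
move=> t0; pose g x := expR (2^-1 * f t x).
pose dg i x := expR (2^-1 * f t x) * (2^-1 * (kappa * t * du t i x)).
have gt : coord_taylor g dg.
  by apply: coord_taylor_expR; apply: coord_taylorZ; exact: coord_taylorZ.
have g2 x : g x ^+ 2 = expR (f t x) by rewrite /g -expRM_natl; congr expR; field.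
have [_ [C fC]] := fm t.
have gc x : expR (- (2^-1 * C)) <= g x.
  rewrite ler_expR -mulrN ler_pM2l //.
  by have := fC x; rewrite ler_norml => /andP[].
have := product_logsobolev indep gt lsi (expR_gt0 _) gc.
under eq_Rintegral do rewrite g2 expRK.
under [X in _ - X * _ <= _]eq_Rintegral do rewrite g2.
under [X in _ - _ * ln X <= _]eq_Rintegral do rewrite g2.
rewrite -/(m t) => ent.
have but : bounded_measurable (fun w => ut t (joint xi w)) := jm (utm t).
have be : bounded_measurable (fun w => expR (f t (joint xi w))) := jm (efm t).
have bf : bounded_measurable (fun w => f t (joint xi w)) := jm (fm t).
have beu := bmM be but.
have e1 : t * m1 t = \int[P]_w (expR (f t (joint xi w)) * f t (joint xi w)) +
    kappa * t ^+ 2 * \int[P]_w (expR (f t (joint xi w)) * ut t (joint xi w)).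
  rewrite /m1 -(bm_intZ P _ beu) -(bm_intZ P _ (bmM be (jm (ftm t)))).
  rewrite -(bm_intD P (bmM be bf) (bmZ _ beu)).
  by apply: eq_Rintegral => w _; rewrite /ft /f; ring.
have e2 : 2 * sigma ^+ 2 * (\sum_i \int[P]_w (dg i (joint xi w) ^+ 2)) <=
    - (kappa * t ^+ 2 * \int[P]_w (expR (f t (joint xi w)) * ut t (joint xi w))).
  have bdg i : bounded_measurable (fun w => dg i (joint xi w) ^+ 2).
    by apply: bmX; exact: jm (coord_taylor_deriv_bm i gt).
  rewrite -(bm_int_sum P _ bdg) -(bm_intZ P _ (bm_sum _ bdg)).
  rewrite -(bm_intZ P _ beu) -(bm_intN P (bmZ _ beu)).
  apply: (bm_int_le P (bmZ _ (bm_sum _ bdg)) (bmN (bmZ _ beu))).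
  move=> w; set x := joint xi w.
  have -> : \sum_i dg i x ^+ 2 = expR (f t x) * (4^-1 * (kappa * t) ^+ 2 * \sum_i du t i x ^+ 2).
    have h4 : 4^-1 = 2^-1 ^+ 2 :> R by rewrite exprVn -natrX.
    by rewrite !mulr_sumr; apply: eq_bigr => i _; rewrite /dg -g2 /g h4; ring.
  have h1 : sigma ^+ 2 * (kappa * \sum_i du t i x ^+ 2) <= - 2 * ut t x.
    apply: (@le_trans _ _ (sigma ^+ 2 * (kappa * (- A * ut t x)))).
      by rewrite ler_wpM2l ?sqr_ge0 // ler_pM2l.
    by have := ler_wnM2r (ut0 t x) kappaA; lra.
  have c0 : 0 <= 2^-1 * expR (f t x) * kappa * t ^+ 2.
    have k0 := ltW kappa0; have e0 := expR_ge0 (f t x).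
    by apply: mulr_ge0 (sqr_ge0 t); apply: mulr_ge0 k0; apply: mulr_ge0.
  by have := ler_wpM2l c0 h1; lra.
by rewrite e1; have := le_trans ent e2; lra.
Qed.

(** The family u decreases in t while its squared gradient is at most A times
    the rate of decrease. In the differential inequality for t |-> E exp (kappa t u_t)
    this decrease absorbs the energy, so no error term is left and the moment at
    H is governed by the mean at 0. *)
Theorem exponential_moment H : 0 < H ->
  \int[P]_w expR (kappa * H * u H (joint xi w)) <=
  expR (kappa * H * \int[P]_w u 0 (joint xi w)).
Proof.
move=> H0; have m01 : m 0 = 1.
  rewrite -[RHS](prob_int_cst P); apply: eq_Rintegral => w _.
  by rewrite /f mulr0 mul0r expR0.
have -> : kappa * H * \int[P]_w u 0 (joint xi w) = H * m1 0.
  rewrite [kappa * H]mulrC -mulrA -(bm_intZ P _ (jm (um 0))); congr (_ * _).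
  apply: eq_Rintegral => w _.
  by rewrite /f /ft mulr0 !mul0r expR0 mul1r addr0.
exact: herbst H0 dm m_gt0 m01 entropy_ineq.
Qed.

End ExponentialMoment.

(** * A smooth step *)

Section SmoothStep.
Variable R : realType.
Implicit Types t s y : R.

(** The cubic Hermite step: its slope vanishes at both ends of the unit
    interval, so that the derivative is Lipschitz. *)
Definition step t : R :=
  if t <= 0 then 0 else if 1 <= t then 1 else 3 * t ^+ 2 - 2 * t ^+ 3.
Definition step1 t : R :=
  if t <= 0 then 0 else if 1 <= t then 0 else 6 * t * (1 - t).

Lemma step_itv t : 0 <= step t <= 1.
Proof.
rewrite /step; case: (leP t 0) => t0; first by rewrite lexx ler01.
case: (leP 1 t) => t1; first by rewrite ler01 lexx.
apply/andP; split.
  have -> : 3 * t ^+ 2 - 2 * t ^+ 3 = t ^+ 2 * (3 - 2 * t) by ring.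
  by rewrite mulr_ge0 ?sqr_ge0 //; lra.
rewrite -subr_ge0.
have -> : 1 - (3 * t ^+ 2 - 2 * t ^+ 3) = (1 - t) ^+ 2 * (1 + 2 * t) by ring.
by rewrite mulr_ge0 ?sqr_ge0 //; lra.
Qed.

Lemma step1_itv t : 0 <= step1 t <= 3 / 2.
Proof.
rewrite /step1; case: (leP t 0) => t0; first by apply/andP; split; lra.
case: (leP 1 t) => t1; first by apply/andP; split; lra.
by apply/andP; split; have := sqr_ge0 (t - 2^-1); rewrite expr2; nra.
Qed.

Lemma step_le0 t : t <= 0 -> step t = 0.
Proof. by rewrite /step => ->. Qed.

Lemma step_ge1 t : 1 <= t -> step t = 1.
Proof. by rewrite /step => t1; rewrite t1; case: leP => //; lra. Qed.

Lemma step1_out t : ~~ (0 < t < 1) -> step1 t = 0.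
Proof.
rewrite /step1 negb_and -!leNgt => /orP[->//|t1].
by rewrite t1; case: ifP.
Qed.

Lemma taylor1_step : taylor1 step step1.
Proof.
(* inside the unit interval 3 would do; 12 leaves room for the pairs s, t that
   straddle an end point *)
exists 1, (3 / 2), 12; split => [t|t|s t].
- by have := step_itv t; rewrite ler_norml; lra.
- by have := step1_itv t; rewrite ler_norml; lra.
- pose p x := 3 * x ^+ 2 - 2 * x ^+ 3 : R; pose p1 x := 6 * x * (1 - x) : R.
  have pE x : p x = x ^+ 2 * (3 - 2 * x) by rewrite /p; ring.
  have qE x : 1 - p x = (1 - x) ^+ 2 * (1 + 2 * x) by rewrite /p; ring.
  have p0 x : 0 <= x -> x <= 1 -> 0 <= p x <= 3 * x ^+ 2.
    move=> x0 x1; rewrite pE; have x2 := sqr_ge0 x.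
    by apply/andP; split; move: (x ^+ 2) x2 => q q0; nra.
  have q0 x : 0 <= x -> x <= 1 -> 0 <= 1 - p x <= 3 * (1 - x) ^+ 2.
    move=> x0 x1; rewrite qE; have x2 := sqr_ge0 (1 - x).
    by apply/andP; split; move: ((1 - x) ^+ 2) x2 => q q0; nra.
  have p10 x : 0 <= x -> x <= 1 -> [/\ 0 <= p1 x, p1 x <= 6 * x & p1 x <= 6 * (1 - x)].
    by move=> x0 x1; rewrite /p1; split; nra.
  have sq (a b : R) : 0 <= a -> a <= b -> a ^+ 2 <= b ^+ 2.
    by move=> a0 ab; rewrite ler_pXn2r ?nnegrE // (le_trans a0).
  have st0 := sqr_ge0 (s - t).
  rewrite ler_norml /step /step1 -/(p s) -/(p t) -/(p1 t).
  case: (leP t 0) => t0.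
    rewrite mulr0 !subr0; case: (leP s 0) => s0; first by lra.
    case: (leP 1 s) => s1.
      by have := @sq 1 (s - t) ler01 ltac:(lra); lra.
    have /andP[h1 h2] := p0 s (ltW s0) (ltW s1).
    by have := @sq s (s - t) (ltW s0) ltac:(lra); lra.
  case: (leP 1 t) => t1.
    rewrite mulr0 !subr0; case: (leP s 0) => s0.
      by have := @sq 1 (t - s) ler01 ltac:(lra); rewrite -(sqrrN (t - s)) opprB; lra.
    case: (leP 1 s) => s1; first by lra.
    have /andP[h1 h2] := q0 s (ltW s0) (ltW s1).
    by have := @sq (1 - s) (t - s) ltac:(lra) ltac:(lra); rewrite -(sqrrN (t - s)) opprB; lra.
  have /andP[h1 h2] := p0 t (ltW t0) (ltW t1).
  have /andP[h3 h4] := q0 t (ltW t0) (ltW t1).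
  have [h5 h6 h7] := p10 t (ltW t0) (ltW t1).
  case: (leP s 0) => s0.
    have h8 : (t - s) * p1 t <= (t - s) * (6 * (t - s)) by apply: ler_wpM2l; lra.
    have h9 : 0 <= (t - s) * p1 t by apply: mulr_ge0 => //; lra.
    have := @sq t (t - s) (ltW t0) ltac:(lra); rewrite -(sqrrN (t - s)) opprB !expr2 => h10.
    by move: h1 h2; rewrite !expr2 => h1 h2; lra.
  case: (leP 1 s) => s1.
    have h8 : (s - t) * p1 t <= (s - t) * (6 * (s - t)) by apply: ler_wpM2l; lra.
    have h9 : 0 <= (s - t) * p1 t by apply: mulr_ge0 => //; lra.
    have := @sq (1 - t) (s - t) ltac:(lra) ltac:(lra); rewrite !expr2 => h10.
    by move: h3 h4; rewrite !expr2 => h3 h4; lra.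
  have -> : p s - p t - (s - t) * p1 t = (s - t) ^+ 2 * (3 - 2 * s - 4 * t).
    by rewrite /p /p1; ring.
  by move: ((s - t) ^+ 2) st0 => q hq; apply/andP; split; nra.
Qed.

Lemma taylor1_affine (f f1 : R -> R) a b : taylor1 f f1 ->
  taylor1 (fun y => f (a * y + b)) (fun y => a * f1 (a * y + b)).
Proof.
move=> [B [L [K [fB fL fK]]]]; exists B, (`|a| * L), (K * a ^+ 2).
split => [t|t|s t] //; first by rewrite normrM ler_wpM2l.
have := fK (a * s + b) (a * t + b).
rewrite (_ : a * s + b - (a * t + b) = a * (s - t)); last by ring.
by rewrite exprMn (mulrA K) (mulrA (s - t) a) (mulrC (s - t) a).
Qed.

End SmoothStep.

(** * The random matrix model *)

Section Model.
Context (R : realType) (n : nat) d (T : measurableType d) (P : probability T R).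
Variables (xi : 'I_n -> 'I_n -> {RV P >-> R}) (X : 'I_n -> T -> R).
Hypothesis n_gt0 : (0 < n)%N.
Hypothesis indep : mutually_independent (@upper_pairs n) (fun jk => xi jk.1 jk.2).
Hypothesis xi_sym : forall (j k : 'I_n) (w : T), (j <= k)%N -> xi k j w = xi j k w.
Hypothesis X_eig : forall w : T, ordered_eigenvalues (normalized_matrix xi w) (X^~ w).

Local Notation N := (#|@upper_pairs n|).

Definition entries (i : 'I_N) : {RV P >-> R} := xi (upper_pair i).1 (upper_pair i).2.

Let nR_gt0 : 0 < n%:R :> R. Proof. by rewrite ltr0n. Qed.

Lemma entries_indep : mutually_independent [set: 'I_N]%SET entries.
Proof.
move=> J B _ mB; have up_inj : injective (@upper_pair n) by exact: enum_val_inj.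
pose B' p := if [pick i | upper_pair i == p] is Some i then B i else setT.
have B'E i : B' (upper_pair i) = B i.
  rewrite /B'; case: pickP => [j /eqP/up_inj -> //|/(_ i)].
  by rewrite eqxx.
have := indep (J := [set upper_pair i | i in J]%SET) (B := B').
rewrite big_imset /=; last by move=> i j _ _; exact: up_inj.
under eq_bigr do rewrite B'E.
rewrite [X in P X = _](_ : _ = \bigcap_(i in [set` J]) (entries i @^-1` B i)); last first.
  apply/seteqP; split=> w /= h.
    move=> i /= iJ; rewrite -B'E; apply: (h (upper_pair i)) => /=.
    exact: imset_f.
  by move=> p /= /imsetP [i iJ ->]; rewrite B'E; exact: (h i).
apply.
- by apply/fintype.subsetP => p /imsetP [i _ ->]; exact: enum_valP.
- by move=> p /imsetP [i iJ ->]; rewrite B'E; exact: mB.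
Qed.

Definition entry_vector : T -> N.-tuple R := joint entries.

Lemma normalized_matrix_entries w :
  normalized_matrix xi w = sym_matrix (entry_vector w).
Proof.
by rewrite normalized_matrixE // => j k; exact: xi_sym.
Qed.

Lemma eigen_mean (f : R -> R) w :
  n%:R^-1 * \sum_i f (X i w) = spectral_mean f (entry_vector w).
Proof.
rewrite /spectral_mean; congr (_ * _); apply: trace_fun_roots.
  exact: sym_matrix_sym.
by rewrite -normalized_matrix_entries; have [] := X_eig w.
Qed.

Definition upper_mass (x : R) w : R := n%:R^-1 * \sum_i (x < X i w)%R%:R.

Lemma empirical_dfE w x : empirical_df (X^~ w) x = 1 - upper_mass x w.
Proof.
have n0 : n%:R != 0 :> R by rewrite gt_eqF.
rewrite /empirical_df /upper_mass -[X in X - _](mulVf n0) -mulrBr; congr (_ * _).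
rewrite -sum1_card natr_sum big_mkcond /= -[X in X%:R - _]card_ord -sum1_card natr_sum -sumrB.
apply: eq_bigr => i _; rewrite inE ltNge.
by case: (X i w <= x); rewrite ?subr0 ?subrr.
Qed.

Lemma upper_mass_itv x w : 0 <= upper_mass x w <= 1.
Proof.
rewrite /upper_mass mulr_ge0 ?invr_ge0 ?sumr_ge0 //= ler_pdivrMl // mulr1.
apply: (@le_trans _ _ (\sum_(i < n) (1 : R))); last by rewrite sumr_const card_ord.
by apply: ler_sum => i _; case: (_ < _).
Qed.

Definition ramp x h (y : R) : R := step (h^-1 * y + - (h^-1 * x)).
Definition ramp1 x h (y : R) : R := h^-1 * step1 (h^-1 * y + - (h^-1 * x)).

Lemma rampE x h y : ramp x h y = step ((y - x) / h).
Proof. by rewrite /ramp -mulrBr mulrC. Qed.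

Lemma ramp1E x h y : ramp1 x h y = h^-1 * step1 ((y - x) / h).
Proof. by rewrite /ramp1 -mulrBr [_ * (y - x)]mulrC. Qed.

Lemma taylor1_ramp x h : taylor1 (ramp x h) (ramp1 x h).
Proof. exact: taylor1_affine (@taylor1_step R). Qed.

Lemma ramp_sandwich x h y : 0 < h -> (x + h < y)%R%:R <= ramp x h y <= (x < y)%R%:R.
Proof.
move=> h0; rewrite rampE; have /andP[s0 s1] := step_itv ((y - x) / h).
apply/andP; split.
  case: ltP => //= xhy; rewrite step_ge1 // ler_pdivlMr //; lra.
case: ltP => //= yx; rewrite step_le0 // pmulr_lle0 ?invr_gt0 //; lra.
Qed.

Lemma ramp1_sqr_bound x h y : 0 < h ->
  ramp1 x h y ^+ 2 <= 9 / 4 / h ^+ 2 * ((x < y)%R%:R - (x + h < y)%R%:R).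
Proof.
move=> h0; rewrite ramp1E.
have h2 : 0 < h ^+ 2 by rewrite exprn_gt0.
have [/andP[s0 s1]|out] := boolP (0 < (y - x) / h < 1).
  have xy : x < y by move: s0; rewrite pmulr_lgt0 ?invr_gt0 // subr_gt0.
  have yxh : y <= x + h by move: s1; rewrite ltr_pdivrMr //; lra.
  rewrite xy ltNge yxh /= subr0 mulr1 exprMn exprVn mulrC ler_pM2r ?invr_gt0 //.
  have /andP[t0 t1] := step1_itv ((y - x) / h).
  by rewrite expr2; nra.
rewrite step1_out // mulr0 expr0n /=; apply: mulr_ge0.
  by apply: divr_ge0; [lra | exact: ltW].
rewrite subr_ge0; case: (ltP (x + h) y) => hy; last by rewrite ler0n.
by have -> : (x < y)%R by lra.
Qed.

Definition smooth_mass x h w := spectral_mean (ramp x h) (entry_vector w).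

Lemma bm_spectral f f1 : taylor1 f f1 ->
  bounded_measurable (fun w => spectral_mean f (entry_vector w)).
Proof.
move=> ft; exact: (bm_joint entries (coord_taylor_bm (spectral_coord_taylor n ft))).
Qed.

Lemma bm_smooth_mass x h : bounded_measurable (smooth_mass x h).
Proof. exact: bm_spectral (taylor1_ramp x h). Qed.

Lemma smooth_mass_sandwich x h w : 0 < h ->
  upper_mass (x + h) w <= smooth_mass x h w <= upper_mass x w.
Proof.
move=> h0; rewrite /smooth_mass -eigen_mean /upper_mass !ler_pM2l ?invr_gt0 //.
by apply/andP; split; apply: ler_sum => i _; have /andP[] := ramp_sandwich x (X i w) h0.
Qed.

Lemma measurable_upper_mass x : measurable_fun setT (upper_mass x).
Proof.
apply: (measurable_fun_cvg (h := fun k w => smooth_mass x k.+1%:R^-1 w)).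
  by move=> k; have [] := bm_smooth_mass x k.+1%:R^-1.
move=> w _.
have cvg1 y : ramp x k.+1%:R^-1 y @[k --> \oo] --> ((x < y)%R%:R : R).
  have [xy|yx] := ltP x y; last first.
    rewrite (_ : (fun k : nat => _) = cst 0); first exact: cvg_cst.
    apply/funext => k; rewrite rampE step_le0 //.
    by rewrite invrK pmulr_lle0 // subr_le0.
  apply: cvg_near_cst; near=> k; apply/eqP; rewrite rampE step_ge1 // invrK.
  have : (y - x)^-1 <= k%:R by near: k; exact: nbhs_infty_ger.
  rewrite -[_^-1]mulr1 ler_pdivrMl ?subr_gt0 // => /le_trans; apply.
  by rewrite ler_pM2l ?subr_gt0 // ler_nat.
under eq_fun do rewrite /smooth_mass -eigen_mean.
apply: cvgM; first exact: cvg_cst.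
by apply: cvg_big => [|i _]; [exact: add_continuous | exact: cvg1].
Unshelve. all: end_near. Qed.

Lemma sum_geq (m i : nat) : (\sum_(j < m) (i <= j) = m - i)%N.
Proof.
elim: m => [|m IHm]; first by rewrite big_ord0.
by rewrite big_ord_recr /= IHm; lia.
Qed.

(** In increasing order, the i-th eigenvalue exceeds x exactly when at least
    n - i of them do. *)
Lemma measurable_eigenvalue i : measurable_fun setT (X i).
Proof.
apply: (measurability _ (RGenOInfty.measurableE R)) => _ [_ [x ->] <-].
rewrite setTI (_ : _ @^-1` _ = upper_mass x @^-1` `[(n%:R^-1 * (n - i)%:R), +oo[%classic); last first.
  apply/seteqP; split=> w /=; rewrite !in_itv /= !andbT /upper_mass ler_pM2l ?invr_gt0 //.
    move=> xXi; rewrite -natr_sum ler_nat -sum_geq.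
    apply: leq_sum => j _; case: (leqP i j) => //= ij.
    have h : X i w <= X j w := (X_eig w).1 _ _ ij.
    by have -> : (x < X j w)%R by exact: lt_le_trans xXi h.
  rewrite -natr_sum ler_nat; apply: contraLR; rewrite -leNgt -ltnNge => Xix.
  apply: (@leq_ltn_trans (\sum_(j < n) (i.+1 <= j)%N)); last first.
    by rewrite sum_geq; have := ltn_ord i; lia.
  apply: leq_sum => j _; case: (leqP j i) => ji; last by case: (_ < _)%R.
  have h : X j w <= X i w := (X_eig w).1 _ _ ji.
  by rewrite ltNge (le_trans h Xix).
rewrite -[X in measurable X]setTI; apply: measurable_upper_mass => //.
Qed.

End Model.

(** * Moments of the entries and of the spectrum *)

Section SecondMoment.
Context (R : realType) d (T : measurableType d) (P : probability T R).

Lemma second_moment (Y : {RV P >-> R}) : ('E_P[Y] = 0)%E -> ('V_P[Y] = 1)%E ->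
  (\int[P]_w (Y w ^+ 2)%:E = 1)%E.
Proof.
move=> E0; rewrite /variance covariance.unlock E0 /= expectation.unlock => <-.
by apply: eq_integral => w _; rewrite !fctE /= subr0 expr2.
Qed.

(** Since |Y| <= 1 + Y^2, the second moment makes Y integrable, as the change of
    variables in the mean requires. *)
Lemma law_moments (Y : {RV P >-> R}) : ('E_P[Y] = 0)%E -> ('V_P[Y] = 1)%E ->
  (\int[distribution P Y]_x x%:E = 0)%E /\ (\int[distribution P Y]_x (x ^+ 2)%:E = 1)%E.
Proof.
move=> E0 V1; have m2 := second_moment E0 V1.
have mY : measurable_fun setT Y by [].
have iY2 : P.-integrable setT (EFin \o (fun w => Y w ^+ 2)).
  apply/integrableP; split; first by apply/measurable_EFinP; exact: measurable_funX.
  rewrite (eq_integral (fun w => (Y w ^+ 2)%:E)) ?m2 ?ltry // => w _ /=.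
  by rewrite ger0_norm // sqr_ge0.
have iY : P.-integrable setT (EFin \o Y).
  have := integrableD measurableT (bm_integrable P (bm_cst _ 1)) iY2.
  apply: le_integrable => //; first exact/measurable_EFinP.
  move=> w _ /=; rewrite lee_fin [leRHS]ger0_norm ?addr_ge0 ?sqr_ge0 //.
  by rewrite ler_norml; have := sqr_ge0 (Y w - 1); have := sqr_ge0 (Y w + 1); rewrite !expr2; nra.
have mid : measurable_fun setT (fun x : R => x%:E) by exact/measurable_EFinP.
have msq : measurable_fun setT (fun x : R => (x ^+ 2)%:E).
  by apply/measurable_EFinP; exact: exprn_measurable.
split.
  by rewrite (integral_distribution (f := fun x : R => x%:E) mid iY) -[RHS]E0 expectation.unlock.
by rewrite (integral_distribution (f := fun x : R => (x ^+ 2)%:E) msq iY2).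
Qed.

Lemma gap_ge1 (Y : {RV P >-> R}) tau : 0 <= tau -> ('E_P[Y] = 0)%E -> ('V_P[Y] = 1)%E ->
  spectral_gap (distribution P Y) tau -> 1 <= tau.
Proof.
move=> tau0 E0 V1 gap; have [m1 m2] := law_moments E0 V1.
exact: spectral_gap_ge1 tau0 gap m1 m2.
Qed.

Variables (n : nat) (xi : 'I_n -> 'I_n -> {RV P >-> R}) (X : 'I_n -> T -> R).
Hypothesis n_gt0 : (0 < n)%N.
Hypothesis xi_sym : forall (j k : 'I_n) (w : T), (j <= k)%N -> xi k j w = xi j k w.
Hypothesis X_eig : forall w : T, ordered_eigenvalues (normalized_matrix xi w) (X^~ w).

(** The trace of the squared matrix, computed from the eigenvalues and from the
    entries. *)
Lemma eigen_mean_sqr w : n%:R^-1 * \sum_i X i w ^+ 2 =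
  n%:R^-1 ^+ 2 * \sum_j \sum_k xi j k w ^+ 2.
Proof.
have -> : n%:R^-1 * \sum_i X i w ^+ 2 = spectral_mean (fun y => y ^+ 2) (entry_vector xi w).
  exact: (eigen_mean xi_sym X_eig (fun y => y ^+ 2)).
rewrite /spectral_mean.
have sS := sym_matrix_sym (entry_vector xi w).
rewrite -(trace_matrix_fun_sqr id sS) matrix_fun_id //.
rewrite -(normalized_matrix_entries xi_sym) /mxtrace expr2 -mulrA; congr (_ * _).
rewrite mulr_sumr; apply: eq_bigr => j _; rewrite mxE mulr_sumr; apply: eq_bigr => k _.
rewrite !mxE; have -> : xi k j w = xi j k w.
  by have [jk|/ltnW kj] := leqP j k; [exact: xi_sym | rewrite (xi_sym w kj)].
by rewrite mulrACA -!expr2 exprVn sqr_sqrtr ?ler0n.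
Qed.

Hypothesis xi_mean : forall j k : 'I_n, (j <= k)%N -> ('E_P[xi j k] = 0)%E.
Hypothesis xi_var : forall j k : 'I_n, (j <= k)%N -> ('V_P[xi j k] = 1)%E.

Lemma eigen_second_moment :
  (\int[P]_w (n%:R^-1 * \sum_i X i w ^+ 2)%:E = 1)%E.
Proof.
under eq_integral do rewrite eigen_mean_sqr.
have m j k : (\int[P]_w (xi j k w ^+ 2)%:E = 1)%E.
  have [jk|/ltnW kj] := leqP j k; first by apply: second_moment; [exact: xi_mean | exact: xi_var].
  rewrite -(second_moment (xi_mean kj) (xi_var kj)); apply: eq_integral => w _.
  by rewrite (xi_sym w kj).
have mx j k : measurable_fun setT (fun w => (xi j k w ^+ 2)%:E).
  by apply/measurable_EFinP; exact: measurable_funX.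
under eq_integral do rewrite EFinM -sumEFin.
under eq_integral do under eq_bigr do rewrite -sumEFin.
rewrite ge0_integralZl //; last 2 first.
- by apply: emeasurable_sum => j; apply: emeasurable_sum => k.
- by move=> w _; apply: sume_ge0 => j _; apply: sume_ge0 => k _; rewrite lee_fin sqr_ge0.
rewrite ge0_integral_sum //; last 2 first.
- by move=> j; apply: emeasurable_sum => k.
- by move=> j w _; apply: sume_ge0 => k _; rewrite lee_fin sqr_ge0.
under eq_bigr => j _.
  rewrite ge0_integral_sum //; last by move=> k w _; rewrite lee_fin sqr_ge0.
  under eq_bigr do rewrite m.
  over.
under eq_bigr do rewrite sumEFin.
rewrite sumEFin -EFinM; congr (_%:E).
rewrite !sumr_const card_ord -mulrnA natrM -expr2 -exprMn mulVf ?expr1n //.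
by rewrite pnatr_eq0 -lt0n.
Qed.

End SecondMoment.

(** * Variance of a smoothed counting function *)

Section CauchyWeight.
Variable R : realType.
Notation mu := (@lebesgue_measure R).

Lemma integral_oneDsqrV : (\int[mu]_x ((1 + x ^+ 2)^-1)%:E = (pi : R)%:E)%E.
Proof.
have c : continuous (fun x : R => (1 + x ^+ 2)^-1) by exact: continuous_oneDsqrV.
have p0 (x : R) : 0 <= (1 + x ^+ 2)^-1 by rewrite invr_ge0 addr_ge0 // sqr_ge0.
rewrite ge0_symfun_integralT //; last by move=> x /=; rewrite sqrrN.
rewrite -set_itvcy integral0y_oneDsqr -EFinM; congr (_%:E).
by rewrite mulrCA divff ?mulr1.
Qed.

End CauchyWeight.

Section MeanVariation.
Context (R : realType) (n : nat) d (T : measurableType d) (P : probability T R).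
Variables (xi : 'I_n -> 'I_n -> {RV P >-> R}) (X : 'I_n -> T -> R) (tau : R).
Hypothesis n_gt0 : (0 < n)%N.
Hypothesis indep : mutually_independent (@upper_pairs n) (fun jk => xi jk.1 jk.2).
Hypothesis xi_sym : forall (j k : 'I_n) (w : T), (j <= k)%N -> xi k j w = xi j k w.
Hypothesis X_eig : forall w : T, ordered_eigenvalues (normalized_matrix xi w) (X^~ w).
Notation mu := (@lebesgue_measure R).

Let nR_gt0 : 0 < n%:R :> R. Proof. by rewrite ltr0n. Qed.

Let U := upper_mass X.
Let Z := smooth_mass xi.

Lemma bm_upper_mass x : bounded_measurable (U x).
Proof.
split; first exact: (measurable_upper_mass xi_sym X_eig x).
by exists 1 => w; have /andP[u0 u1] := upper_mass_itv X n_gt0 x w; rewrite ger0_norm.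
Qed.

Lemma mean_empirical_dfE x : mean_empirical_df P X x = 1 - \int[P]_w U x w.
Proof.
rewrite /mean_empirical_df expectation.unlock.
rewrite -[X in X - _](prob_int_cst P) -bm_intB //; last exact: bm_upper_mass.
by congr fine; apply: eq_integral => w _; rewrite empirical_dfE.
Qed.

Lemma upper_mass_nincr x y w : x <= y -> U y w <= U x w.
Proof.
move=> xy; rewrite /U /upper_mass ler_pM2l ?invr_gt0 //; apply: ler_sum => i _.
by case: (ltP y (X i w)) => yX; [rewrite (le_lt_trans xy yX) | case: (_ < _)].
Qed.

Section Variance.
Hypothesis gap : forall i, spectral_gap (coord_law (entries xi) i) tau.
Hypothesis tau0 : 0 <= tau.

(** The squared slope of the ramp is of order h^-2 and lives on a window of
    length h, so its mean is of order h^-2 times the mass of that window. *)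
Lemma smooth_mass_variance x h : 0 < h ->
  \int[P]_w (Z x h w ^+ 2) - (\int[P]_w Z x h w) ^+ 2 <=
  tau * (9 / 2 / (n%:R ^+ 2 * h ^+ 2)) * \int[P]_w (U x w - U (x + h) w).
Proof.
move=> h0; have ft := spectral_coord_taylor n (taylor1_ramp x h).
apply: le_trans (product_poincare (entries_indep indep) ft gap) _.
rewrite -mulrA; apply: ler_wpM2l => //.
have bU := bmB (bm_upper_mass x) (bm_upper_mass (x + h)).
have bg i : bounded_measurable (fun w => spectral_grad (ramp1 x h) i (joint (entries xi) w) ^+ 2).
  by apply: bmX; exact: (bm_joint (entries xi) (coord_taylor_deriv_bm i ft)).
rewrite -bm_int_sum // -bm_intZ //; apply: bm_int_le; [exact: bm_sum | exact: bmZ | move=> w].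
apply: le_trans (spectral_grad_sqr _ _) _.
rewrite -(eigen_mean xi_sym X_eig (fun t => ramp1 x h t ^+ 2)) /U /upper_mass.
rewrite -mulrBr -sumrB.
have -> : 9 / 2 / (n%:R ^+ 2 * h ^+ 2) * (n%:R^-1 *
   \sum_(i < n) ((x < X i w)%R%:R - (x + h < X i w)%R%:R)) =
   2 / n%:R ^+ 2 * (n%:R^-1 * \sum_(i < n) (9 / 4 / h ^+ 2 * ((x < X i w)%R%:R - (x + h < X i w)%R%:R))).
  by rewrite -mulr_sumr; field; rewrite !gt_eqF.
apply: ler_wpM2l; first by rewrite divr_ge0 // sqr_ge0.
rewrite ler_pM2l ?invr_gt0 //; apply: ler_sum => i _.
exact: ramp1_sqr_bound.
Qed.

(** The empirical distribution function is within a window mass of its smoothed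
    version, whose deviation z from the mean is split by |z| <= a / 2 + z^2 / (2 a)
    with a = c / (1 + x^2). This choice makes the first term integrable in x and
    leaves on the window mass a weight of order 1 + x^2, which the second moment
    of the spectrum controls. *)
Lemma mean_deviation x h c : 0 < h -> 0 < c ->
  \int[P]_w `|empirical_df (X^~ w) x - mean_empirical_df P X x| <=
  c / 2 / (1 + x ^+ 2) +
  \int[P]_w ((tau * (9 / 4 / (c * n%:R ^+ 2 * h ^+ 2)) * (1 + x ^+ 2) + 2) *
             (U x w - U (x + h) w)).
Proof.
move=> h0 c0; set D := fun w => U x w - U (x + h) w.
have bU := bm_upper_mass x; have bZ : bounded_measurable (Z x h) := bm_smooth_mass xi x h.
have bD : bounded_measurable D := bmB bU (bm_upper_mass (x + h)).
pose EU := \int[P]_w U x w; pose EZ := \int[P]_w Z x h w; pose ED := \int[P]_w D w.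
pose q := 1 + x ^+ 2; have q0 : 0 < q by rewrite ltr_pwDl // sqr_ge0.
pose a := c / q; have a0 : 0 < a by rewrite divr_gt0.
have UZ w : 0 <= U x w - Z x h w <= D w.
  by have /andP[h1 h2] := smooth_mass_sandwich n_gt0 xi_sym X_eig x w h0; rewrite /D /U /Z; lra.
have EUZ : 0 <= EU - EZ <= ED.
  rewrite -bm_intB // bm_int_ge0 /=; last by move=> w; case/andP: (UZ w).
  by apply: bm_int_le => // [|w]; [exact: bmB | case/andP: (UZ w)].
pose V := \int[P]_w (Z x h w ^+ 2) - EZ ^+ 2.
have bZ2 : bounded_measurable (fun w => (Z x h w - EZ) ^+ 2) by apply: bmX; exact: bmB.
have EV : \int[P]_w ((Z x h w - EZ) ^+ 2) = V.
  transitivity (\int[P]_w ((Z x h w ^+ 2 - 2 * EZ * Z x h w) + EZ ^+ 2)).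
    by apply: eq_Rintegral => w _; ring.
  have b2 : bounded_measurable (fun w => Z x h w ^+ 2) by exact: bmX.
  have b3 : bounded_measurable (fun w => 2 * EZ * Z x h w) by exact: bmZ.
  rewrite bm_intD //; last exact: bmB.
  by rewrite bm_intB // bm_intZ // prob_int_cst /V -/EZ; ring.
have pt w : `|empirical_df (X^~ w) x - mean_empirical_df P X x| <=
    (2^-1 * a + (2 * a)^-1 * (Z x h w - EZ) ^+ 2) + (D w + ED).
  rewrite empirical_dfE // mean_empirical_dfE -/EU.
  have -> : 1 - U x w - (1 - EU) = - (Z x h w - EZ) + ((EU - EZ) - (U x w - Z x h w)) by ring.
  apply: (le_trans (ler_normD _ _)); apply: lerD; last first.
    have /andP[u1 u2] := UZ w; have /andP[v1 v2] := EUZ.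
    by rewrite ler_norml; lra.
  rewrite normrN; set z := Z x h w - EZ.
  have -> : 2^-1 * a + (2 * a)^-1 * z ^+ 2 = (a ^+ 2 + `|z| ^+ 2) / (2 * a).
    by rewrite real_normK ?num_real //; field; rewrite gt_eqF.
  have a20 : 0 < 2 * a by rewrite mulr_gt0.
  rewrite ler_pdivlMr //.
  by have := sqr_ge0 (a - `|z|); rewrite !expr2; lra.
have b1 : bounded_measurable (fun w => 2^-1 * a + (2 * a)^-1 * (Z x h w - EZ) ^+ 2).
  by apply: bmD => //; exact: bmZ.
have b2 : bounded_measurable (fun w => D w + ED) by exact: bmD.
have bl : bounded_measurable (fun w => `|empirical_df (X^~ w) x - mean_empirical_df P X x|).
  apply: bm_norm; apply: bmB => //.
  have -> : (fun w => empirical_df (X^~ w) x) = fun w => 1 - U x w.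
    by apply/funext => w'; rewrite empirical_dfE.
  exact: bmB.
apply: le_trans (bm_int_le P bl (bmD b1 b2) pt) _.
rewrite (bm_intD P b1 b2) (bm_intD P (bm_cst T (2^-1 * a)) (bmZ (2 * a)^-1 bZ2)).
rewrite (bm_intZ P _ bZ2) EV (bm_intD P bD (bm_cst T ED)) !prob_int_cst -/ED.
rewrite (bm_intZ P _ bD) -/ED.
have hV := smooth_mass_variance x h0; rewrite -/V -/EZ -/ED in hV.
have e1 : 2^-1 * a = c / 2 / q by rewrite /a; field; rewrite !gt_eqF.
have ia0 : 0 <= (2 * a)^-1 by rewrite invr_ge0 mulr_ge0 // ltW.
have := ler_wpM2l ia0 hV.
rewrite [X in _ <= X -> _](_ : _ = tau * (9 / 4 / (c * n%:R ^+ 2 * h ^+ 2)) * q * ED); last first.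
  by rewrite /a; field; rewrite !gt_eqF.
by rewrite -e1 -/q; lra.
Qed.

End Variance.

End MeanVariation.

(** * The mean variation in L1 *)

Section MeanVariationL1.
Context (R : realType) (n : nat) d (T : measurableType d) (P : probability T R).
Variables (xi : 'I_n -> 'I_n -> {RV P >-> R}) (X : 'I_n -> T -> R) (tau : R).
Hypothesis n_gt0 : (0 < n)%N.
Hypothesis indep : mutually_independent (@upper_pairs n) (fun jk => xi jk.1 jk.2).
Hypothesis xi_sym : forall (j k : 'I_n) (w : T), (j <= k)%N -> xi k j w = xi j k w.
Hypothesis X_eig : forall w : T, ordered_eigenvalues (normalized_matrix xi w) (X^~ w).
Hypothesis xi_mean : forall j k : 'I_n, (j <= k)%N -> ('E_P[xi j k] = 0)%E.
Hypothesis xi_var : forall j k : 'I_n, (j <= k)%N -> ('V_P[xi j k] = 1)%E.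
Hypothesis gap : forall i, spectral_gap (coord_law (entries xi) i) tau.
Hypothesis tau0 : 0 <= tau.
Notation mu := (@lebesgue_measure R).

Let nR_gt0 : 0 < n%:R :> R. Proof. by rewrite ltr0n. Qed.

Let U := upper_mass X.

Lemma measurable_upper_mass2 : measurable_fun setT (fun p : T * R => U p.2 p.1).
Proof.
rewrite /U /upper_mass; apply: measurable_funM => //.
apply: measurable_sum => i.
rewrite (_ : (fun p : T * R => _) = fun p => if (p.2 < X i p.1)%R then 1 else 0); last first.
  by apply/funext => p; case: (_ < _)%R.
apply: measurable_fun_ifT => //.
apply: measurable_fun_ltr; first exact: measurable_snd.
by apply: measurableT_comp; [exact: measurable_eigenvalue xi_sym X_eig i | exact: measurable_fst].
Qed.

Lemma measurable_mean_df : measurable_fun setT (mean_empirical_df P X).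
Proof.
apply: nondecreasing_measurable => // x y xy.
have bU := bm_upper_mass n_gt0 xi_sym X_eig.
rewrite !(mean_empirical_dfE n_gt0 xi_sym X_eig) lerD2l lerN2.
by apply: bm_int_le => // w; exact: upper_mass_nincr.
Qed.

Lemma measurable_deviation :
  measurable_fun setT (fun p : T * R =>
    `|empirical_df (X^~ p.1) p.2 - mean_empirical_df P X p.2|%:E).
Proof.
apply/measurable_EFinP; apply: measurableT_comp => //.
apply: measurable_funB; last by apply: measurableT_comp; [exact: measurable_mean_df | exact: measurable_snd].
rewrite (_ : (fun p : T * R => _) = fun p => 1 - U p.2 p.1); last first.
  by apply/funext => p; rewrite empirical_dfE.
by apply: measurable_funB => //; exact: measurable_upper_mass2.
Qed.

(** Integrated over the level, the mass of a window of length h is h; the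
    quadratic weight is paid for by the second moment of the spectrum. *)
Lemma window_integral (K h : R) w : 0 <= K -> 0 < h ->
  (\int[mu]_x ((K * (1 + x ^+ 2) + 2) * (U x w - U (x + h) w))%:E <=
   (h * (K * (1 + 2 * h ^+ 2) + 2) + 2 * h * K * (n%:R^-1 * \sum_i X i w ^+ 2))%:E)%E.
Proof.
move=> K0 h0.
pose a i := K * (1 + 2 * X i w ^+ 2 + 2 * h ^+ 2) + 2.
pose I i := `[(X i w - h), (X i w)[%classic : set R.
have a0 i : 0 <= a i.
  apply: addr_ge0 => //; apply: mulr_ge0 => //; apply: addr_ge0; last by rewrite mulr_ge0 // sqr_ge0.
  by rewrite addr_ge0 // mulr_ge0 // sqr_ge0.
have mI i : measurable (I i) by exact: measurable_itv.
have mII i : measurable_fun setT (\1_(I i) : R -> R) by exact: measurable_indic.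
have mind i : measurable_fun setT (fun x : R => n%:R^-1 * a i * \1_(I i) x).
  exact: (measurable_funM (measurable_cst _) (mII i)).
have pt x : (K * (1 + x ^+ 2) + 2) * (U x w - U (x + h) w) <=
    \sum_i n%:R^-1 * a i * \1_(I i) x.
  rewrite /U /upper_mass -mulrBr -sumrB mulrCA mulr_sumr mulr_sumr.
  apply: ler_sum => i _; rewrite -mulrA ler_pM2l ?invr_gt0 // indicE.
  have [xI|xI] := boolP (x \in I i).
    move: xI; rewrite inE /I /= in_itv /= => /andP[x1 x2].
    rewrite x2 (_ : (x + h < X i w)%R = false) ?subr0 ?mulr1; last by apply/negbTE; rewrite -leNgt; lra.
    rewrite /a lerD2r ler_wpM2l // -addrA lerD2l.
    have := sqr_ge0 (x - X i w); have : (x - X i w) ^+ 2 <= h ^+ 2.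
      have : 0 <= (h - (x - X i w)) * (h + (x - X i w)) by apply: mulr_ge0; lra.
      by rewrite !expr2; lra.
    have := sqr_ge0 (2 * X i w - x); rewrite !expr2; nra.
  have : (x < X i w)%R = (x + h < X i w)%R.
    apply/idP/idP => [x2|]; last by move=> ?; lra.
    rewrite ltNge; apply: contra xI => x1.
    by rewrite inE /I /= in_itv /= x2 andbT; lra.
  by move=> ->; rewrite subrr !mulr0.
apply: (@le_trans _ _ (\int[mu]_x (\sum_i n%:R^-1 * a i * \1_(I i) x)%:E)%E).
  apply: ge0_le_integral => //.
  - move=> x _; rewrite lee_fin mulr_ge0 //.
      by rewrite addr_ge0 // mulr_ge0 // addr_ge0 // sqr_ge0.
    by rewrite subr_ge0 upper_mass_nincr // lerDl ltW.
  - apply/measurable_EFinP; apply: measurable_funM.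
      apply: measurable_funD => //; apply: measurable_funM => //.
      by apply: measurable_funD => //; exact: exprn_measurable.
    have mU : measurable_fun setT (fun x : R => U x w).
      by apply: nonincreasing_measurable => // x y xy; exact: upper_mass_nincr.
    have mUh : measurable_fun setT (fun x : R => U (x + h) w).
      by apply: nonincreasing_measurable => // x y xy; apply: upper_mass_nincr => //; rewrite lerD2r.
    exact: (measurable_funB mU mUh).
  - apply/measurable_EFinP; exact: measurable_sum.
  - by move=> x _; rewrite lee_fin.
under eq_integral do rewrite -sumEFin.
rewrite ge0_integral_sum //; last 2 first.
- by move=> i; apply/measurable_EFinP; exact: mind.
- by move=> i x _; rewrite lee_fin !mulr_ge0 ?invr_ge0.
have Ii i : (\int[mu]_x (n%:R^-1 * a i * \1_(I i) x)%:E = (n%:R^-1 * a i * h)%:E)%E.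
  under eq_integral do rewrite EFinM.
  rewrite ge0_integralZl //; last 2 first.
  - by apply/measurable_EFinP; exact: mII.
  - by rewrite lee_fin mulr_ge0 ?invr_ge0.
  rewrite (@integral_indic _ _ R mu setT measurableT (I i) (mI i)) setIT.
  rewrite [X in (_ * X)%E](_ : _ = h%:E); last first.
    rewrite /I; transitivity (mu `[X i w - h, X i w[%classic) => //; rewrite lebesgue_measure_itv /= lte_fin ltrBlDr ltrDl h0.
    by rewrite -EFinB opprB addrC subrK.
  by rewrite -EFinM.
under eq_bigr do rewrite Ii.
rewrite sumEFin lee_fin -mulr_suml -mulr_sumr.
rewrite [\sum_i a i](_ : _ = n%:R * (K * (1 + 2 * h ^+ 2) + 2) + 2 * K * \sum_i X i w ^+ 2); last first.
  rewrite mulr_sumr -[X in X%:R * _]card_ord -sum1_card natr_sum mulr_suml -big_split /=.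
  by apply: eq_bigr => i _; rewrite /a; ring.
rewrite le_eqVlt; apply/orP; left; apply/eqP; field.
by rewrite gt_eqF.
Qed.

(** Integrating [mean_deviation] over x: pi comes from the weight 1 / (1 + x^2),
    and 3 + 2 h^2 from the second moment 1 of the spectrum and the width of the
    window. *)
Theorem mean_variation_L1 h c : 0 < h -> 0 < c ->
  (\int[P]_w \int[mu]_x `|empirical_df (X^~ w) x - mean_empirical_df P X x|%:E <=
   (c / 2 * pi + h * (tau * (9 / 4 / (c * n%:R ^+ 2 * h ^+ 2)) * (3 + 2 * h ^+ 2) + 2))%:E)%E.
Proof.
move=> h0 c0; set K := tau * _.
have K0 : 0 <= K.
  by rewrite /K mulr_ge0 // divr_ge0 // !mulr_ge0 ?sqr_ge0 // ltW.
pose G x w := (K * (1 + x ^+ 2) + 2) * (U x w - U (x + h) w).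
have q0 (x : R) : 0 < 1 + x ^+ 2 by rewrite ltr_pwDl // sqr_ge0.
have G0 x w : 0 <= G x w.
  rewrite /G mulr_ge0 //; last by rewrite subr_ge0 upper_mass_nincr // lerDl ltW.
  by rewrite addr_ge0 // mulr_ge0 // ltW.
have mG : measurable_fun setT (fun p : T * R => (G p.2 p.1)%:E).
  apply/measurable_EFinP; apply: measurable_funM.
    apply: measurable_funD => //; apply: measurable_funM => //; apply: measurable_funD => //.
    by apply: measurable_funX; exact: measurable_snd.
  apply: measurable_funB; first exact: measurable_upper_mass2.
  apply: (measurableT_comp (f := fun p : T * R => U p.2 p.1) (g := fun p : T * R => (p.1, p.2 + h))).
    exact: measurable_upper_mass2.
  apply: measurable_fun_pair; first exact: measurable_fst.
  by apply: measurable_funD => //; exact: measurable_snd.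
have bD x := bmB (bm_upper_mass n_gt0 xi_sym X_eig x) (bm_upper_mass n_gt0 xi_sym X_eig (x + h)).
have bdev x : bounded_measurable (fun w => `|empirical_df (X^~ w) x - mean_empirical_df P X x|).
  apply: bm_norm; apply: bmB => //.
  have -> : (fun w => empirical_df (X^~ w) x) = fun w => 1 - U x w.
    by apply/funext => w'; rewrite empirical_dfE.
  by apply: bmB => //; exact: bm_upper_mass n_gt0 xi_sym X_eig x.
rewrite (fubini_tonelli (m1 := P) (m2 := mu) _ measurable_deviation) => [|p]; last by rewrite lee_fin.
have mw : measurable_fun setT (fun x : R => (c / 2 / (1 + x ^+ 2))%:E).
  apply/measurable_EFinP; apply: measurable_funM => //.
  by apply: continuous_measurable_fun; exact: continuous_oneDsqrV.
have mGx : measurable_fun setT (fun x : R => (\int[P]_w (G x w)%:E)%E).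
  exact: (measurable_fun_fubini_tonelli_G (m1 := P) _ mG (fun p => G0 p.2 p.1)).
have w0 (x : R) : 0 <= c / 2 / (1 + x ^+ 2) by rewrite !divr_ge0 // ?ltW.
apply: (@le_trans _ _ (\int[mu]_x ((c / 2 / (1 + x ^+ 2))%:E + \int[P]_w (G x w)%:E))%E).
  apply: ge0_le_integral => //.
  - by move=> x _; apply: integral_ge0 => w _; rewrite lee_fin.
  - exact: (measurable_fun_fubini_tonelli_G (m1 := P) _ measurable_deviation (fun p => normr_ge0 _)).
  - exact: emeasurable_funD.
  - move=> x _; rewrite -(bm_EFin P (bmZ (K * (1 + x ^+ 2) + 2) (bD x))) -(bm_EFin P (bdev x)).
    rewrite -EFinD lee_fin.
    exact: (mean_deviation n_gt0 indep xi_sym X_eig gap tau0 x h0 c0).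
rewrite ge0_integralD //; last 2 first.
- by move=> x _; rewrite lee_fin.
- by move=> x _; rewrite integral_ge0 // => w _; rewrite lee_fin.
rewrite EFinD; apply: leeD.
  under eq_integral do rewrite EFinM.
  rewrite ge0_integralZl //; last 3 first.
  - by apply/measurable_EFinP; apply: continuous_measurable_fun; exact: continuous_oneDsqrV.
  - by move=> x _; rewrite lee_fin invr_ge0 ltW.
  - by rewrite lee_fin divr_ge0 // ltW.
  by rewrite integral_oneDsqrV -EFinM.
rewrite -(fubini_tonelli (m1 := P) (m2 := mu) _ mG) => [|p]; last by rewrite lee_fin.
have mX2 : measurable_fun setT (fun w => n%:R^-1 * \sum_i X i w ^+ 2).
  apply: measurable_funM => //; apply: measurable_sum => i; apply: measurable_funX.
  exact: measurable_eigenvalue xi_sym X_eig i.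
have X20 w : 0 <= n%:R^-1 * \sum_i X i w ^+ 2.
  by rewrite mulr_ge0 ?invr_ge0 // sumr_ge0 // => i _; exact: sqr_ge0.
have A0 : 0 <= h * (K * (1 + 2 * h ^+ 2) + 2).
  apply: mulr_ge0; first exact: ltW.
  apply: addr_ge0 => //; apply: mulr_ge0 => //; apply: addr_ge0 => //.
  by apply: mulr_ge0 => //; exact: sqr_ge0.
have B0 : 0 <= 2 * h * K by apply: mulr_ge0 => //; apply: mulr_ge0 => //; exact: ltW.
apply: (@le_trans _ _ (\int[P]_w ((h * (K * (1 + 2 * h ^+ 2) + 2))%:E +
   (2 * h * K)%:E * (n%:R^-1 * \sum_i X i w ^+ 2)%:E))%E).
  apply: ge0_le_integral => //.
  - by move=> w _; apply: integral_ge0 => x _; rewrite lee_fin.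
  - exact: (measurable_fun_fubini_tonelli_F (m2 := mu) _ mG (fun p => G0 p.2 p.1)).
  - by apply: emeasurable_funD => //; apply: emeasurable_funM => //; exact/measurable_EFinP.
  - by move=> w _; rewrite -EFinM -EFinD; exact: window_integral.
rewrite ge0_integralD //; last 2 first.
- by move=> w _; rewrite -EFinM lee_fin mulr_ge0.
- by apply: emeasurable_funM => //; exact/measurable_EFinP.
rewrite -(bm_EFin P (bm_cst T _)) prob_int_cst.
rewrite ge0_integralZl //; last 2 first.
- exact/measurable_EFinP.
- by move=> w _; rewrite lee_fin.
rewrite (eigen_second_moment n_gt0 xi_sym X_eig xi_mean xi_var) mule1 -EFinD lee_fin.
lra.
Qed.

End MeanVariationL1.

(** * The bound under the Poincare inequality *)

Lemma powR_two_thirds (R : realType) (a : R) : 0 <= a -> (a `^ (2 / 3)) ^+ 3 = a ^+ 2.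
Proof.
move=> a0; rewrite -powR_mulrn ?powR_ge0 // -powRrM.
by rewrite (_ : 2 / 3 * 3%:R = 2%:R) ?powR_mulrn //; field.
Qed.

Section MeanVariationPI.
Context (R : realType) (n : nat) d (T : measurableType d) (P : probability T R).
Variables (xi : 'I_n -> 'I_n -> {RV P >-> R}) (X : 'I_n -> T -> R) (sigma : R).
Hypothesis n_gt0 : (0 < n)%N.
Hypothesis indep : mutually_independent (@upper_pairs n) (fun jk => xi jk.1 jk.2).
Hypothesis xi_sym : forall (j k : 'I_n) (w : T), (j <= k)%N -> xi k j w = xi j k w.
Hypothesis X_eig : forall w : T, ordered_eigenvalues (normalized_matrix xi w) (X^~ w).
Hypothesis xi_mean : forall j k : 'I_n, (j <= k)%N -> ('E_P[xi j k] = 0)%E.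
Hypothesis xi_var : forall j k : 'I_n, (j <= k)%N -> ('V_P[xi j k] = 1)%E.
Hypothesis sigma0 : 0 <= sigma.

Let i0 : 'I_#|@upper_pairs n|.
Proof.
apply: (@Ordinal _ 0); apply/card_gt0P.
by exists (Ordinal n_gt0, Ordinal n_gt0); rewrite inE /=.
Qed.

(** An inequality with a small constant would contradict the unit variance of
    the entries. *)
Lemma entries_gap_ge1 tau : 0 <= tau ->
  (forall i, spectral_gap (coord_law (entries xi) i) tau) -> 1 <= tau.
Proof.
move=> tau0 gap; have le0 : ((upper_pair i0).1 <= (upper_pair i0).2)%N.
  by have := enum_valP i0; rewrite inE.
exact: (gap_ge1 tau0 (xi_mean le0) (xi_var le0) (gap i0)).
Qed.

Theorem mean_variation_PI : (forall i, PI sigma (coord_law (entries xi) i)) ->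
  (\int[P]_w \int[lebesgue_measure]_x
     `|empirical_df (X^~ w) x - mean_empirical_df P X x|%:E <=
   (16 * sigma / n%:R `^ (2 / 3))%:E)%E.
Proof.
move=> pi_; have gap i := spectral_gap_PI (pi_ i).
have s2 : 1 <= sigma ^+ 2 by apply: (entries_gap_ge1 _ gap); exact: sqr_ge0.
have s1 : 1 <= sigma by rewrite leNgt; apply/negP => s1; move: s2; rewrite leNgt expr_lt1 // s1.
have sp : 0 < sigma by exact: lt_le_trans s1.
(* the scale is h = 1 / p and the weight in mean_deviation is c = sigma / p *)
pose p : R := n%:R `^ (2 / 3).
have n1 : 1 <= n%:R :> R by rewrite ler1n.
have np : 0 < n%:R :> R by rewrite ltr0n.
have p3 : p ^+ 3 = n%:R ^+ 2 by exact: powR_two_thirds.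
have p0 : 0 < p by exact: powR_gt0.
have p1 : 1 <= p by rewrite /p -[leLHS](powRr0 n%:R) ler_powR // divr_ge0.
have ip0 : 0 < p^-1 by rewrite invr_gt0.
have ip1 : p^-1 <= 1 by rewrite invf_le1.
have sip : 0 < sigma / p by rewrite divr_gt0.
apply: le_trans (mean_variation_L1 n_gt0 indep xi_sym X_eig xi_mean xi_var gap _ ip0 sip) _.
  exact: sqr_ge0.
rewrite lee_fin -p3 -/p.
have -> : sigma ^+ 2 * (9 / 4 / (sigma / p * p ^+ 3 * p^-1 ^+ 2)) = sigma * (9 / 4).
  by field; rewrite !gt_eqF.
rewrite (_ : 16 * sigma / p = 16 * (sigma / p)); last by ring.
rewrite (_ : sigma / p / 2 * pi = sigma / p * (pi / 2)); last by ring.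
have hp : (pi / 2 : R) < 2 by exact: pihalf_lt2.
have i2 : p^-1 ^+ 2 <= 1 by rewrite expr_le1 // ltW.
have : p^-1 * (sigma * (9 / 4) * (3 + 2 * p^-1 ^+ 2) + 2) <= p^-1 * (sigma * (53 / 4)).
  rewrite ler_pM2l //; nra.
have : sigma / p * (pi / 2) <= sigma / p * 2 by rewrite ler_pM2l // ltW.
have : 0 < p^-1 * sigma by rewrite mulr_gt0.
lra.
Qed.

End MeanVariationPI.

(** * Exponential moments of a sweeping profile *)

(** The profile chi decreases; as t grows from 0 to h it is moved by its own width
    h, in the direction given by the sign s. The squared slope of
    y |-> chi ((s y + t + b) / h) is at most 3 / (2 h) times its rate of decrease in
    t, which is what [exponential_moment] asks for. *)
Section Sweep.
Context (R : realType) (n : nat) d (T : measurableType d) (P : probability T R).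
Local Notation N := (#|@upper_pairs n|).
Variable xi : 'I_N -> {RV P >-> R}.
Hypothesis n_gt0 : (0 < n)%N.
Hypothesis indep : mutually_independent [set: 'I_N]%SET xi.
Variable sigma : R.
Hypothesis sigma0 : 0 < sigma.
Hypothesis lsi : forall i, LSI sigma (coord_law xi i).
Variables (chi chi1 : R -> R) (s b h : R).
Hypothesis chi_t : taylor1 chi chi1.
Hypothesis chi1_itv : forall t, - (3 / 2) <= chi1 t <= 0.
Hypothesis s2 : s ^+ 2 = 1.
Hypothesis h0 : 0 < h.

Let nR_gt0 : 0 < n%:R :> R. Proof. by rewrite ltr0n. Qed.

Let arg (t y : R) := h^-1 * s * y + h^-1 * (t + b).

Lemma spectral_mean_exp_decrease (lambda := 2 * n%:R ^+ 2 * h ^+ 2 / (3 * sigma ^+ 2)) :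
  \int[P]_w expR (lambda * spectral_mean (fun y => chi (arg h y)) (joint xi w)) <=
  expR (lambda * \int[P]_w spectral_mean (fun y => chi (arg 0 y)) (joint xi w)).
Proof.
have hn0 : h != 0 by rewrite gt_eqF.
have [B [L [K [chiB chi1L chiK]]]] := chi_t.
pose u t := spectral_mean (n := n) (fun y => chi (arg t y)).
pose ut t := spectral_mean (n := n) (fun y => h^-1 * chi1 (arg t y)).
pose du t := spectral_grad (n := n) (fun y => h^-1 * s * chi1 (arg t y)).
have K0 : 0 <= K by have := le_trans (normr_ge0 _) (chiK 1 0); rewrite subr0 expr1n mulr1.
have L0 : 0 <= L := le_trans (normr_ge0 _) (chi1L 0).
have ih0 : 0 < h^-1 by rewrite invr_gt0.
have uK t t' x : `|u t x - u t' x - (t - t') * ut t' x| <= K * h^-1 ^+ 2 * (t - t') ^+ 2.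
  rewrite (_ : u t x - u t' x - (t - t') * ut t' x = n%:R^-1 * \sum_(i < n)
     (chi (arg t (spectrum (sym_matrix x) i)) - chi (arg t' (spectrum (sym_matrix x) i)) -
      (t - t') * (h^-1 * chi1 (arg t' (spectrum (sym_matrix x) i))))); last first.
    by rewrite /u /ut /spectral_mean /trace_fun 2!sumrB -!mulr_sumr; ring.
  rewrite normrM ger0_norm ?invr_ge0 // ler_pdivrMl //.
  apply: (le_trans (ler_norm_sum _ _ _)).
  rewrite mulr_natl -[n in _ *+ n]card_ord -sumr_const; apply: ler_sum => i _.
  rewrite mulrA; apply: (le_trans _ (_ : K * (arg t (spectrum (sym_matrix x) i) - arg t' (spectrum (sym_matrix x) i)) ^+ 2 <= _)).
    rewrite (_ : (t - t') * h^-1 = arg t (spectrum (sym_matrix x) i) - arg t' (spectrum (sym_matrix x) i)) //.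
    by rewrite /arg; ring.
  by rewrite le_eqVlt; apply/orP; left; apply/eqP; rewrite /arg; ring.
have mono (f g : R -> R) x : (forall y, f y <= g y) -> spectral_mean (n := n) f x <= spectral_mean g x.
  by move=> fg; rewrite /spectral_mean ler_pM2l ?invr_gt0 // /trace_fun; apply: ler_sum => i _.
have meanZ c (f : R -> R) x : spectral_mean (n := n) (fun y => c * f y) x = c * spectral_mean f x.
  by rewrite /spectral_mean /trace_fun -mulr_sumr mulrCA.
have grad t x : \sum_i du t i x ^+ 2 <= - (3 / (n%:R ^+ 2 * h)) * ut t x.
  apply: (le_trans (spectral_grad_sqr _ _)).
  rewrite (_ : - _ * _ = 2 / n%:R ^+ 2 * (- (3 / (2 * h)) * ut t x)); last by field; rewrite hn0 gt_eqF.
  rewrite ler_pM2l ?divr_gt0 ?exprn_gt0 // /ut -meanZ; apply: mono => y.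
  rewrite !exprMn s2 mulr1 exprVn.
  rewrite (_ : - _ * _ = (h ^+ 2)^-1 * (- (3 / 2) * chi1 (arg t y))); last by field.
  rewrite ler_pM2l ?invr_gt0 ?exprn_gt0 //.
  by have /andP[c1 c2] := chi1_itv (arg t y); rewrite expr2; nra.
have ut0 t x : ut t x <= 0.
  rewrite /ut meanZ pmulr_rle0 // /spectral_mean pmulr_rle0 ?invr_gt0 //.
  by apply: sumr_le0 => i _; case/andP: (chi1_itv (arg t (spectrum (sym_matrix x) i))).
have utL t x : `|ut t x| <= h^-1 * L.
  by apply: spectral_mean_norm => y; rewrite normrM gtr0_norm // ler_pM2l.
have uB t x : `|u t x| <= B by exact: spectral_mean_norm.
have ux t : coord_taylor (u t) (du t).
  exact: (spectral_coord_taylor n (taylor1_affine (h^-1 * s) (h^-1 * (t + b)) chi_t)).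
pose kappa := 2 * n%:R ^+ 2 * h / (3 * sigma ^+ 2).
have k0 : 0 < kappa by rewrite divr_gt0 ?mulr_gt0 ?exprn_gt0.
have kA : sigma ^+ 2 * kappa * (3 / (n%:R ^+ 2 * h)) <= 2.
  by rewrite le_eqVlt; apply/orP; left; apply/eqP; rewrite /kappa; field; rewrite hn0 !gt_eqF.
have := exponential_moment indep uB utL uK ux grad ut0 lsi k0 kA h0.
rewrite (_ : kappa * h = lambda) //; rewrite /kappa /lambda; field.
by rewrite gt_eqF.
Qed.

End Sweep.

(** * The semicircle distribution function *)

Section Semicircle.
Variable R : realType.
Notation mu := (@lebesgue_measure R).
Notation f := (@semicircle_pdf R).
Notation G := (@semicircle_df R).

Lemma semicircle_pdf_itv x : 0 <= f x <= 1.
Proof.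
rewrite /semicircle_pdf; case: ifP => _; last by rewrite lexx ler01.
have p2 := pi_ge2 R; have p0 : 0 < 2 * pi :> R by rewrite mulr_gt0 // pi_gt0.
rewrite mulr_ge0 ?invr_ge0 ?sqrtr_ge0 ?(ltW p0) //= ler_pdivrMl // mulr1.
apply: (@le_trans _ _ 2); last by lra.
rewrite -[leRHS](@ger0_norm _ 2) // -sqrtr_sqr ler_wsqrtr //.
by have := sqr_ge0 x; lra.
Qed.

Lemma semicircle_pdf_out x : ~~ (-2 < x < 2) -> f x = 0.
Proof. by rewrite /semicircle_pdf => /negPf ->. Qed.

Lemma measurable_semicircle_pdf : measurable_fun setT f.
Proof.
apply: measurable_fun_ifT.
- apply: measurable_and; exact: measurable_fun_ltr.
- apply: measurable_funM => //; apply: continuous_measurable_fun => x.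
  apply: continuous_comp; last exact: sqrt_continuous.
  by apply: cvgB; [exact: cvg_cst | exact: exprn_continuous].
- exact: measurable_cst.
Qed.

Lemma integrable_semicircle_pdf : mu.-integrable setT (EFin \o f).
Proof.
apply/integrableP; split; first by apply/measurable_EFinP; exact: measurable_semicircle_pdf.
pose I := `[(-2 : R), 2]%classic; have mI : measurable I by exact: measurable_itv.
apply: (@le_lt_trans _ _ (\int[mu]_x (\1_I x)%:E)%E).
  apply: ge0_le_integral => //.
  - by apply: measurableT_comp => //; apply/measurable_EFinP; exact: measurable_semicircle_pdf.
  - by apply/measurable_EFinP; exact: measurable_indic.
  - move=> x _; rewrite /= lee_fin indicE; have /andP[f0 f1] := semicircle_pdf_itv x.
    rewrite ger0_norm //; case: (boolP (x \in _)) => // xI.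
    rewrite semicircle_pdf_out //; apply: contra xI => /andP[x1 x2].
    by rewrite inE /= /I /= in_itv /= !ltW.
rewrite (@integral_indic _ _ R mu setT measurableT _ mI) setIT.
change (mu I < +oo)%E; rewrite /I.
rewrite lebesgue_measure_itv /=; case: ifP => _; by rewrite -?EFinB ltry.
Qed.

Lemma semicircle_df_increment a b : a <= b ->
  G b - G a = \int[mu]_(t in `]a, b]) f t.
Proof.
move=> ab; rewrite /semicircle_df (@Rintegral_itvB _ f -oo%O (BRight b) a) //.
apply: integrableS integrable_semicircle_pdf => //.
Qed.

Lemma semicircle_df_lipschitz a b : a <= b -> 0 <= G b - G a <= b - a.
Proof.
move=> ab; rewrite semicircle_df_increment //; apply/andP; split.
  by apply: Rintegral_ge0 => x _; case/andP: (semicircle_pdf_itv x).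
have mI : measurable (`]a, b]%classic : set R) by exact: measurable_itv.
have muI : mu `]a, b]%classic = (b - a)%:E.
  rewrite lebesgue_measure_itv /= lte_fin EFinB; case: ltP => // ba.
  by rewrite (@le_anti _ _ a b) ?ab // -EFinB subrr.
have mI' : (mu `]a, b]%classic < +oo)%E by rewrite muI ltry.
apply: (@le_trans _ _ (\int[mu]_(t in `]a, b]) 1)).
  apply: le_Rintegral => //.
  - apply: integrableS integrable_semicircle_pdf => //.
  - apply: (@measurable_bounded_integrable _ _ R mu (cst 1) `]a, b]%classic mI mI') => //.
    by exists 1; split => // M M1 x _; rewrite /= normr1 ltW.
  - by move=> x _; case/andP: (semicircle_pdf_itv x).
by rewrite Rintegral_cst // mul1r [X in fine X](_ : _ = (b - a)%:E).
Qed.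

Lemma semicircle_df_left x : x <= -2 -> G x = 0.
Proof.
move=> x2; rewrite /semicircle_df (@eq_Rintegral _ _ _ mu _ (cst 0)) ?Rintegral_cst ?mul0r //.
move=> t; rewrite inE /= in_itv /= => tx; apply: semicircle_pdf_out.
by apply/negP => /andP[]; lra.
Qed.

Lemma semicircle_df_right x : 2 <= x -> G x = G 2.
Proof.
move=> x2; apply/eqP; rewrite -subr_eq0 semicircle_df_increment //.
rewrite (@eq_Rintegral _ _ _ mu _ (cst 0)) ?Rintegral_cst ?mul0r //.
move=> t; rewrite inE /= in_itv /= => /andP[t2 _]; apply: semicircle_pdf_out.
by apply/negP => /andP[]; lra.
Qed.

End Semicircle.

(** * Exponential moments of the counting function *)

Section Tails.
Context (R : realType) (n : nat) d (T : measurableType d) (P : probability T R).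
Variables (xi : 'I_n -> 'I_n -> {RV P >-> R}) (X : 'I_n -> T -> R) (sigma : R).
Hypothesis n_gt0 : (0 < n)%N.
Hypothesis indep : mutually_independent (@upper_pairs n) (fun jk => xi jk.1 jk.2).
Hypothesis xi_sym : forall (j k : 'I_n) (w : T), (j <= k)%N -> xi k j w = xi j k w.
Hypothesis X_eig : forall w : T, ordered_eigenvalues (normalized_matrix xi w) (X^~ w).
Hypothesis lsi : forall i, LSI sigma (coord_law (entries xi) i).
Hypothesis sigma0 : 0 < sigma.

Let U := upper_mass X.
Let EU x := \int[P]_w U x w.
Let Z := smooth_mass xi.

Let bU x : bounded_measurable (U x) := bm_upper_mass n_gt0 xi_sym X_eig x.
Let bZ x h : bounded_measurable (Z x h) := bm_smooth_mass xi x h.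

Let EZ_sandwich x h : 0 < h -> EU (x + h) <= \int[P]_w Z x h w <= EU x.
Proof.
move=> h0; apply/andP; split; apply: bm_int_le => // w.
  by have /andP[] := smooth_mass_sandwich n_gt0 xi_sym X_eig x w h0.
by have /andP[] := smooth_mass_sandwich n_gt0 xi_sym X_eig x w h0.
Qed.

Let exp_shift (lambda c : R) (f : T -> R) : bounded_measurable f ->
  \int[P]_w expR (lambda * f w) <= expR (lambda * c) ->
  \int[P]_w expR (lambda * (f w - c)) <= 1.
Proof.
move=> bf h; under eq_Rintegral => w _ do rewrite mulrBr expRD mulrC.
rewrite (bm_intZ P); last by apply: bm_expR; exact: bmZ.
apply: le_trans (ler_wpM2l (expR_ge0 _) h) _.
by rewrite -expRD addNr expR0.
Qed.

Section Level.
Variables (x h : R).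
Hypothesis h0 : 0 < h.
Let lambda := 2 * n%:R ^+ 2 * h ^+ 2 / (3 * sigma ^+ 2).

Let lambda0 : 0 <= lambda.
Proof. by apply: divr_ge0; [apply: mulr_ge0; [apply: mulr_ge0 => //|]|apply: mulr_ge0 => //]; exact: sqr_ge0. Qed.

(** The step at level x + h is swept down to level x; the second shift by h is
    the cost of comparing the smoothed counting function with the sharp one. *)
Lemma upper_mass_exp_lower : \int[P]_w expR (lambda * (EU (x + 2 * h) - U x w)) <= 1.
Proof.
have ct : taylor1 (fun t : R => - step t) (fun t => - step1 t).
  have [B [L [K [sB sL sK]]]] := @taylor1_step R; exists B, L, K.
  split => [t|t|s t]; rewrite ?normrN //.
  by rewrite (_ : _ - _ = - (step s - step t - (s - t) * step1 t)) ?normrN //; ring.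
have c1 (t : R) : - (3 / 2) <= - step1 t <= 0 by have := step1_itv t; lra.
have e (t y : R) : h^-1 * 1 * y + h^-1 * (t + - (x + h)) = h^-1 * y + - (h^-1 * (x + h - t)) by ring.
have sm t : (fun w => spectral_mean (n := n) (fun y => - step (h^-1 * 1 * y + h^-1 * (t + - (x + h))))
    (joint (entries xi) w)) = fun w => - Z (x + h - t) h w.
  apply/funext => w; rewrite /Z /smooth_mass /spectral_mean /trace_fun -mulrN -sumrN.
  by congr (_ * _); apply: eq_bigr => i _; rewrite /ramp e.
have := spectral_mean_exp_decrease n_gt0 (entries_indep indep) sigma0 lsi
  (s := 1) (- (x + h)) ct c1 (expr1n _ _) h0.
cbv zeta beta; under eq_Rintegral => w _ do rewrite (congr1 (fun f => f w) (sm h)).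
under [X in _ <= expR (_ * X) -> _]eq_Rintegral => w _ do rewrite (congr1 (fun f => f w) (sm 0)).
rewrite addrK subr0 -/lambda => hh.
apply: le_trans (exp_shift (bmN (bZ x h)) hh).
have b1 : bounded_measurable (fun w => expR (lambda * (EU (x + 2 * h) - U x w))).
  by apply: bm_expR; apply: bmZ; exact: bmB.
have b2 : bounded_measurable (fun w => expR (lambda * (- Z x h w - \int[P]_w (- Z (x + h) h w)))).
  by apply: bm_expR; apply: bmZ; apply: bmB => //; exact: bmN.
apply: (bm_int_le P b1 b2) => w; rewrite ler_expR ler_wpM2l // bm_intN //.
have /andP[z1 _] := EZ_sandwich (x + h) h0.
have /andP[_ z2] := smooth_mass_sandwich n_gt0 xi_sym X_eig x w h0.
rewrite (_ : x + 2 * h = x + h + h); last by ring.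
by rewrite /U /Z in z1 *; lra.
Qed.

(** The mirror image: the step at level x is swept up to level x + h. *)
Lemma upper_mass_exp_upper : \int[P]_w expR (lambda * (U (x + 2 * h) w - EU x)) <= 1.
Proof.
have ct : taylor1 (fun t : R => step (-1 * t + 0)) (fun t => -1 * step1 (-1 * t + 0)).
  exact: taylor1_affine (@taylor1_step R).
have c1 (t : R) : - (3 / 2) <= -1 * step1 (-1 * t + 0) <= 0 by have := step1_itv (-1 * t + 0); lra.
have e (t y : R) : -1 * (h^-1 * -1 * y + h^-1 * (t + x)) + 0 = h^-1 * y + - (h^-1 * (x + t)) by ring.
have sm t : (fun w => spectral_mean (n := n) (fun y => step (-1 * (h^-1 * -1 * y + h^-1 * (t + x)) + 0))
    (joint (entries xi) w)) = fun w => Z (x + t) h w.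
  apply/funext => w; rewrite /Z /smooth_mass /spectral_mean /trace_fun.
  by congr (_ * _); apply: eq_bigr => i _; rewrite /ramp e.
have s2 : (-1 : R) ^+ 2 = 1 by rewrite sqrrN expr1n.
have := spectral_mean_exp_decrease n_gt0 (entries_indep indep) sigma0 lsi x ct c1 s2 h0.
cbv zeta beta; under eq_Rintegral => w _ do rewrite (congr1 (fun f => f w) (sm h)).
under [X in _ <= expR (_ * X) -> _]eq_Rintegral => w _ do rewrite (congr1 (fun f => f w) (sm 0)).
rewrite addr0 -/lambda => hh.
apply: le_trans (exp_shift (bZ (x + h) h) hh).
have b1 : bounded_measurable (fun w => expR (lambda * (U (x + 2 * h) w - EU x))).
  by apply: bm_expR; apply: bmZ; exact: bmB.
have b2 : bounded_measurable (fun w => expR (lambda * (Z (x + h) h w - \int[P]_w (Z x h w)))).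
  by apply: bm_expR; apply: bmZ; exact: bmB.
apply: (bm_int_le P b1 b2) => w; rewrite ler_expR ler_wpM2l //.
have /andP[_ z1] := EZ_sandwich x h0.
have /andP[z2 _] := smooth_mass_sandwich n_gt0 xi_sym X_eig (x + h) w h0.
rewrite (_ : x + 2 * h = x + h + h); last by ring.
by rewrite /U /Z in z1 *; lra.
Qed.

End Level.
End Tails.

(** * From a grid of levels to the supremum *)

Section Grid.
Variables (R : realType) (Fn F : R -> R) (h D M : R).
Hypothesis h0 : 0 < h.
Hypothesis M0 : 0 <= M.
Hypothesis Fn_ndecr : forall x y, x <= y -> Fn x <= Fn y.
Hypothesis Fn_itv : forall x, 0 <= Fn x <= 1.
Hypothesis FD : forall x, `|F x - semicircle_df x| <= D.
Hypothesis D2 : 1 - semicircle_df 2 <= D.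

Let y k : R := -2 + k%:R * h.

Hypothesis Fn_above : forall k, (k < (Num.truncn (4 / h)).+2)%N -> Fn (y k) - F (y k + 2 * h) <= M.
Hypothesis Fn_below : forall k, (k < (Num.truncn (4 / h)).+2)%N -> F (y k - 2 * h) - Fn (y k) <= M.

(** Between two neighbouring levels of the grid the monotone function Fn is
    compared at the ends with F, and F with the semicircle function, which moves
    by at most 3 h over the three meshes involved. Outside [-2, 2] the semicircle
    function is constant. *)
Lemma kolmogorov_grid x : `|Fn x - semicircle_df x| <= D + 3 * h + M.
Proof.
set G := @semicircle_df R.
have core z : -2 <= z <= 2 -> `|Fn z - G z| <= D + 3 * h + M.
  move=> /andP[z1 z2]; pose k := Num.truncn ((z + 2) / h).
  have /andP[k1 k2] : k%:R <= (z + 2) / h < k.+1%:R.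
    by apply: truncn_itv; rewrite divr_ge0 ?(ltW h0) //; lra.
  have kn : (k <= Num.truncn (4 / h))%N.
    by apply: le_truncn; rewrite ler_pM2r ?invr_gt0 //; lra.
  have y1 : y k <= z by move: k1; rewrite ler_pdivlMr // /y; lra.
  have y2 : z < y k.+1 by move: k2; rewrite ltr_pdivrMr // /y; lra.
  have y3 : y k.+1 = y k + h by rewrite /y -natr1; ring.
  have f1 := Fn_above (k := k.+1); have f2 := Fn_below (k := k).
  have {}f1 := f1 kn; have {}f2 := f2 (leqW kn).
  have m1 := Fn_ndecr y1; have m2 := Fn_ndecr (ltW y2).
  have := FD (y k.+1 + 2 * h); have := FD (y k - 2 * h).
  rewrite !ler_norml => /andP[d1 d2] /andP[d3 d4].
  have /andP[_ g1] : 0 <= G (y k.+1 + 2 * h) - G z <= y k.+1 + 2 * h - z.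
    by apply: semicircle_df_lipschitz; lra.
  have /andP[_ g2] : 0 <= G z - G (y k - 2 * h) <= z - (y k - 2 * h).
    by apply: semicircle_df_lipschitz; lra.
  rewrite -/G in d1 d2 d3 d4; apply/andP; split; lra.
have [x2|x2] := leP x (-2).
  have := core (-2); have := Fn_ndecr x2; have /andP[+ _] := Fn_itv x.
  rewrite /G !semicircle_df_left // !subr0 => f0 f1.
  by rewrite !ger0_norm // ?(le_trans f0) // => h1; apply: (le_trans f1); apply: h1; apply/andP; split; lra.
have [x3|x3] := leP x 2; first by apply: core; rewrite (ltW x2).
have := core 2; have := Fn_ndecr (ltW x3); have /andP[_ f1] := Fn_itv x.
rewrite /G (semicircle_df_right (ltW x3)) !ler_norml => f2.
have -> : -2 <= (2 : R) <= 2 by apply/andP; split; lra.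
move=> /(_ isT) /andP[h1 h2]; have d2 := D2; apply/andP; split; first by lra.
apply: (le_trans (lerB f1 (lexx _))); apply: (le_trans d2).
by rewrite -addrA lerDl addr_ge0 // mulr_ge0 // ltW.
Qed.

End Grid.

(** Both integrals are suprema over simple minorants, hence no measurability. *)
Lemma ge0_integral_monotone d (T : measurableType d) (R : realType)
    (mu : {measure set T -> \bar R}) (f g : T -> \bar R) :
  (forall x, (0 <= f x)%E) -> (forall x, (f x <= g x)%E) ->
  (\int[mu]_x f x <= \int[mu]_x g x)%E.
Proof.
move=> f0 fg; rewrite !ge0_integralTE => [|x|//]; last exact: le_trans (fg x).
apply: ge_ereal_sup => _ [u /= uf <-]; apply: ereal_sup_ubound; exists u => //= x.
exact: le_trans (fg x).
Qed.

Section LogSumBound.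
Variables (R : realType) (I : finType) (a : I -> R) (lambda C : R).
Hypothesis lambda0 : 0 < lambda.
Hypothesis C0 : 0 < C.

(** A maximum is at most a log-sum-exp, and [expR] lies above its tangents. *)
Lemma max_le_sum_expR i : a i <= lambda^-1 * (ln C + C^-1 * \sum_j expR (lambda * a j)).
Proof.
rewrite ler_pdivlMl //.
have h : 1 + (lambda * a i - ln C) <= C^-1 * expR (lambda * a i).
  apply: le_trans (expR_ge1Dx _) _.
  by rewrite expRD expRN lnK ?posrE // mulrC.
have : C^-1 * expR (lambda * a i) <= C^-1 * \sum_j expR (lambda * a j).
  rewrite ler_pM2l ?invr_gt0 // (bigD1 i) //= lerDl.
  by apply: sumr_ge0 => j _; exact: expR_ge0.
lra.
Qed.

End LogSumBound.

(** * The bound under the logarithmic Sobolev inequality *)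

Lemma ln_nat_ge (R : realType) n : (2 <= n)%N -> 2^-1 <= ln n%:R :> R.
Proof.
move=> n2; have n0 : 0 < n%:R :> R by rewrite ltr0n ltnW.
rewrite -ler_expR lnK ?posrE //; apply: (@le_trans _ _ 2); last by rewrite ler_nat.
have h : 1 + - 2^-1 <= expR (- 2^-1 : R) := expR_ge1Dx _.
have e0 := expR_gt0 (2^-1 : R).
have : expR (2^-1 : R) * expR (- 2^-1) = 1 by rewrite -expRD subrr expR0.
have := ler_wpM2l (ltW e0) h; lra.
Qed.

(** With this h, lambda^-1 = (3 / 2) h / ln n. The number of grid levels is at most
    n^6, so its logarithm costs another multiple of h. *)
Lemma optimal_scale (R : realType) (n : nat) (sigma : R)
    (h := (sigma / n%:R) `^ (2 / 3) * ln n%:R `^ (1 / 3))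
    (lambda := 2 * n%:R ^+ 2 * h ^+ 2 / (3 * sigma ^+ 2))
    (m := (Num.truncn (4 / h)).+2) :
  (2 <= n)%N -> 0 < sigma -> 1 <= 2 * sigma ^+ 2 ->
  [/\ 0 < h, 0 < lambda
    & 3 * h + lambda^-1 * (ln (m * 2)%:R + 1) <= 16 * h].
Proof.
move=> n2 s0 s1; set L : R := ln n%:R; set x : R := n%:R.
have x2 : 2 <= x by rewrite ler_nat.
have x0 : 0 < x by lra.
have L2 : 2^-1 <= L := ln_nat_ge R n2.
have L0 : 0 < L by lra.
have h0 : 0 < h by rewrite mulr_gt0 // powR_gt0 // divr_gt0.
have h3 : h ^+ 3 = (sigma / x) ^+ 2 * L.
  rewrite /h exprMn powR_two_thirds ?divr_ge0 ?ltW //; congr (_ * _).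
  rewrite -powR_mulrn ?powR_ge0 // -powRrM (_ : 1 / 3 * 3%:R = 1) ?powRr1 ?ltW //.
  by field.
clearbody h.
have l0 : 0 < lambda by rewrite /lambda -/x; apply: divr_gt0; rewrite ?mulr_gt0 ?exprn_gt0.
have lV : lambda^-1 = 3 / 2 * h / L.
  rewrite (_ : 3 / 2 * h / L = 3 / 2 * h ^+ 3 / (L * h ^+ 2)); last by field; rewrite !gt_eqF.
  by rewrite h3 /lambda -/x; field; rewrite !gt_eqF.
split => //.
have x4 : 16 <= x ^+ 4.
  rewrite (_ : 16 = 2 ^+ 4); last by rewrite -natrX.
  by rewrite ler_pXn2r // nnegrE // ltW.
(* h >= n^-2, because sigma^2 and ln n are at least 1 / 2 *)
have xh : 1 <= x ^+ 2 * h.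
  rewrite leNgt; apply/negP => xh; have : (x ^+ 2 * h) ^+ 3 < 1.
    by rewrite exprn_ilt1 // mulr_ge0 ?exprn_ge0 // ltW.
  rewrite exprMn h3 (_ : (x ^+ 2) ^+ 3 * ((sigma / x) ^+ 2 * L) = x ^+ 4 * (sigma ^+ 2 * L)); last by field; rewrite gt_eqF.
  have sL : 1 / 4 <= sigma ^+ 2 * L.
    rewrite (_ : 1 / 4 = 2^-1 * 2^-1); last by field.
    by apply: ler_pM => //; lra.
  have : 16 * (1 / 4) <= x ^+ 4 * (sigma ^+ 2 * L) by apply: ler_pM.
  lra.
have hV : h^-1 <= x ^+ 2 by rewrite -[h^-1]mul1r ler_pdivrMr.
have N0 : 0 < (m * 2)%:R :> R by rewrite ltr0n.
have Nn : (m * 2)%:R <= x ^+ 6.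
  have t : (Num.truncn (4 / h))%:R <= 4 / h by rewrite truncn_le divr_ge0 // ltW.
  rewrite natrM /m -addn2 natrD.
  apply: (@le_trans _ _ (16 * x ^+ 2)).
    have : 4 <= x ^+ 2 by rewrite expr2; nra.
    lra.
  by rewrite (_ : x ^+ 6 = x ^+ 4 * x ^+ 2) ?ler_pM2r ?exprn_gt0 // -exprD.
have lnN : ln (m * 2)%:R <= 6 * L.
  apply: (@le_trans _ _ (ln (x ^+ 6))); first by rewrite ler_ln ?posrE // exprn_gt0.
  by rewrite lnXn // mulr_natl.
rewrite lV; have : 3 / 2 * h / L * (ln (m * 2)%:R + 1) <= 3 / 2 * h / L * (8 * L).
  apply: ler_wpM2l; last by lra.
  by rewrite divr_ge0 ?(ltW L0) // mulr_ge0 // ltW.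
rewrite [X in _ <= X](_ : _ = 12 * h); first by lra.
by field; rewrite gt_eqF.
Qed.

Lemma kolmogorov_dist_ge0 (R : realType) (F1 F2 : R -> R) : (0 <= kolmogorov_dist F1 F2)%E.
Proof.
apply: (@le_trans _ _ `|F1 0 - F2 0|%:E); first by rewrite lee_fin.
by apply: ereal_sup_ubound; exists 0.
Qed.

Section KolmogorovLSI.
Context (R : realType) (n : nat) d (T : measurableType d) (P : probability T R).
Variables (xi : 'I_n -> 'I_n -> {RV P >-> R}) (X : 'I_n -> T -> R) (sigma : R).
Hypothesis n_ge2 : (2 <= n)%N.
Hypothesis indep : mutually_independent (@upper_pairs n) (fun jk => xi jk.1 jk.2).
Hypothesis xi_sym : forall (j k : 'I_n) (w : T), (j <= k)%N -> xi k j w = xi j k w.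
Hypothesis X_eig : forall w : T, ordered_eigenvalues (normalized_matrix xi w) (X^~ w).
Hypothesis xi_mean : forall j k : 'I_n, (j <= k)%N -> ('E_P[xi j k] = 0)%E.
Hypothesis xi_var : forall j k : 'I_n, (j <= k)%N -> ('V_P[xi j k] = 1)%E.
Hypothesis sigma0 : 0 <= sigma.
Hypothesis lsi : forall i, LSI sigma (coord_law (entries xi) i).

Let n_gt0 : (0 < n)%N. Proof. exact: ltnW. Qed.
Let U := upper_mass X.
Let EU x := \int[P]_w U x w.
Let F := mean_empirical_df P X.
Let G := @semicircle_df R.

Let bU x : bounded_measurable (U x) := bm_upper_mass n_gt0 xi_sym X_eig x.
Let FE x : F x = 1 - EU x. Proof. exact: mean_empirical_dfE n_gt0 xi_sym X_eig x. Qed.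

Lemma mean_upper_mass_cvg0 : EU k%:R @[k --> \oo] --> (0 : R).
Proof.
rewrite -(prob_int_cst P 0); apply: (bounded_convergence (B := 1)) => [k|k w|w].
- by have [] := bU k%:R.
- by have /andP[u0 u1] := upper_mass_itv X n_gt0 k%:R w; rewrite ger0_norm.
- apply: cvg_near_cst; near=> k; apply/eqP.
  rewrite /U /upper_mass big1 ?mulr0 // => i _.
  suff : X i w <= k%:R by rewrite leNgt => /negPf ->.
  apply: (@le_trans _ _ (\sum_j `|X j w|)); last by near: k; exact: nbhs_infty_ger.
  rewrite (bigD1 i) //= -[leLHS]addr0 lerD ?ler_norm //.
  by apply: sumr_ge0.
Unshelve. all: end_near. Qed.

(** At large levels F is close to 1 while the semicircle function has reached its
    final value. *)
Lemma semicircle_tail r : (forall x, `|F x - G x| <= r) -> 1 - G 2 <= r.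
Proof.
move=> FG; have c : 1 - G 2 - EU k%:R @[k --> \oo] --> 1 - G 2 - 0.
  by apply: cvgB; [exact: cvg_cst | exact: mean_upper_mass_cvg0].
rewrite -[leLHS]subr0; apply: (cvgr_to_le c); near=> k.
have k2 : 2 <= k%:R :> R by near: k; exact: nbhs_infty_ger.
have := FG k%:R; rewrite FE ler_norml /G (semicircle_df_right k2) => /andP[_].
lra.
Unshelve. all: end_near. Qed.

Theorem kolmogorov_LSI :
  (\int[P]_w kolmogorov_dist (empirical_df (X^~ w)) G <=
   (16 * (sigma / n%:R) `^ (2 / 3) * ln n%:R `^ (1 / 3))%:E + kolmogorov_dist F G)%E.
Proof.
have s1 : 1 <= 2 * sigma ^+ 2.
  apply: (entries_gap_ge1 n_gt0 xi_mean xi_var) => [|i]; first by rewrite mulr_ge0 // sqr_ge0.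
  exact: spectral_gap_LSI.
have sp : 0 < sigma.
  rewrite lt_def sigma0 andbT; apply/eqP => s0; move: s1.
  by rewrite s0 expr0n mulr0 ler10.
have [h0 l0 hb] := optimal_scale n_ge2 sp s1.
rewrite -mulrA; set h := _ `^ _ * _ in h0 l0 hb *.
set lambda := 2 * n%:R ^+ 2 * h ^+ 2 / _ in l0 hb; set m := (Num.truncn (4 / h)).+2 in hb.
case E : (kolmogorov_dist F G) => [r||]; last first.
- by have := kolmogorov_dist_ge0 F G; rewrite E leNgt ltNy0.
- by rewrite addey // leey.
have FG x : `|F x - G x| <= r.
  by rewrite -lee_fin -E; apply: ereal_sup_ubound; exists x.
pose y (k : nat) : R := -2 + k%:R * h.
(* the deviations at the levels of the grid, in both directions *)
pose a w (i : 'I_m * bool) := if i.2 then EU (y i.1 + 2 * h) - U (y i.1) w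
  else U (y i.1) w - EU (y i.1 - 2 * h).
pose C : R := (m * 2)%:R; have C0 : 0 < C by rewrite ltr0n.
pose M w := lambda^-1 * (ln C + C^-1 * \sum_i expR (lambda * a w i)).
have bE i : bounded_measurable (fun w => expR (lambda * a w i)).
  by apply: bm_expR; apply: bmZ; rewrite /a; case: (i.2); exact: bmB.
have bS : bounded_measurable (fun w => \sum_i expR (lambda * a w i)) by exact: bm_sum.
have bM : bounded_measurable M.
  by apply: bmZ; apply: bmD => //; exact: bmZ.
have M0 w : 0 <= M w.
  rewrite mulr_ge0 ?invr_ge0 ?(ltW l0) // addr_ge0 ?ln_ge0 ?ler1n //.
  by rewrite mulr_ge0 ?invr_ge0 ?(ltW C0) // sumr_ge0 // => i _; exact: expR_ge0.
have pt w : (kolmogorov_dist (empirical_df (X^~ w)) G <= (r + 3 * h + M w)%:E)%E.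
  apply: ge_ereal_sup => _ [x _ <-]; rewrite lee_fin.
  apply: (kolmogorov_grid (F := F) h0 (M0 w)) => //.
  - move=> u v uv; rewrite !empirical_dfE // lerD2l lerN2; exact: upper_mass_nincr.
  - move=> u; rewrite empirical_dfE //; have /andP[u0 u1] := upper_mass_itv X n_gt0 u w.
    by apply/andP; split; lra.
  - exact: semicircle_tail.
  - move=> k km; have := max_le_sum_expR (a w) l0 C0 (Ordinal km, true).
    by rewrite -/(M w) /a /= empirical_dfE // FE -/U -/(y k); lra.
  - move=> k km; have := max_le_sum_expR (a w) l0 C0 (Ordinal km, false).
    by rewrite -/(M w) /a /= empirical_dfE // FE -/U -/(y k); lra.
apply: le_trans (ge0_integral_monotone (P : {measure set T -> \bar R})
  (fun w => kolmogorov_dist_ge0 _ _) pt) _.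
have bR : bounded_measurable (fun w => r + 3 * h + M w) by exact: bmD.
rewrite -(bm_EFin P bR) -EFinD lee_fin (bm_intD P (bm_cst T _) bM) prob_int_cst.
have -> : \int[P]_w M w = lambda^-1 * (ln C + C^-1 * \sum_i \int[P]_w expR (lambda * a w i)).
  rewrite (bm_intZ P) ?(bm_intD P (bm_cst T _)) ?prob_int_cst ?(bm_intZ P) ?(bm_int_sum P) //.
  - exact: bmZ.
  - by apply: bmD => //; exact: bmZ.
have e1 i : \int[P]_w expR (lambda * a w i) <= 1.
  rewrite /a; case: (i.2); first exact: (upper_mass_exp_lower n_gt0 indep xi_sym X_eig lsi sp (y i.1) h0).
  have := upper_mass_exp_upper n_gt0 indep xi_sym X_eig lsi sp (y i.1 - 2 * h) h0.
  by rewrite subrK.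
have : lambda^-1 * (ln C + C^-1 * \sum_i \int[P]_w expR (lambda * a w i)) <= lambda^-1 * (ln C + 1).
  rewrite ler_pM2l ?invr_gt0 // lerD2l ler_pdivrMl // mulr1.
  apply: le_trans (ler_sum _ (fun i _ => e1 i)) _.
  by rewrite sumr_const card_prod card_ord card_bool.
rewrite -/C in hb; lra.
Qed.

End KolmogorovLSI.

Theorem theorem1p3 (R : realType) :
  exists C : R, 0 < C /\
  forall (n : nat) (d : measure_display) (T : measurableType d)
    (P : probability T R) (xi : 'I_n -> 'I_n -> {RV P >-> R})
    (X : 'I_n -> T -> R) (sigma : R),
    (2 <= n)%N ->
    mutually_independent [set jk : 'I_n * 'I_n | (jk.1 <= jk.2)%N]%SET
      (fun jk => xi jk.1 jk.2) ->
    (forall j k : 'I_n, (j <= k)%N -> ('E_P[xi j k] = 0)%E) ->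
    (forall j k : 'I_n, (j <= k)%N -> ('V_P[xi j k] = 1)%E) ->
    (forall (j k : 'I_n) (w : T), (j <= k)%N -> xi k j w = xi j k w) ->
    (forall w : T, ordered_eigenvalues (normalized_matrix xi w) (X^~ w)) ->
    0 <= sigma ->
    let Fn (w : T) : R -> R := empirical_df (X^~ w) in
    let F : R -> R := mean_empirical_df P X in
    let G : R -> R := @semicircle_df R in
    ((forall j k : 'I_n, (j <= k)%N -> PI sigma (distribution P (xi j k))) ->
      (\int[P]_w \int[lebesgue_measure]_x `|Fn w x - F x|%:E <=
         (C * sigma / n%:R `^ (2 / 3))%:E)%E) /\
    ((forall j k : 'I_n, (j <= k)%N -> LSI sigma (distribution P (xi j k))) ->
      (\int[P]_w kolmogorov_dist (Fn w) G <=
         (C * (sigma / n%:R) `^ (2 / 3) * ln n%:R `^ (1 / 3))%:E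
           + kolmogorov_dist F G)%E).
Proof.
exists 16; split=> // n d T P xi X sigma n2 indep mean var sym eig s0 Fn F G.
have le_pair (i : 'I_#|@upper_pairs n|) : ((upper_pair i).1 <= (upper_pair i).2)%N.
  by have := enum_valP i; rewrite inE.
split=> ineq.
  by apply: (mean_variation_PI (ltnW n2) indep sym eig mean var s0) => i; exact: ineq.
by apply: (kolmogorov_LSI n2 indep sym eig mean var s0) => i; exact: ineq.
Qed.
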